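(* Let $K$ be a field, $Q$ a quiver of type $\mathbb{A}_n$ with arrows $\alpha_1,\dots,\alpha_{n-1}$, and $\Lambda=KQ/I$ with $I$ an admissible ideal of $KQ$ (possibly $I=0$). (1) For any irreducible morphism $f$ between indecomposable modules in $\mathrm{mod}\,\Lambda$, the following statements are equivalent. (1.1) $f$ is a monomorphism. (1.2) There exists an irreducible monomorphism $f_1:X\to P(i)$, for some $i$, with $X$ indecomposable such that $C(f)=C(f_1)=P(j)$ for some $1\le j\le n$. (1.3) There exists an almost split sequence $0\to M(U_{\alpha_i})\xrightarrow{f_2}M(N_{\alpha_i})\to M(V_{\alpha_i})\to 0$ in $\mathrm{mod}\,\Lambda$, for some $1\le i\le n-1$, such that $C(f)=C(f_2)=P(j)$ for some $1\le j\le n$. (2) For any irreducible morphism $g$ between indecomposable modules in $\mathrm{mod}\,\Lambda$, the following statements are equivalent. (2.1) $g$ is an epimorphism. (2.2) There exists a unique (up to isomorphism) irreducible epimorphism $g_1:I(i)\to Y$, for some $i$, with $Y$ indecomposable such that $C(g)=C(g_1)$. (2.3) There exists a unique (up to isomorphism) almost split sequence $0\to M(U_{\alpha_i})\to M(N_{\alpha_i})\xrightarrow{g_2}M(V_{\alpha_i})\to 0$ in $\mathrm{mod}\,\Lambda$, with $1\le i\le n-1$, such that $C(g)=C(g_2)=\tau^{-1}\mathrm{Ker}\,g_2=M(V_{\alpha_i})$, which is a non-zero non-projective indecomposable module. (Equalities of modules are up to isomorphism.)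
   Context: A quiver $Q$ is of type $\mathbb{A}_n$ if its underlying unoriented graph is the Dynkin diagram $1 - 2 - \cdots - n$; the arrow $\alpha_i$ joins $i$ and $i+1$, with arbitrary orientation. For an arrow $\alpha$, $s(\alpha)$ and $e(\alpha)$ are its starting and end points. $\mathrm{mod}\,\Lambda$ is the category of finitely generated left $\Lambda$-modules; paths are composed from right to left, so left modules are representations of $Q$ satisfying the relations in $I$. $P(i)$, $I(i)$, $S(i)$ are the indecomposable projective, injective and simple modules at vertex $i$; $\tau$ is the Auslander–Reiten translation. Minimal right determiner: an indecomposable projective module $P$ almost factors through $f:M\to N$ if there are morphisms $u:\mathrm{rad}\,P\to M$ and $h:P\to N$ with $h\iota=fu$, where $\iota:\mathrm{rad}\,P\to P$ is the inclusion, such that $\mathrm{Im}\,h\not\subseteq \mathrm{Im}\,f$. For an irreducible morphism $f$ between indecomposables, the minimal right determiner is $C(f)=\tau^{-1}\mathrm{Ker}\,f\oplus(\bigoplus P_i)$, where the $P_i$ are the pairwise non-isomorphic indecomposable projective modules almost factoring through $f$. Strings: for an arrow $\beta$ let $\beta^{-1}$ be a formal inverse with $s(\beta^{-1})=e(\beta)$, $e(\beta^{-1})=s(\beta)$, $(\beta^{-1})^{-1}=\beta$. A string of length $m\ge 1$ is a word $c_1\cdots c_m$ with each $c_i$ an arrow or a formal inverse of an arrow, $s(c_i)=e(c_{i+1})$, $c_{i+1}\neq c_i^{-1}$, such that no subword $c_i\cdots c_{i+t}$ nor its inverse belongs to $I$; $s(c_1\cdots c_m)=s(c_m)$, $e(c_1\cdots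 c_m)=e(c_1)$. Strings of length $0$ are the trivial paths $\epsilon_i$ at the vertices and their inverses. A string is direct if all its letters are arrows, inverse if its inverse is direct; length-$0$ strings are both. A string $\omega$ ends on a peak if there is no arrow $\alpha$ with $\alpha^{-1}\omega$ a string; it starts in a deep if there is no arrow $\beta$ with $\omega\beta^{-1}$ a string. For a string $\omega$, $M(\omega)$ is the indecomposable representation with $K$ at every vertex between $s(\omega)$ and $e(\omega)$ (inclusive), identity maps on the arrows between them, and zero elsewhere. For each arrow $\alpha$, $N_\alpha=U_\alpha\,\alpha\,V_\alpha$ is the unique string with $U_\alpha,V_\alpha$ both inverse such that $N_\alpha$ starts in a deep and ends on a peak. It is known that $0\to M(U_{\alpha})\to M(N_{\alpha})\to M(V_{\alpha})\to 0$ is an almost split sequence for every arrow $\alpha$, and that these $n-1$ sequences are all the almost split sequences in $\mathrm{mod}\,\Lambda$ with indecomposable middle term. *)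

(* Defs.v *)
From HB Require Import structures.
From mathcomp Require Import all_boot all_order all_algebra.

Set Implicit Arguments.
Unset Strict Implicit.
Unset Printing Implicit Defensive.

Import GRing.Theory.
Local Open Scope ring_scope.

(* A quiver with underlying graph 0 - 1 - ... - n (that is, of type A_(n+1),
   with n arrows) is given by its orientation o: the arrow a joins the vertices
   a and a+1, and points from a+1 to a exactly when o a holds. *)
Section Quiver.
Variables (n : nat) (o : 'I_n -> bool).

Definition src (a : 'I_n) : 'I_n.+1 :=
  if o a then lift ord0 a else widen_ord (leqnSn n) a.
Definition tgt (a : 'I_n) : 'I_n.+1 :=
  if o a then widen_ord (leqnSn n) a else lift ord0 a.

(* Words c_1 ... c_m in letters with a source s and an end e compose from right
   to left.  The starting vertex i is recorded separately, since an empty word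
   does not determine it. *)
Definition word_end (T : Type) (e : T -> 'I_n.+1) (i : 'I_n.+1) (w : seq T) :=
  if w is c :: _ then e c else i.

Fixpoint is_walk (T : Type) (s e : T -> 'I_n.+1) (i : 'I_n.+1) (w : seq T) :=
  if w is c :: w' then (s c == word_end e i w') && is_walk s e i w' else true.

(* Each path of a quiver of type A_(n+1) has length at most n, so the bound on
   the length of the words does not exclude any path. *)
Definition qpath := {p : 'I_n.+1 * n.-bseq 'I_n | is_walk src tgt p.1 p.2}.
Definition pstart (p : qpath) : 'I_n.+1 := (val p).1.
Definition pword (p : qpath) : seq 'I_n := (val p).2.
Definition pend (p : qpath) : 'I_n.+1 := word_end tgt (pstart p) (pword p).

(* Letters: (a, false) is the arrow a and (a, true) its formal inverse. *)
Definition letter := ('I_n * bool)%type.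
Definition lsrc (c : letter) := if c.2 then tgt c.1 else src c.1.
Definition ltgt (c : letter) := if c.2 then src c.1 else tgt c.1.
Definition linv (c : letter) : letter := (c.1, ~~ c.2).

End Quiver.

Arguments letter n : clear implicits.

Section PathAlgebra.
Variables (K : fieldType) (n : nat) (o : 'I_n -> bool).

Definition path_alg := {ffun qpath o -> K^o}.
HB.instance Definition _ := Vector.on path_alg.

Definition pmul (x y : path_alg) : path_alg :=
  [ffun p : qpath o => \sum_(q : qpath o) \sum_(r : qpath o |
     [&& pstart q == pend r, pstart p == pstart r
       & pword p == pword q ++ pword r]) x q * y r].

Definition pelt (p : qpath o) : path_alg := [ffun q => (q == p)%:R].

(* The basis elements given by the trivial path at i and by the arrow a. *)
Definition pidem (i : 'I_n.+1) : path_alg :=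
  [ffun q => ((pstart q == i) && (pword q == [::]))%:R].
Definition parrow (a : 'I_n) : path_alg := [ffun q => (pword q == [:: a])%:R].

(* The m-th power of the arrow ideal is spanned by the paths of length >= m. *)
Definition in_arrow_pow (m : nat) (x : path_alg) : Prop :=
  forall p, (size (pword p) < m)%N -> x p = 0.

Definition two_sided_ideal (I : {vspace path_alg}) : Prop :=
  forall x y, y \in I -> pmul x y \in I /\ pmul y x \in I.

Definition admissible (I : {vspace path_alg}) : Prop :=
  two_sided_ideal I /\
  exists2 m, (2 <= m)%N &
    (forall x, in_arrow_pow m x -> x \in I) /\
    (forall x, x \in I -> in_arrow_pow 2 x).

(* The quotient K Q / I, carried by a linear complement of I in K Q; bclass is
   the canonical projection, with kernel I. *)
Definition bound_alg (I : {vspace path_alg}) : vectType K := subvs_of (I^C)%VS.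
Definition bclass (I : {vspace path_alg}) (x : path_alg) : bound_alg I :=
  vsproj (I^C)%VS (daddv_pi (I^C)%VS I x).
Definition bmul (I : {vspace path_alg}) (x y : bound_alg I) : bound_alg I :=
  bclass I (pmul (vsval x) (vsval y)).

(* e_j Lambda e_i *)
Definition peirce (I : {vspace path_alg}) (j i : 'I_n.+1) :
    {vspace bound_alg I} :=
  limg (linfun (fun x : bound_alg I =>
    bmul (bmul (bclass I (pidem j)) x) (bclass I (pidem i)))).

End PathAlgebra.

(* Finite-dimensional representations of the quiver. *)
Record rep (K : fieldType) (n : nat) (o : 'I_n -> bool) := Rep {
  rsp :> 'I_n.+1 -> vectType K;
  rmap : forall a : 'I_n, 'Hom(rsp (src o a), rsp (tgt o a))
}.
Arguments Rep {K n o} rsp rmap.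
Arguments rmap {K n o} M a : rename.

Record rhom (K : fieldType) (n : nat) (o : 'I_n -> bool) (M N : rep K o) := RHom {
  hmap :> forall i : 'I_n.+1, 'Hom(M i, N i);
  _ : forall a, (rmap N a \o hmap (src o a) = hmap (tgt o a) \o rmap M a)%VF
}.

Section Representations.
Variables (K : fieldType) (n : nat) (o : 'I_n -> bool).
Implicit Types C D J L M N P R T X Y : rep K o.

Definition single M (i : 'I_n.+1) (x : M i) : forall j, M j :=
  dfwith (fun j => 0 : M j) x.

(* The action of a path on the direct sum of the spaces M i. *)
Definition path_act M (p : qpath o) (v : forall i, M i) : forall i, M i :=
  foldr (fun a u => single (rmap M a (u (src o a))))
        (single (v (pstart p))) (pword p).

(* mod Lambda: the representations satisfying the relations in I. *)
Definition in_mod (I : {vspace path_alg K o}) M : Prop :=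
  forall x, x \in I -> forall (v : forall i, M i) j,
    \sum_(p : qpath o) x p *: path_act p v j = 0.

Definition mono M N (f : rhom M N) : Prop := forall i, lker (f i) = 0%VS.
Definition epi M N (f : rhom M N) : Prop := forall i, limg (f i) = fullv.
Definition split_mono M N (f : rhom M N) : Prop :=
  exists g : rhom N M, forall i, (g i \o f i = \1)%VF.
Definition split_epi M N (f : rhom M N) : Prop :=
  exists g : rhom N M, forall i, (f i \o g i = \1)%VF.
Definition iso M N (f : rhom M N) : Prop :=
  exists g : rhom N M,
    forall i, (g i \o f i = \1)%VF /\ (f i \o g i = \1)%VF.
Definition isomorphic M N : Prop := exists f : rhom M N, iso f.

Definition short_exact L M N (f : rhom L M) (g : rhom M N) : Prop :=
  [/\ mono f, epi g & forall i, limg (f i) = lker (g i)].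

Definition zero_rep : rep K o :=
  Rep (fun i => 'rV[K]_0 : vectType K) (fun a => 0).
Definition dsum M N : rep K o :=
  Rep (fun i => (M i * N i)%type : vectType K)
      (fun a => linfun (fun u => (rmap M a u.1, rmap N a u.2))).
Definition kernel M N (f : rhom M N) : rep K o :=
  Rep (fun i => subvs_of (lker (f i)) : vectType K)
      (fun a => linfun (fun u => vsproj (lker (f (tgt o a)))
                                        (rmap M a (vsval u)))).

Definition is_zero M : Prop := forall i, fullv = 0%VS :> {vspace M i}.
Definition indecomposable M : Prop :=
  ~ is_zero M /\
  forall X Y, isomorphic M (dsum X Y) -> is_zero X \/ is_zero Y.

Section ModLambda.
Variable I : {vspace path_alg K o}.

Definition projective P : Prop :=
  in_mod I P /\
  forall X Y (g : rhom X Y) (h : rhom P Y), in_mod I X -> in_mod I Y -> epi g ->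
    exists h' : rhom P X, forall i, (g i \o h' i = h i)%VF.
Definition injective_rep J : Prop :=
  in_mod I J /\
  forall X Y (g : rhom X Y) (h : rhom X J), in_mod I X -> in_mod I Y -> mono g ->
    exists h' : rhom Y J, forall i, (h' i \o g i = h i)%VF.

(* P(i) = Lambda e_i *)
Definition proj_at (i : 'I_n.+1) : rep K o :=
  Rep (fun j => subvs_of (peirce I j i) : vectType K)
      (fun a => linfun (fun x => vsproj (peirce I (tgt o a) i)
                          (bmul (bclass I (parrow K o a)) (vsval x)))).

(* x |-> x a, from e_i Lambda e_(tgt a) to e_i Lambda e_(src a) *)
Definition rmul_arrow (i : 'I_n.+1) (a : 'I_n) :
    subvs_of (peirce I i (tgt o a)) -> subvs_of (peirce I i (src o a)) :=
  fun x => vsproj _ (bmul (vsval x) (bclass I (parrow K o a))).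
(* x |-> a x, from e_(src a) Lambda e_k to e_(tgt a) Lambda e_k *)
Definition lmul_arrow (k : 'I_n.+1) (a : 'I_n) :
    subvs_of (peirce I (src o a) k) -> subvs_of (peirce I (tgt o a) k) :=
  fun x => vsproj _ (bmul (bclass I (parrow K o a)) (vsval x)).

(* I(i) = Hom_K(e_i Lambda, K) *)
Definition inj_at (i : 'I_n.+1) : rep K o :=
  Rep (fun j => 'Hom(subvs_of (peirce I i j), K^o) : vectType K)
      (fun a => linfun (fun phi : 'Hom(subvs_of (peirce I i (src o a)), K^o) =>
                          (phi \o linfun (@rmul_arrow i a))%VF)).

(* The map I(tgt a) -> I(src a) dual to left multiplication by a. *)
Definition inj_arrow (a : 'I_n) (k : 'I_n.+1) :
    'Hom(inj_at (tgt o a) k, inj_at (src o a) k) :=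
  linfun (fun phi : 'Hom(subvs_of (peirce I (tgt o a) k), K^o) =>
            (phi \o linfun (@lmul_arrow k a))%VF
              : 'Hom(subvs_of (peirce I (src o a) k), K^o)).

Definition injective_envelope M J (f : rhom M J) : Prop :=
  [/\ injective_rep J, mono f &
      forall X (h : rhom J X) (hf : rhom M X), in_mod I X ->
        (forall i, (h i \o f i = hf i)%VF) -> mono hf -> mono h].

(* 0 -> M -f-> I0 -jp-> I1 is a minimal injective copresentation, with
   C = Coker f. *)
Definition min_inj_copres M I0 C I1 (f : rhom M I0) (p : rhom I0 C)
    (j : rhom C I1) : Prop :=
  [/\ injective_envelope f, short_exact f p & injective_envelope j].

(* T is isomorphic to tau^{-1} M, i.e. to the cokernel of the map
   nu^{-1} I0 -> nu^{-1} I1 induced by a minimal injective copresentation of M.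
   Here nu^{-1} X = Hom(D Lambda, X) is the inverse Nakayama functor: its space
   at the vertex i is Hom(I(i), X), and an arrow a acts by composition with
   I(tgt a) -> I(src a).  The maps pi i : Hom(I(i), I1) -> T i exhibit T as this
   cokernel. *)
Definition is_tau_inv M T : Prop :=
  exists (I0 C I1 : rep K o) (f : rhom M I0) (p : rhom I0 C) (j : rhom C I1)
         (pi : forall i, rhom (inj_at i) I1 -> T i),
    min_inj_copres f p j /\
    [/\ forall i (c : K) (phi psi chi : rhom (inj_at i) I1),
          (forall k, chi k = c *: phi k + psi k) ->
          pi i chi = c *: pi i phi + pi i psi,
        forall i (t : T i), exists phi, pi i phi = t,
        forall i phi, pi i phi = 0 <->
          exists psi : rhom (inj_at i) I0,
            forall k, (phi k = (j k \o p k) \o psi k)%VF &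
        forall a (phi : rhom (inj_at (src o a)) I1)
            (psi : rhom (inj_at (tgt o a)) I1),
          (forall k, (psi k = phi k \o inj_arrow a k)%VF) ->
          rmap T a (pi (src o a) phi) = pi (tgt o a) psi].

Definition stable M (U : forall i, {vspace M i}) : Prop :=
  forall a, (rmap M a @: U (src o a) <= U (tgt o a))%VS.
Definition maximal_sub M (U : forall i, {vspace M i}) : Prop :=
  [/\ stable U, ~ (forall i, U i = fullv) &
      forall W : forall i, {vspace M i}, stable W ->
        (forall i, (U i <= W i)%VS) ->
        (forall i, W i = U i) \/ (forall i, W i = fullv)].

(* iota : R -> M is (up to isomorphism) the inclusion of rad M, the
   intersection of the maximal subrepresentations of M. *)
Definition is_radical M R (iota : rhom R M) : Prop :=
  mono iota /\
  forall i v, v \in limg (iota i) <->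
    forall U : forall i, {vspace M i}, maximal_sub U -> v \in U i.

Definition almost_factors P M N (f : rhom M N) : Prop :=
  exists (R : rep K o) (iota : rhom R P) (u : rhom R M) (h : rhom P N),
    [/\ is_radical iota, forall i, (h i \o iota i = f i \o u i)%VF &
        ~ (forall i, (limg (h i) <= limg (f i))%VS)].

Definition indec_projective P : Prop := projective P /\ indecomposable P.

(* D is isomorphic to tau^{-1} (Ker f) (+) P_0 (+) ... (+) P_(m-1), where the
   P_k represent without repetition the isomorphism classes of indecomposable
   projectives almost factoring through f. *)
Definition is_min_det M N (f : rhom M N) D : Prop :=
  exists (T : rep K o) (m : nat) (P : 'I_m -> rep K o),
    [/\ is_tau_inv (kernel f) T,
        forall k, indec_projective (P k) /\ almost_factors (P k) f,
        forall k l, isomorphic (P k) (P l) -> k = l,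
        forall X, indec_projective X -> almost_factors X f ->
          exists k, isomorphic X (P k) &
        isomorphic D (dsum T (\big[dsum/zero_rep]_(k < m) P k))].

Definition irreducible M N (f : rhom M N) : Prop :=
  [/\ in_mod I M, in_mod I N, ~ split_mono f, ~ split_epi f &
      forall X (h : rhom M X) (g : rhom X N), in_mod I X ->
        (forall i, (f i = g i \o h i)%VF) -> split_mono h \/ split_epi g].

Definition left_almost_split L M (f : rhom L M) : Prop :=
  ~ split_mono f /\
  forall X (h : rhom L X), in_mod I X -> ~ split_mono h ->
    exists h' : rhom M X, forall i, (h' i \o f i = h i)%VF.
Definition right_almost_split M N (g : rhom M N) : Prop :=
  ~ split_epi g /\
  forall X (h : rhom X N), in_mod I X -> ~ split_epi h ->
    exists h' : rhom X M, forall i, (g i \o h' i = h i)%VF.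

Definition almost_split_seq L M N (f : rhom L M) (g : rhom M N) : Prop :=
  [/\ [/\ in_mod I L, in_mod I M & in_mod I N], short_exact f g,
      left_almost_split f & right_almost_split g].

(* w, with starting vertex i, is a string.  The trivial path at a vertex and its
   inverse are not distinguished. *)
Definition is_string (i : 'I_n.+1) (w : seq (letter n)) : bool :=
  [&& is_walk (lsrc o) (ltgt o) i w,
      sorted (fun c d => d != linv c) w &
      [forall q : qpath o, (pelt K q \in I) ==>
        let d := [seq (a, false) | a <- pword q] in
        ~~ infix d w && ~~ infix (rev (map (@linv n) d)) w]].

Definition inverse_word (w : seq (letter n)) : bool := all snd w.

Definition ends_on_peak (i : 'I_n.+1) (w : seq (letter n)) : bool :=
  [forall a, ~~ is_string i ((a, true) :: w)].
(* The starting vertex of w b^-1 is tgt b. *)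
Definition starts_in_deep (i : 'I_n.+1) (w : seq (letter n)) : bool :=
  [forall b, (src o b == i) ==> ~~ is_string (tgt o b) (rcons w (b, true))].

(* U_a = u with starting vertex tgt a, V_a = v with starting vertex i, and
   N_a = u a v. *)
Definition is_UNV (a : 'I_n) (u : seq (letter n)) (i : 'I_n.+1)
    (v : seq (letter n)) : Prop :=
  let w := u ++ (a, false) :: v in
  [/\ is_string (tgt o a) u /\ inverse_word u,
      is_string i v /\ inverse_word v,
      is_string i w, starts_in_deep i w & ends_on_peak i w].

(* M(w) for the string w with starting vertex i. *)
Definition between (i j k : 'I_n.+1) : bool := (minn i j <= k <= maxn i j)%N.
Definition string_rep (i : 'I_n.+1) (w : seq (letter n)) : rep K o :=
  let b k := between i (word_end (ltgt o) i w) k in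
  Rep (fun k => 'rV[K]_(b k) : vectType K)
      (fun a => linfun (mulmxr (const_mx 1 : 'M[K]_(b (src o a), b (tgt o a))))).

Definition U_rep (a : 'I_n) (u : seq (letter n)) := string_rep (tgt o a) u.
Definition N_rep (a : 'I_n) (u : seq (letter n)) (i : 'I_n.+1)
  (v : seq (letter n)) := string_rep i (u ++ (a, false) :: v).
Definition V_rep (i : 'I_n.+1) (v : seq (letter n)) := string_rep i v.

Definition same_min_det M N M' N' (f : rhom M N) (f' : rhom M' N') : Prop :=
  exists D, is_min_det f D /\ is_min_det f' D.

Definition det_by_injective M N (g : rhom M N) i Y (g1 : rhom (inj_at i) Y) : Prop :=
  [/\ indecomposable Y, irreducible g1, epi g1 & same_min_det g g1].

Definition det_by_string_seq M N (g : rhom M N) a u i v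
    (f2 : rhom (U_rep a u) (N_rep a u i v)) (g2 : rhom (N_rep a u i v) (V_rep i v)) :
    Prop :=
  [/\ is_UNV a u i v, almost_split_seq f2 g2,
      [/\ is_min_det g (V_rep i v), is_min_det g2 (V_rep i v)
        & is_tau_inv (kernel g2) (V_rep i v)] &
      [/\ ~ is_zero (V_rep i v), ~ projective (V_rep i v)
        & indecomposable (V_rep i v)]].

End ModLambda.

Definition iso_morphisms M N M' N' (f : rhom M N) (f' : rhom M' N') : Prop :=
  exists (s : rhom M M') (t : rhom N N'),
    [/\ iso s, iso t & forall i, (t i \o f i = f' i \o s i)%VF].

Definition iso_sequences L M N L' M' N' (f : rhom L M) (g : rhom M N)
    (f' : rhom L' M') (g' : rhom M' N') : Prop :=
  exists (r : rhom L L') (s : rhom M M') (t : rhom N N'),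
    [/\ iso r, iso s, iso t &
        forall i, (s i \o f i = f' i \o r i)%VF /\
                  (t i \o g i = g' i \o s i)%VF].

End Representations.

(* Main.v *)
Require Import Defs.
From HB Require Import structures.
From mathcomp Require Import all_boot all_order all_algebra zify.
From Stdlib Require Import Classical FunctionalExtensionality.

Set Implicit Arguments.
Unset Strict Implicit.
Unset Printing Implicit Defensive.

Import GRing.Theory.

(* Every indecomposable representation of a quiver of type A is thin, with support
   an interval.  If f is an irreducible monomorphism between two such modules, then
   testing it against the factorisations through intermediate intervals forces its
   cokernel to be M(V_a) for some arrow a; dually, the kernel of an irreducible
   epimorphism is some M(U_a).  The module M(V_a) is uniserial, with simple socle
   S(k), so the only indecomposable projective that almost factors through the
   monomorphism is P(k), and its determiner is P(k).  An epimorphism has no such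
   projectives, and its determiner is tau^-1 M(U_a) = M(V_a), which is not projective
   because M(N_a) -> M(V_a) does not split.  Hence the determiner tells the two cases
   apart, and M(V_a) determines a.  The test maps are the inclusion into P(src a) of
   the radical summand through a, with cokernel M(V_a), the projection of I(tgt a)
   with kernel M(U_a), and the two maps of the almost split sequence of a. *)

(** The ideal enters only through the relation [nz]. Two vertices of a quiver of type A are joined
    by at most one path, so multiplying an element of I by trivial paths isolates its coefficients:
    an admissible ideal is spanned by the paths that it contains, and a representation lies in mod
    Lambda exactly when these paths act by zero. Thin modules then become predicates on the
    vertices, and the search for the cokernel becomes a statement on predicates; the search for the
    kernel is the same statement for the opposite orientation. The translate is given by a relation
    that chooses a minimal injective copresentation. Comparing the determiners of two maps requires
    this relation to be single valued up to isomorphism, which is why injective envelopes are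
    compared. An indecomposable is shown to be thin by finding one interval in it together with
    functionals that retract it. Uniqueness in the epimorphism case rests on thinness: a submodule
    of a thin module is fixed by its support. *)

Section LinearAlgebra.
Local Open Scope ring_scope.
Variable K : fieldType.

Lemma comp_lfunP (U V W : vectType K) (g : 'Hom(V, W)) (f : 'Hom(U, V)) h :
  (g \o f)%VF = h <-> forall x, g (f x) = h x.
Proof.
split=> [<- x|e]; first by rewrite comp_lfunE.
by apply/lfunP=> x; rewrite comp_lfunE e.
Qed.

Lemma lfunZ (U V : vectType K) (f : 'Hom(U, V)) c u : f (c *: u) = c *: f u.
Proof. exact: linearZ. Qed.

(** [linfun] evaluates as expected only on maps with a linear structure; here the structure is
    packed from the bare property, so that the [linfun] terms inside the representations can be
    computed. *)
Lemma linfunE (U V : vectType K) (f : U -> V) : linear f -> linfun f =1 f.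
Proof.
move=> lf x; pose F := GRing.isLinear.Build K U V *:%R f lf.
pose G : {linear U -> V} := HB.pack f F.
by rewrite -[f]/(G : U -> V) lfunE.
Qed.

Lemma lin_lfun (U V : vectType K) (f : U -> V) :
  linear f -> exists g : 'Hom(U, V), forall x, g x = f x.
Proof. by move=> lf; exists (linfun f) => x; rewrite linfunE. Qed.

(* The domain of a linear relation need not be decidable, so the functional is
   built on a subspace of maximal dimension. *)
Lemma linear_relation_hom (V W : vectType K) (R : V -> W -> Prop) :
  R 0 0 ->
  (forall a x y x' y', R x y -> R x' y' -> R (a *: x + x') (a *: y + y')) ->
  (forall y, R 0 y -> y = 0) ->
  exists f : 'Hom(V, W), forall x y, R x y -> f x = y.
Proof.
move=> R0 RL Rf.
have Ruq x y y' : R x y -> R x y' -> y = y'.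
  move=> h h'; have := RL (-1) _ _ _ _ h h'.
  rewrite !scaleN1r addNr => /Rf /eqP; rewrite addrC subr_eq0 => /eqP ->//.
(* Induct on a lower bound [k] for the dimension of the subspace already treated; beyond dim V only
   the second alternative is left. *)
suff H k : (exists (U : {vspace V}) (f : 'Hom(V, W)),
      (k <= \dim U)%N /\ forall x, x \in U -> R x (f x)) \/
    exists f : 'Hom(V, W), forall x y, R x y -> f x = y.
  case: (H (dim V).+1) => // [[U [f [dU _]]]].
  by have := dimvS (subvf U); rewrite dimvf => /(leq_trans dU); rewrite ltnn.
elim: k => [|k [[U [f [dU fU]]]|]]; last by right.
  by left; exists 0%VS, 0; split=> // x; rewrite memv0 => /eqP->; rewrite linear0.
case: (classic (exists x y, R x y /\ x \notin U)) => [[x [y [Rxy xU]]]|nR]; last first.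
  right; exists f => x y Rxy; case: (boolP (x \in U)) => xU.
    exact: Ruq (fU _ xU) Rxy.
  by case: nR; exists x, y.
left; exists (U + <[x]>)%VS.
have xn0 : x != 0 by apply: contraNneq xU => ->; rewrite mem0v.
have dis : (U :&: <[x]> = 0)%VS.
  apply/eqP; rewrite -subv0; apply/subvP=> v /memv_capP[vU /vlineP[a e]].
  rewrite memv0 e; case: (eqVneq a 0) => [->|an0]; first by rewrite scale0r.
  by case/negP: xU; rewrite -(scale1r x) -(mulVf an0) -scalerA -e memvZ.
pose piU := daddv_pi U <[x]>; pose pix := daddv_pi <[x]> U.
have dis' : (<[x]> :&: U = 0)%VS by rewrite capvC.
(* The extension agrees with [f] on [U] and sends [x] to [y]. *)
pose g v := f (piU v) + coord [tuple x] ord0 (pix v) *: y.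
have lg : linear g.
  by move=> a u v; rewrite /g !linearP scalerDl -scalerA scalerDr !addrA; congr (_ + _);
    rewrite -!addrA; congr (_ + _); rewrite addrC.
have [G GE] := lin_lfun lg.
exists G; split=> [|v]; first by rewrite dimv_disjoint_sum // dim_vline xn0 addn1.
move=> vU; rewrite GE /g -{1}(daddv_pi_add dis vU) addrC [f _ + _]addrC.
have /vlineP[c ec] : pix v \in <[x]>%VS by apply: memv_pi.
rewrite -/piU -/pix ec linearZ /=.
have -> : coord [tuple x] ord0 x = 1.
  have fx : free [tuple x] by rewrite seq1_free.
  by have := coord_free ord0 ord0 fx; rewrite eqxx.
rewrite mulr1; apply: RL => //; apply: fU; exact: memv_pi.
Qed.

(** The assignment d z + f x |-> d is single valued exactly because z is outside the image of f. *)
Lemma separating_functional (U V : vectType K) (f : 'Hom(U, V)) (z : V) :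
  z \notin limg f -> exists phi : 'Hom(V, K^o), phi z = 1 /\ forall x, phi (f x) = 0.
Proof.
move=> zf.
pose R v (c : K^o) := exists (d : K) x, v = d *: z + f x /\ c = d.
have R0 : R 0 0 by exists 0, 0; rewrite scale0r linear0 addr0.
have RL a x y x' y' : R x y -> R x' y' -> R (a *: x + x') (a *: y + y').
  move=> [d [v [-> ->]]] [d' [v' [-> ->]]]; exists (a * d + d'), (a *: v + v').
  split=> //; rewrite (linearP f) scalerDl -scalerA scalerDr !addrA; congr (_ + _).
  by rewrite -!addrA; congr (_ + _); rewrite addrC.
have Rf y : R 0 y -> y = 0.
  move=> [c [x [e ->]]]; apply/eqP; apply: contraNT zf => c0.
  apply/memv_imgP; exists (- c^-1 *: x); rewrite ?memvf// linearZ /=.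
  have e' : f x = - (c *: z) by apply/eqP; rewrite -addr_eq0 addrC -e.
  by rewrite e' scalerN scaleNr opprK scalerA mulVf // scale1r.
have [phi hphi] := linear_relation_hom R0 RL Rf.
exists phi; split=> [|x]; apply: hphi.
  by exists 1, 0; rewrite scale1r linear0 addr0.
by exists 0, x; rewrite scale0r add0r.
Qed.

End LinearAlgebra.

(** * Morphisms of representations: factorisation, exactness, direct sums, splitting *)

Section Reps.
Local Open Scope ring_scope.
Variables (K : fieldType) (n : nat) (o : 'I_n -> bool).
Implicit Types L M N P X Y : rep K o.

Lemma rhomE M N (f : rhom M N) a x :
  rmap N a (f (src o a) x) = f (tgt o a) (rmap M a x).
Proof. by case: f => h H /=; rewrite ((comp_lfunP _ _ _).1 (H a)) comp_lfunE. Qed.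

Definition mk_rhom M N (h : forall i, 'Hom(M i, N i))
    (H : forall a x, rmap N a (h (src o a) x) = h (tgt o a) (rmap M a x)) : rhom M N :=
  RHom (fun a => (comp_lfunP _ _ _).2 (fun x => etrans (H a x) (esym (comp_lfunE _ _ x)))).

Definition rid M : rhom M M := mk_rhom (h := fun i => \1%VF)
  (fun a x => etrans (congr1 (rmap M a) (id_lfunE x)) (esym (id_lfunE _))).

Lemma rcomp_subproof M N P (g : rhom N P) (f : rhom M N) a x :
  rmap P a ((g (src o a) \o f (src o a))%VF x) =
  (g (tgt o a) \o f (tgt o a))%VF (rmap M a x).
Proof. by rewrite !comp_lfunE !rhomE. Qed.

Definition rcomp M N P (g : rhom N P) (f : rhom M N) : rhom M P :=
  mk_rhom (h := fun i => (g i \o f i)%VF) (rcomp_subproof g f).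

Lemma rcompE M N P (g : rhom N P) (f : rhom M N) i x : rcomp g f i x = g i (f i x).
Proof. exact: comp_lfunE. Qed.

Lemma rzero_subproof M N a x :
  rmap N a ((0 : 'Hom(M (src o a), N (src o a))) x) =
  (0 : 'Hom(M (tgt o a), N (tgt o a))) (rmap M a x).
Proof. by rewrite !zero_lfunE linear0. Qed.

Definition rzero M N : rhom M N := mk_rhom (h := fun i => 0) (@rzero_subproof M N).

Lemma rzeroE M N i x : rzero M N i x = 0.
Proof. exact: zero_lfunE. Qed.

Lemma mono_injP M N (f : rhom M N) : mono f <-> forall i, injective (f i).
Proof.
split=> H i; first by apply/lker0P; rewrite H.
by apply/eqP/lker0P.
Qed.

Lemma mono_eq0 M N (f : rhom M N) :
  (forall i x, f i x = 0 -> x = 0) -> mono f.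
Proof.
by move=> H i; apply/eqP; rewrite -subv0; apply/subvP=> x; rewrite memv_ker memv0 => /eqP /H ->.
Qed.

Lemma mono0 M N (f : rhom M N) i x : mono f -> f i x = 0 -> x = 0.
Proof. by move=> /mono_injP fi e; apply: (fi i); rewrite e linear0. Qed.

Lemma epi_surj M N (f : rhom M N) : epi f <-> forall i y, exists x, y = f i x.
Proof.
split=> H i; first by move=> y; have := memvf y; rewrite -(H i) => /memv_imgP[x _ ->]; exists x.
apply/eqP; rewrite eqEsubv subvf; apply/subvP=> y _.
by have [x ->] := H i y; apply: memv_img; apply: memvf.
Qed.

Lemma iso_mono M N (f : rhom M N) : iso f -> mono f.
Proof.
move=> [g gf]; apply/mono_injP=> i; have [/comp_lfunP e _] := gf i.
by move=> x y /(congr1 (g i)); rewrite !e !id_lfunE.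
Qed.

Lemma iso_epi M N (f : rhom M N) : iso f -> epi f.
Proof.
move=> [g gf]; apply/epi_surj=> i y; have [_ /comp_lfunP e] := gf i.
by exists (g i y); rewrite e id_lfunE.
Qed.

(** The inverse at each vertex is only a linear left inverse of [f i]; on the image of [h] it is a
    true inverse, and injectivity of [f] gives commutation with the arrows. *)
Lemma factor_mono M N P (f : rhom M N) (h : rhom P N) :
  mono f -> (forall i x, exists y, h i x = f i y) ->
  exists u : rhom P M, forall i x, f i (u i x) = h i x.
Proof.
move=> mf H.
have fK i x : f i ((f i)^-1%VF (h i x)) = h i x.
  by rewrite limg_lfunVK //; have [y ->] := H i x; apply: memv_img (memvf _).
have Hu a x : rmap M a (((f (src o a))^-1 \o h (src o a))%VF x) =
    ((f (tgt o a))^-1 \o h (tgt o a))%VF (rmap P a x).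
  rewrite !comp_lfunE; apply: ((mono_injP f).1 mf).
  by rewrite fK -!rhomE fK.
by exists (mk_rhom (h := fun i => ((f i)^-1 \o h i)%VF) Hu) => i x; rewrite /= comp_lfunE fK.
Qed.

(** Linear sections of [p i] are chosen vertex by vertex; they need not commute with the arrows, but
    the defect lies in the kernel of [p], which [h] kills. *)
Lemma factor_epi M N P (p : rhom M N) (h : rhom M P) :
  epi p -> (forall i x, p i x = 0 -> h i x = 0) ->
  exists t : rhom N P, forall i x, t i (p i x) = h i x.
Proof.
move=> /epi_surj ep H.
have tK i x : h i ((p i)^-1%VF (p i x)) = h i x.
  apply/eqP; rewrite -subr_eq0 -linearB; apply/eqP/H.
  by rewrite linearB /= limg_lfunVK ?subrr // memv_img // memvf.
have Ht a y : rmap P a ((h (src o a) \o (p (src o a))^-1)%VF y) =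
    (h (tgt o a) \o (p (tgt o a))^-1)%VF (rmap N a y).
  have [x ->] := ep _ y.
  by rewrite !comp_lfunE tK [rmap N a _]rhomE tK rhomE.
by exists (mk_rhom (h := fun i => (h i \o (p i)^-1)%VF) Ht) => i x; rewrite /= comp_lfunE tK.
Qed.

Lemma bij_iso M N (f : rhom M N) : mono f -> epi f -> iso f.
Proof.
move=> mf /epi_surj ef.
have [i x|g gE] := @factor_mono _ _ _ f (rid N) mf; first by rewrite id_lfunE; apply: ef.
exists g => i; split; apply/comp_lfunP=> x; last by rewrite gE.
by apply: ((mono_injP f).1 mf i); rewrite gE !id_lfunE.
Qed.

Lemma iso_inv M N (f : rhom M N) : iso f ->
  exists g : rhom N M, [/\ iso g, forall i x, g i (f i x) = x & forall i x, f i (g i x) = x].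
Proof.
move=> [g gf]; exists g; split.
- by exists f => i; have [? ?] := gf i.
- by move=> i x; have [/comp_lfunP -> _] := gf i; rewrite id_lfunE.
- by move=> i x; have [_ /comp_lfunP ->] := gf i; rewrite id_lfunE.
Qed.

Lemma iso_id M : iso (rid M).
Proof. by exists (rid M) => i; rewrite comp_lfun1l. Qed.

Lemma iso_comp M N P (g : rhom N P) (f : rhom M N) : iso g -> iso f -> iso (rcomp g f).
Proof.
move=> ig jf; apply: bij_iso.
  apply/mono_injP=> i x y; rewrite !rcompE.
  by move/((mono_injP _).1 (iso_mono ig)) /((mono_injP _).1 (iso_mono jf)).
apply/epi_surj=> i y.
have [z ->] := (epi_surj g).1 (iso_epi ig) i y.
have [x ->] := (epi_surj f).1 (iso_epi jf) i z.
by exists x; rewrite rcompE.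
Qed.

Lemma isomorphic_sym M N : isomorphic M N -> isomorphic N M.
Proof. by move=> [f /iso_inv[g [ig _ _]]]; exists g. Qed.

Lemma isomorphic_trans M N P : isomorphic M N -> isomorphic N P -> isomorphic M P.
Proof. by move=> [f i1] [g i2]; exists (rcomp g f); apply: iso_comp. Qed.

Lemma is_zeroP M : is_zero M <-> forall i (x : M i), x = 0.
Proof.
split=> H i; first by move=> x; apply/eqP; rewrite -memv0 -H memvf.
by apply/eqP; rewrite -subv0; apply/subvP=> x _; rewrite (H i x) mem0v.
Qed.

Lemma is_zero_iso M N : isomorphic M N -> is_zero M -> is_zero N.
Proof.
move=> [f /iso_epi /epi_surj ef] /is_zeroP zM; apply/is_zeroP=> i y.
by have [x ->] := ef i y; rewrite (zM _ x) linear0.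
Qed.

Lemma is_zero_isomorphic M N : is_zero M -> is_zero N -> isomorphic M N.
Proof.
move=> /is_zeroP zM /is_zeroP zN; exists (rzero M N); apply: bij_iso.
  by apply: mono_eq0 => i x _; apply: zM.
by apply/epi_surj=> i y; exists 0; rewrite (zN _ y) linear0.
Qed.

Lemma is_zero_zero_rep : is_zero (zero_rep K o).
Proof. by apply/is_zeroP=> i x; apply/rowP; case. Qed.

Lemma indecomposable_iso M N : isomorphic M N -> indecomposable M -> indecomposable N.
Proof.
move=> MN [zM dM]; split=> [zN|X Y NXY]; first by apply: zM; apply: is_zero_iso zN; apply: isomorphic_sym.
by apply: dM; apply: isomorphic_trans NXY.
Qed.

Lemma dsum_mapE M N a u : rmap (dsum M N) a u = (rmap M a u.1, rmap N a u.2).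
Proof. by apply: linfunE => c x y; rewrite /= !linearP. Qed.

Lemma linear_rhom M N (f : forall i, M i -> N i) : (forall i, linear (f i)) ->
  (forall a x, rmap N a (f (src o a) x) = f (tgt o a) (rmap M a x)) ->
  exists F : rhom M N, forall i x, F i x = f i x.
Proof.
move=> lf H; pose g i : 'Hom(M i, N i) := linfun (f i).
have gE i x : g i x = f i x by rewrite /g linfunE.
have Hg a x : rmap N a (g (src o a) x) = g (tgt o a) (rmap M a x) by rewrite !gE.
by exists (mk_rhom (h := g) Hg) => i x; apply: gE.
Qed.

Lemma dsum_fst X Y : exists p : rhom (dsum X Y) X, forall i u, p i u = u.1.
Proof.
by apply: (@linear_rhom (dsum X Y) X (fun i u => u.1)) => // a x; rewrite dsum_mapE.
Qed.

Lemma dsum_snd X Y : exists p : rhom (dsum X Y) Y, forall i u, p i u = u.2.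
Proof.
by apply: (@linear_rhom (dsum X Y) Y (fun i u => u.2)) => // a x; rewrite dsum_mapE.
Qed.

Lemma dsum_inl X Y : exists s : rhom X (dsum X Y), forall i x, s i x = (x, 0).
Proof.
apply: (@linear_rhom X (dsum X Y) (fun i x => (x, 0))) => [i c u v|a x].
  by apply: injective_projections; rewrite /= ?scaler0 ?addr0.
by rewrite dsum_mapE linear0.
Qed.

Lemma dsum_inr X Y : exists s : rhom Y (dsum X Y), forall i x, s i x = (0, x).
Proof.
apply: (@linear_rhom Y (dsum X Y) (fun i x => (0, x))) => [i c u v|a x].
  by apply: injective_projections; rewrite /= ?scaler0 ?addr0.
by rewrite dsum_mapE linear0.
Qed.

Lemma dsum_copair X Y M (f : rhom X M) (g : rhom Y M) :
  exists h : rhom (dsum X Y) M, forall i u, h i u = f i u.1 + g i u.2.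
Proof.
apply: (@linear_rhom (dsum X Y) M (fun i u => f i u.1 + g i u.2)) => [i c u v|a u].
  by rewrite !linearP /= scalerDr addrACA.
by rewrite dsum_mapE /fst /snd -!rhomE -linearD.
Qed.

Lemma dsum_zero_r X Y : is_zero Y -> isomorphic X (dsum X Y).
Proof.
move=> /is_zeroP z; have [F FE] := dsum_inl X Y; exists F; apply: bij_iso.
  by apply: mono_eq0 => i x; rewrite FE => -[].
by apply/epi_surj=> i [x y]; exists x; rewrite FE (z i y).
Qed.

Lemma dsum_zero_l X Y : is_zero Y -> isomorphic X (dsum Y X).
Proof.
move=> /is_zeroP z; have [F FE] := dsum_inr Y X; exists F; apply: bij_iso.
  by apply: mono_eq0 => i x; rewrite FE => -[].
by apply/epi_surj=> i [y x]; exists x; rewrite FE (z i y).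
Qed.

Lemma kernel_mapE M N (f : rhom M N) a (u : kernel f (src o a)) :
  vsval (rmap (kernel f) a u) = rmap M a (vsval u).
Proof.
rewrite linfunE => [|c x y]; last by rewrite !linearP.
by rewrite vsprojK // memv_ker -rhomE; have := subvsP u; rewrite memv_ker => /eqP->; rewrite linear0.
Qed.

Lemma kernel_inc_subproof M N (f : rhom M N) a x :
  rmap M a (linfun vsval (x : kernel f (src o a))) = linfun vsval (rmap (kernel f) a x).
Proof. by rewrite !lfunE /= kernel_mapE. Qed.

Definition kernel_inc M N (f : rhom M N) : rhom (kernel f) M :=
  mk_rhom (h := fun i => linfun vsval : 'Hom(kernel f i, M i)) (@kernel_inc_subproof M N f).

Lemma kernel_incE M N (f : rhom M N) i x : kernel_inc f i x = vsval x.
Proof. exact: lfunE. Qed.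

Lemma kernel_inc_mono M N (f : rhom M N) : mono (kernel_inc f).
Proof. by apply/mono_injP=> i x y; rewrite !kernel_incE; apply: subvs_inj. Qed.

Lemma kernel_comp M N (f : rhom M N) i x : f i (kernel_inc f i x) = 0.
Proof. by rewrite kernel_incE; have := subvsP x; rewrite memv_ker => /eqP. Qed.

Lemma kernel_incP M N (f : rhom M N) i x : f i x = 0 -> exists y, x = kernel_inc f i y.
Proof.
by move=> e; exists (vsproj (lker (f i)) x); rewrite kernel_incE vsprojK // memv_ker e.
Qed.

Lemma short_exactP L M N (f : rhom L M) (g : rhom M N) :
  short_exact f g <-> [/\ mono f, epi g, forall i x, g i (f i x) = 0 &
                     forall i y, g i y = 0 -> exists x, y = f i x].
Proof.
split=> [[mf eg H]|[mf eg H1 H2]]; split=> // i.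
- by move=> x; apply/eqP; rewrite -memv_ker -H memv_img // memvf.
- by move=> y e; have : y \in lker (g i); [rewrite memv_ker e|rewrite -H => /memv_imgP[x _ ->]; exists x].
apply/vspaceP=> y; rewrite memv_ker; apply/idP/idP=> [/memv_imgP[x _ ->]|/eqP/H2[x ->]].
  by rewrite H1.
by rewrite memv_img // memvf.
Qed.

Lemma short_exact_iso L M N (j : rhom L M) (f : rhom M N) :
  short_exact j f -> isomorphic L (kernel f).
Proof.
move=> /short_exactP[mj _ fj jf].
have [i x|u uE] := @factor_mono _ _ _ (kernel_inc f) j (kernel_inc_mono f).
  by apply: kernel_incP.
exists u; apply: bij_iso.
  by apply/mono_injP=> i x y e; apply: ((mono_injP j).1 mj i); rewrite -!uE e.
apply/epi_surj=> i y; have [x ex] := jf i _ (kernel_comp y).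
by exists x; apply: ((mono_injP _).1 (kernel_inc_mono f) i); rewrite uE.
Qed.

Lemma short_exact_unique L M N L' N' (j : rhom L M) (f : rhom M N)
    (j' : rhom L' M) (f' : rhom M N') :
  short_exact j f -> short_exact j' f' ->
  (forall i x, f i x = 0 <-> f' i x = 0) ->
  exists (r : rhom L L') (t : rhom N N'), [/\ iso r, iso t,
     forall i x, j' i (r i x) = j i x & forall i x, t i (f i x) = f' i x].
Proof.
move=> /short_exactP[mj ef fj jf] /short_exactP[mj' ef' fj' jf'] E.
have [i x|r rE] := @factor_mono _ _ _ j' j mj'; first by apply/jf'/E.
have [i x /E//|t tE] := @factor_epi _ _ _ f f' ef.
exists r, t; split=> //; apply: bij_iso.
- by apply/mono_injP=> i x y e; apply: ((mono_injP j).1 mj i); rewrite -!rE e.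
- apply/epi_surj=> i y; have [|x ex] := jf i (j' i y); first by apply/E.
  by exists x; apply: ((mono_injP _).1 mj' i); rewrite rE.
- apply: mono_eq0 => i x; have [y ->] := (epi_surj f).1 ef i x.
  by rewrite tE => /E.
- apply/epi_surj=> i y; have [x ->] := (epi_surj f').1 ef' i y.
  by exists (f i x); rewrite tE.
Qed.

Lemma split_dsum X Y (f : rhom X Y) (g : rhom Y X) :
  (forall i x, g i (f i x) = x) -> isomorphic Y (dsum X (kernel g)).
Proof.
move=> gf; apply: isomorphic_sym; have [h hE] := dsum_copair f (kernel_inc g).
exists h; apply: bij_iso.
  apply: mono_eq0 => i u; rewrite hE => e.
  have u1 : u.1 = 0.
    by have := congr1 (g i) e; rewrite linearD /= gf kernel_comp addr0 linear0.
  move: e; rewrite u1 linear0 add0r => /(mono0 (@kernel_inc_mono _ _ g)) u2.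
  by rewrite [u]surjective_pairing u1 u2.
apply/epi_surj=> i y.
have [k ek] : exists k, y - f i (g i y) = kernel_inc g i k.
  by apply: kernel_incP; rewrite linearB /= gf subrr.
by exists (g i y, k); rewrite hE /= -ek addrC subrK.
Qed.

(** The complement of X is the kernel of the retraction. It vanishes since X does not, so the
    retraction is injective. *)
Lemma split_mono_indec X Y (f : rhom X Y) :
  indecomposable Y -> ~ is_zero X -> split_mono f -> iso f.
Proof.
move=> [_ dY] nX [g gf].
have gfK i x : g i (f i x) = x by have /comp_lfunP -> := gf i; rewrite id_lfunE.
have [//|zk] := dY _ _ (split_dsum gfK).
have mg : mono g.
  apply: mono_eq0 => i y gy.
  have [k ->] := kernel_incP gy.
  by rewrite ((is_zeroP _).1 zk i k) linear0.
apply: bij_iso; first by apply/mono_injP=> i x y /(congr1 (g i)); rewrite !gfK.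
apply/epi_surj=> i y; exists (g i y); apply: ((mono_injP g).1 mg i).
by rewrite gfK.
Qed.

Lemma split_epi_indec X Y (f : rhom Y X) :
  indecomposable Y -> ~ is_zero X -> split_epi f -> iso f.
Proof.
move=> dY nX [g fg].
have sg : split_mono g by exists f.
have [h [ih hg gh]] := iso_inv (split_mono_indec dY nX sg).
have fh i x : f i x = h i x.
  have /comp_lfunP e := fg i.
  by rewrite -{1}(gh i x) e id_lfunE.
apply: bij_iso.
  by apply: mono_eq0 => i x; rewrite fh; apply: mono0 (iso_mono ih).
by apply/epi_surj=> i y; exists (g i y); rewrite fh hg.
Qed.

Definition image M N (f : rhom M N) : rep K o :=
  Rep (fun i => subvs_of (limg (f i)) : vectType K)
      (fun a => linfun (fun u => vsproj (limg (f (tgt o a))) (rmap N a (vsval u)))).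

Lemma image_mapE M N (f : rhom M N) a (u : image f (src o a)) :
  vsval (rmap (image f) a u) = rmap N a (vsval u).
Proof.
rewrite linfunE => [|c x y]; last by rewrite !linearP.
have /memv_imgP[x _ ->] := subvsP u.
by rewrite vsprojK // rhomE memv_img // memvf.
Qed.

Lemma image_factor M N (f : rhom M N) :
  exists (h : rhom M (image f)) (g : rhom (image f) N),
    [/\ epi h, mono g & forall i x, f i x = g i (h i x)].
Proof.
have Hg a x : rmap N a (linfun vsval (x : image f (src o a))) = linfun vsval (rmap (image f) a x).
  by rewrite !lfunE /= image_mapE.
pose g := mk_rhom (h := fun i => linfun vsval : 'Hom(image f i, N i)) Hg.
have mg : mono g by apply/mono_injP=> i x y; rewrite /= !lfunE; apply: subvs_inj.
have [i x|h hE] := @factor_mono _ _ _ g f mg.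
  exists (vsproj (limg (f i)) (f i x)).
  by rewrite /= lfunE /= vsprojK // memv_img // memvf.
exists h, g; split=> //; apply/epi_surj=> i y.
have /memv_imgP[x _ ex] := subvsP y; exists x.
by apply: ((mono_injP g).1 mg i); rewrite hE /= lfunE.
Qed.

Lemma path_act_hom M N (f : rhom M N) (p : qpath o) v j :
  path_act p (fun i => f i (v i)) j = f j (path_act p v j).
Proof.
have single_hom i (x : M i) k : single (f i x) k = f k (single x k).
  rewrite /single; case: (eqVneq k i) => [->|ki]; first by rewrite !dfwith_in.
  by rewrite !dfwith_out // ?linear0 // eq_sym.
rewrite /path_act; elim: (pword p) j => [|a w IH] j /=; first exact: single_hom.
by rewrite IH rhomE single_hom.
Qed.

Section InMod.
Variable I : {vspace path_alg K o}.

Lemma in_mod_sub M N (f : rhom M N) : mono f -> in_mod I N -> in_mod I M.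
Proof.
move=> mf iN x xI v j; apply: (mono0 mf).
rewrite linear_sum -[RHS](iN x xI (fun i => f i (v i)) j); apply: eq_bigr => p _.
by rewrite linearZ /= path_act_hom.
Qed.

Lemma in_mod_iso M N : isomorphic M N -> in_mod I M -> in_mod I N.
Proof. by move=> [f /iso_inv[g [/iso_mono mg _ _]]]; apply: in_mod_sub. Qed.

Lemma in_mod_zero M : is_zero M -> in_mod I M.
Proof. by move=> /is_zeroP zM x _ v j; apply: zM. Qed.

(** Factor through the image: a splitting of the first factor makes f injective, a splitting of the
    second makes it surjective. *)
Lemma irreducible_mono_or_epi M N (f : rhom M N) : irreducible I f -> mono f \/ epi f.
Proof.
move=> [iM iN _ _ H].
have [h [g [eh mg fE]]] := image_factor f.
have [||[r rh]|[s gs]] := H _ h g; first exact: in_mod_sub iN.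
- by move=> i; apply/esym/comp_lfunP.
- left; apply/mono_injP=> i x y; rewrite !fE => /((mono_injP g).1 mg i) e.
  have /comp_lfunP rK := rh i.
  by rewrite -[x]id_lfunE -[y]id_lfunE -!rK e.
- right; apply/epi_surj=> i y.
  have [x ex] := (epi_surj h).1 eh i (s i y); exists x.
  by rewrite fE -ex; have /comp_lfunP -> := gs i; rewrite id_lfunE.
Qed.

Lemma irreducible_not_iso M N (f : rhom M N) : irreducible I f -> ~ iso f.
Proof. by move=> [_ _ H _ _] [g gf]; apply: H; exists g => i; case: (gf i). Qed.

End InMod.
End Reps.

(** * Directed paths, sides of an arrow, supports *)

Section Orientation.
Variables (n : nat) (o : 'I_n -> bool).
Implicit Types (i j k v w x : 'I_n.+1) (a e : 'I_n).

Lemma src_val a : src o a = (a + o a)%N :> nat.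
Proof. by rewrite /src; case: (o a) => /=; rewrite /bump; lia. Qed.

Lemma tgt_val a : tgt o a = (a + ~~ o a)%N :> nat.
Proof. by rewrite /tgt; case: (o a) => /=; rewrite /bump; lia. Qed.

(** Existence of a directed path from [i] to [j], read off the orientation of the edges between
    them. *)
Definition dir i j : bool :=
  [forall a : 'I_n, ((i <= a < j)%N ==> ~~ o a) && ((j <= a < i)%N ==> o a)].

Lemma dirP i j : reflect
  (forall a, ((i <= a < j)%N -> ~~ o a) /\ ((j <= a < i)%N -> o a)) (dir i j).
Proof.
apply: (iffP forallP) => H a; first by have /andP[/implyP ? /implyP ?] := H a.
by have [h1 h2] := H a; apply/andP; split; apply/implyP.
Qed.

Lemma dir_refl i : dir i i.
Proof. by apply/dirP=> a; split=> h; exfalso; lia. Qed.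

Lemma dir_arrow a : dir (src o a) (tgt o a).
Proof.
apply/dirP=> e; rewrite src_val tgt_val.
case: (eqVneq (e : nat) a) => [/val_inj->|ne]; first by case: (o a) => /=; split=> // h; lia.
by split=> h; exfalso; move: h; case: (o a) => /=; lia.
Qed.

Lemma dir_sub i j x : dir i j -> between i j x -> dir i x /\ dir x j.
Proof.
move=> /dirP H; rewrite /between => b; split; apply/dirP=> a; have [h1 h2] := H a;
  by split=> h; [apply: h1|apply: h2]; lia.
Qed.

(** Otherwise the path would turn back at [x] and use an edge beside [x] in both directions. *)
Lemma dir_between i j x : dir i x -> dir x j -> between i j x.
Proof.
move=> /dirP H1 /dirP H2; rewrite /between.
case: (ltnP i x) => h; case: (ltnP j x) => h'; [|lia|lia|].
  have xn : (x.-1 < n)%N by have := ltn_ord x; lia.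
  have [e1 _] := H1 (Ordinal xn); have [_ e2] := H2 (Ordinal xn).
  have /negP[] : ~~ o (Ordinal xn) by apply: e1 => /=; lia.
  by apply: e2 => /=; lia.
case: (eqVneq (i : nat) x) => [->|ne]; first by lia.
case: (eqVneq (j : nat) x) => [->|ne']; first by lia.
have xn : (x < n)%N by have := ltn_ord i; lia.
have [_ e1] := H1 (Ordinal xn); have [e2 _] := H2 (Ordinal xn).
have /negP[] : ~~ o (Ordinal xn) by apply: e2 => /=; lia.
by apply: e1 => /=; lia.
Qed.

Lemma dir_trans i j x : dir i x -> dir x j -> dir i j.
Proof.
move=> d1 d2; have := dir_between d1 d2; move: d1 d2 => /dirP H1 /dirP H2.
rewrite /between => b; apply/dirP=> a; have [h1 h2] := H1 a; have [h3 h4] := H2 a.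
split=> h.
  by case: (ltnP a x) => ax; [apply: h1|apply: h3]; lia.
by case: (ltnP a x) => ax; [apply: h4|apply: h2]; lia.
Qed.

Lemma dir_antisym i j : dir i j -> dir j i -> i = j.
Proof. by move=> d1 d2; have := dir_between d1 d2; rewrite /between => h; apply: val_inj => /=; lia. Qed.

(* The vertices on the same side as src a once the arrow a is removed. *)
Definition src_side a v : bool := if o a then (a < v)%N else (v <= a)%N.

Lemma src_side_src a : src_side a (src o a).
Proof. by rewrite /src_side src_val; case: (o a); lia. Qed.

Lemma src_side_tgt a : ~~ src_side a (tgt o a).
Proof. by rewrite /src_side tgt_val; case: (o a) => /=; lia. Qed.

Lemma src_side_cross a e : src_side a (src o e) != src_side a (tgt o e) -> e = a.
Proof.
rewrite /src_side src_val tgt_val => h; apply: val_inj => /=; move: h.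
by case: (o a); case: (o e) => /=; lia.
Qed.

(** Only [a] joins the two sides, and it leaves the source side; no path can enter that side. *)
Lemma src_side_dir a v w : dir v w -> src_side a w -> src_side a v.
Proof.
move=> /dirP H; have [h1 h2] := H a; rewrite /src_side.
move: h1 h2; case: (o a) => /= h1 h2 h; case: ltnP => //= h'; exfalso.
  by have: false by apply: h1; lia.
by have: false by apply: h2; lia.
Qed.

Lemma src_side_between a v w : src_side a v != src_side a w ->
  between v w (src o a) /\ between v w (tgt o a).
Proof.
by rewrite /src_side /between src_val tgt_val; case: (o a) => /=; lia.
Qed.

Lemma src_side_away a v x : src_side a x -> ~~ src_side a v ->
  between (src o a) v x -> x = src o a.
Proof.
rewrite /src_side /between src_val => h1 h2 h3; apply: val_inj; rewrite /= src_val.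
by move: h1 h2 h3; case: (o a) => /=; lia.
Qed.

Lemma between_l i j : between i j i.
Proof. by rewrite /between; lia. Qed.

Lemma between_r i j : between i j j.
Proof. by rewrite /between; lia. Qed.

Lemma src_side_nearer a v w x : src_side a x -> between v w x ->
  (src_side a v /\ between (src o a) v x) \/ (src_side a w /\ between (src o a) w x).
Proof.
rewrite /src_side /between src_val; case: (o a) => /=; rewrite ?addn1 ?addn0 => sx.
  case: (leqP v w) => vw h; [right|left]; split; lia.
case: (leqP v w) => vw h; [left|right]; split; lia.
Qed.

Definition convex (b : pred 'I_n.+1) : Prop :=
  forall v w x, b v -> b w -> between v w x -> b x.

(** The discrete intermediate value theorem, by which constancy along an interval is reduced to
    single arrows. The proof passes to natural numbers to induct on the distance. *)
Lemma crossing (b : pred 'I_n.+1) v w : b v -> ~~ b w ->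
  exists a, b (src o a) != b (tgt o a) /\ between v w (src o a) /\ between v w (tgt o a).
Proof.
move=> bv bw; pose B (m : nat) := b (inord m).
have BE x : B x = b x by rewrite /B inord_val.
suff H d : forall m, (m + d < n.+1)%N -> B m != B (m + d)%N ->
    exists2 a : 'I_n, (m <= a < m + d)%N & B a != B a.+1.
  have [m [d [md dn Bm]]] : exists m d, [/\ (m + d < n.+1)%N,
      B m != B (m + d)%N & (m = minn v w /\ m + d = maxn v w)%N].
    case: (leqP v w) => vw.
      exists v, (w - v)%N; rewrite subnKC // !BE bv (negbTE bw); split=> //; exact: ltn_ord.
    exists w, (v - w)%N; rewrite subnKC ?(ltnW vw) // !BE bv (negbTE bw); split=> //; exact: ltn_ord.
  have [a ha Ba] := H d m md dn; exists a.
  have -> : (b (src o a) != b (tgt o a)) = (B a != B a.+1).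
    rewrite -!BE src_val tgt_val; case: (o a) => /=; rewrite addn1 addn0 //.
    by rewrite eq_sym.
  by split=> //; rewrite /between src_val tgt_val; case: (o a) => /=; lia.
elim: d => [|d IH] m md; first by rewrite addn0 eqxx.
case: (eqVneq (B m) (B (m + d)%N)) => [->|h] Bm; last first.
  by have [||a ha Ba] := IH m; rewrite ?h //; [lia|exists a => //; lia].
have mn : (m + d < n)%N by lia.
by exists (Ordinal mn) => /=; [lia|rewrite -addnS].
Qed.

(* Exactly when this holds does the family of identities on b `&` c define a
   morphism between the thin representations supported on b and c. *)
Definition compatible (b c : pred 'I_n.+1) : Prop :=
  forall a, b (src o a) -> c (tgt o a) -> c (src o a) = b (tgt o a).

(** The condition for [thin b] to satisfy the relations: a path inside the support acts there as the
    identity, so it must not lie in I. *)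
Definition path_closed (nz : rel 'I_n.+1) (b : pred 'I_n.+1) : Prop :=
  forall i j, dir i j -> (forall x, between i j x -> b x) -> nz i j.

(* What is used of the relation [there is a path from i to j outside of I]. *)
Record nonzero_paths (nz : rel 'I_n.+1) : Prop := NonzeroPaths {
  nz_dir : forall i j, nz i j -> dir i j;
  nz_refl : forall i, nz i i;
  nz_arrow : forall a, nz (src o a) (tgt o a);
  nz_sub : forall i j x, nz i j -> between i j x -> nz i x /\ nz x j
}.

(* V_of and U_of are the supports of M(V_a) and M(U_a): the vertices on a nonzero
   path starting at src a, resp. ending at tgt a, that avoids the arrow a. *)
Definition V_of (nz : rel 'I_n.+1) a v := nz (src o a) v && src_side a v.
Definition U_of (nz : rel 'I_n.+1) a v := nz v (tgt o a) && ~~ src_side a v.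

End Orientation.

(** * Reversal of all arrows *)

Section Duality.
Variables (n : nat) (o : 'I_n -> bool).
Let o' a := ~~ o a.

Lemma src_neg a : src o' a = tgt o a.
Proof. by rewrite /src /tgt /o'; case: (o a). Qed.

Lemma tgt_neg a : tgt o' a = src o a.
Proof. by rewrite /src /tgt /o'; case: (o a). Qed.

Lemma dir_neg i j : dir o' i j = dir o j i.
Proof. by apply: eq_forallb => a; rewrite /o' negbK andbC. Qed.

Lemma src_side_neg a v : src_side o' a v = ~~ src_side o a v.
Proof. by rewrite /src_side /o'; case: (o a) => /=; lia. Qed.

Lemma between_sym (i j x : 'I_n.+1) : between i j x = between j i x.
Proof. by rewrite /between minnC maxnC. Qed.

Lemma nonzero_paths_neg nz : nonzero_paths o nz -> nonzero_paths o' (fun i j => nz j i).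
Proof.
case=> h1 h2 h3 h4; split=> //.
- by move=> i j /h1; rewrite dir_neg.
- by move=> a; rewrite src_neg tgt_neg.
- by move=> i j x h; rewrite between_sym => /(h4 _ _ _ h)[].
Qed.

(** Reversal exchanges the two families of supports, which turns facts on cokernels and socles into
    facts on kernels and tops. *)
Lemma V_set_neg nz a v : V_of o' (fun i j => nz j i) a v = U_of o nz a v.
Proof. by rewrite /V_of /U_of src_neg src_side_neg. Qed.

Lemma compatible_neg b c : compatible o b c -> compatible o' c b.
Proof. by move=> h a; rewrite src_neg tgt_neg => h1 h2; rewrite (h a h2 h1). Qed.

Lemma path_closed_neg nz b : path_closed o nz b -> path_closed o' (fun i j => nz j i) b.
Proof.
by move=> h i j; rewrite dir_neg => d H; apply: h => // x; rewrite between_sym; apply: H.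
Qed.

End Duality.

(** * Supports of cokernels of irreducible inclusions *)

Section ThinCombinatorics.
Variables (n : nat) (o : 'I_n -> bool) (nz : rel 'I_n.+1).
Hypothesis hnz : nonzero_paths o nz.
Implicit Types (i j k v w x : 'I_n.+1) (a e : 'I_n).
Let nzd := nz_dir hnz.

Lemma V_set_src a : V_of o nz a (src o a).
Proof. by rewrite /V_of (nz_refl hnz) src_side_src. Qed.

Lemma nz_convex i : convex (nz i).
Proof.
move=> v w x h1 h2 h; have [] : between i v x \/ between i w x.
- by move: h; rewrite /between; lia.
- by case/(nz_sub hnz h1).
- by case/(nz_sub hnz h2).
Qed.

Lemma src_side_convex a : convex (src_side o a).
Proof. by move=> v w x; rewrite /src_side /between; case: (o a) => /=; lia. Qed.

Lemma tgt_side_convex a : convex (fun v => ~~ src_side o a v).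
Proof. by move=> v w x; rewrite /src_side /between; case: (o a) => /=; lia. Qed.

Lemma convexI (b c : pred 'I_n.+1) : convex b -> convex c -> convex (fun v => b v && c v).
Proof.
move=> cb cc v w x /andP[h1 h2] /andP[h3 h4] h.
by rewrite (cb v w) // (cc v w).
Qed.

Lemma convexU (b c : pred 'I_n.+1) v0 : b v0 -> c v0 -> convex b -> convex c ->
  convex (fun v => b v || c v).
Proof.
move=> b0 c0 cb cc v w x hv hw h.
have [hx|hx] : between v v0 x \/ between w v0 x by move: h; rewrite /between; lia.
  by case/orP: hv => hv; apply/orP; [left; apply: (cb v v0)|right; apply: (cc v v0)].
by case/orP: hw => hw; apply/orP; [left; apply: (cb w v0)|right; apply: (cc w v0)].
Qed.

Lemma V_set_convex a : convex (V_of o nz a).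
Proof. by apply: convexI; [apply: nz_convex|apply: src_side_convex]. Qed.

Lemma V_set_out a e : V_of o nz a (src o e) -> ~~ V_of o nz a (tgt o e) ->
  e = a \/ ~~ nz (src o a) (tgt o e).
Proof.
rewrite /V_of => /andP[h1 h2]; rewrite negb_and => /orP[]; first by right.
by move=> h3; left; apply: (@src_side_cross _ o); rewrite h2 (negbTE h3).
Qed.

Lemma V_set_dir a v w : V_of o nz a v -> between (src o a) v w -> V_of o nz a w.
Proof. by move=> h; apply: V_set_convex h; apply: V_set_src. Qed.

Lemma U_V_disjoint a v : U_of o nz a v -> V_of o nz a v = false.
Proof. by rewrite /U_of /V_of => /andP[_ /negbTE->]; rewrite andbF. Qed.

Lemma V_U_arrow a e : V_of o nz a (src o e) -> U_of o nz a (tgt o e) -> e = a.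
Proof.
rewrite /U_of /V_of => /andP[_ h1] /andP[_ h2].
by apply: (@src_side_cross _ o); rewrite h1 (negbTE h2).
Qed.

Lemma U_V_arrow a e : U_of o nz a (src o e) -> V_of o nz a (tgt o e) -> False.
Proof.
rewrite /U_of /V_of => /andP[_ h1] /andP[_ h2].
have ea : e = a by apply: (@src_side_cross _ o); rewrite h2 (negbTE h1).
by move: h1; rewrite ea src_side_src.
Qed.

(** [k] is the socle vertex of M(V_a), found as the vertex of V_a farthest from [src o a]; the sum
    [d] of two truncated differences is the distance. *)
Lemma V_set_deep a : exists2 k, V_of o nz a k & forall v, V_of o nz a v -> dir o v k.
Proof.
pose d v := ((v - src o a) + (src o a - v))%N.
case: (@arg_maxnP _ (src o a) (V_of o nz a) d (V_set_src a)) => k Vk mk.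
exists k => // v Vv; have := mk v Vv; rewrite /d => hd.
have b : between (src o a) k v.
  move: Vk Vv hd => /andP[_ Vk] /andP[_ Vv]; move: Vk Vv.
  by rewrite /between /src_side src_val; case: (o a) => /=; lia.
by case/andP: Vk => /nzd /dir_sub /(_ b)[].
Qed.

Lemma path_closed_sub (b c : pred 'I_n.+1) : (forall v, b v -> c v) ->
  path_closed o nz c -> path_closed o nz b.
Proof. by move=> bc gc i j d H; apply: gc => // x /H /bc. Qed.

Lemma nz_path_closed i : path_closed o nz (nz i).
Proof.
move=> v w d H; have h1 : nz i v by apply: H; rewrite /between; lia.
have h2 : nz i w by apply: H; rewrite /between; lia.
by have [_] := nz_sub hnz h2 (dir_between (nzd h1) d).
Qed.

(* Each of the three intermediate supports below would factor an irreducible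
   inclusion nontrivially; together they pin the difference c \ b down. *)
Lemma thin_cokernel (b c : pred 'I_n.+1) v0 v1 :
  convex b -> convex c -> path_closed o nz c -> b v0 -> c v1 -> ~~ b v1 ->
  (forall v, b v -> c v) -> compatible o b c ->
  (forall d : pred 'I_n.+1, convex d -> path_closed o nz d ->
     compatible o b d -> compatible o d c -> (forall v, b v -> c v -> d v) ->
     (forall v, d v = b v) \/ (forall v, d v = c v)) ->
  exists a, b (tgt o a) /\ forall v, (c v && ~~ b v) = V_of o nz a v.
Proof.
move=> cb cc gc b0 c1 b1 bc comp H.
(* Compatibility makes b closed under the arrows of c, like the support of a submodule. *)
have succ e : b (src o e) -> c (tgt o e) -> b (tgt o e).
  by move=> h1 h2; rewrite -(comp e h1 h2) bc.
have [a [ba [bs bt]]] := crossing o b0 b1.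
have cs : c (src o a) by apply: cc bs => //; apply: bc.
have ct : c (tgt o a) by apply: cc bt => //; apply: bc.
(* By [succ] the arrow that crosses the boundary of b points into b. *)
have {ba} [nbs bta] : ~~ b (src o a) /\ b (tgt o a).
  by move: ba; case: (boolP (b (src o a))) => [/succ /(_ ct) ->|_] //; case: (b _).
(* b is convex, contains [tgt o a] and misses [src o a], so it lies on the target side. *)
have nbside v : b v -> ~~ src_side o a v.
  move=> bv; apply: contra nbs => sv.
  have [|h _] := @src_side_between _ o a v (tgt o a).
    by rewrite sv (negbTE (src_side_tgt _ _)).
  exact: cb h.
have cases v w x : b v || src_side o a v -> b w || src_side o a w ->
    between v w x -> ~~ src_side o a x -> b x.
  move=> hv hw h nx.
  suff [y [z [by_ bz hb]]] : exists y z, [/\ b y, b z & between y z x] by apply: cb hb.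
  case/orP: hv => hv; case/orP: hw => hw.
  - by exists v, w.
  - exists v, (tgt o a); split=> //; move: h nx hw (nbside _ hv).
    by rewrite /between /src_side tgt_val; case: (o a) => /=; lia.
  - exists w, (tgt o a); split=> //; move: h nx hv (nbside _ hw).
    by rewrite /between /src_side tgt_val; case: (o a) => /=; lia.
  - by case/negP: nx; apply: src_side_convex h.
(* Test support: b with the part of c on the source side of [a]. It contains [src o a], so it must
   be c; hence c does not extend b at its other end. *)
have step1 v : c v -> b v || src_side o a v.
  pose d v := b v || (c v && src_side o a v).
  have dc w : d w -> c w by case/orP=> [/bc|/andP[]].
  have ds w : d w -> b w || src_side o a w by case/orP=> [h|/andP[_ h]]; rewrite h ?orbT.
  case: (H d).
  - move=> y z x dy dz h; rewrite /d; case: (boolP (src_side o a x)) => sx.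
      by rewrite (cc _ _ _ (dc _ dy) (dc _ dz) h) orbT.
    by rewrite (cases y z x) // ds.
  - exact: path_closed_sub gc.
  - by move=> e h1 /dc h2; rewrite (succ e) // /d h1.
  - move=> e h1 h2; rewrite dc //; symmetry; case/orP: h1 => [h1|/andP[h1 h3]].
      by rewrite /d (succ e).
    case: (boolP (src_side o a (tgt o e))) => h4; first by rewrite /d h2 h4 orbT.
    have -> : e = a by apply: (@src_side_cross _ o); rewrite h3 (negbTE h4).
    by rewrite /d bta.
  - by move=> w bw _; rewrite /d bw.
  - by move=> /(_ (src o a)); rewrite /d cs src_side_src (negbTE nbs).
  - by move=> E cv; apply: ds; rewrite E.
(* Now keep only the part of c that nonzero paths from [src o a] reach on that side; again the
   support can only be c. *)
have step2 v : c v -> b v || V_of o nz a v.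
  pose d v := b v || (c v && V_of o nz a v).
  have dc w : d w -> c w by case/orP=> [/bc|/andP[]].
  have ds w : d w -> b w || src_side o a w by case/orP=> [h|/andP[_ /andP[_ h]]]; rewrite h ?orbT.
  have dV w : d w -> src_side o a w -> V_of o nz a w.
    by case/orP=> [/nbside/negbTE->|/andP[]].
  case: (H d).
  - move=> y z x dy dz h; case: (boolP (src_side o a x)) => sx; last first.
      by rewrite /d (cases y z x) // ds.
    rewrite /d (cc _ _ _ (dc _ dy) (dc _ dz) h) /=; apply/orP; right.
    have [hs|hs] := src_side_nearer sx h.
      by case: hs => hs; apply: V_set_dir; apply: dV.
    by case: hs => hs; apply: V_set_dir; apply: dV.
  - exact: path_closed_sub gc.
  - by move=> e h1 /dc h2; rewrite (succ e) // /d h1.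
  - move=> e h1 h2; rewrite dc //; symmetry; case/orP: h1 => [h1|/andP[h1 h3]].
      by rewrite /d (succ e).
    case: (boolP (V_of o nz a (tgt o e))) => h4; first by rewrite /d h2 h4 orbT.
    case: (V_set_out h3 h4) => [->|/negP[]]; first by rewrite /d bta.
    apply: gc => [|x]; last exact: cc.
    by apply: dir_trans (dir_arrow o e); case/andP: h3 => /nzd.
  - by move=> w bw _; rewrite /d bw.
  - by move=> /(_ (src o a)); rewrite /d cs V_set_src (negbTE nbs).
  - by move=> E cv; have := E v; rewrite cv /d cv.
(* This time c is enlarged by [V_of]; the support differs from b at [src o a], so it is c. *)
have step3 v : V_of o nz a v -> c v.
  pose d v := c v || V_of o nz a v.
  case: (H d).
  - by apply: (convexU cs (V_set_src a)) => //; apply: V_set_convex.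
  (* A path that leaves c has both ends in [V_of], hence is part of a nonzero path from
     [src o a]. *)
  - move=> i j dij hd; case: (boolP [forall x, between i j x ==> c x]) => [/forallP h|].
      by apply: gc => // x hx; have := h x; rewrite hx.
    rewrite negb_forall => /existsP[x]; rewrite negb_imply => /andP[hx ncx].
    have Vx : V_of o nz a x by have := hd x hx; rewrite /d (negbTE ncx).
    have [sx nsx] : src_side o a x /\ nz (src o a) x by case/andP: Vx.
    have [dix dxj] := dir_sub dij hx.
    have si : src_side o a i by apply: src_side_dir dix sx.
    have sj : src_side o a j.
      apply: contraT => nsj; case/negP: ncx.
      by rewrite (src_side_away sx nsj) // (dir_between (nzd nsx)).
    have dV w : d w -> src_side o a w -> V_of o nz a w.
      by case/orP=> // /step2 /orP[/nbside/negbTE->|].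
    have /andP[Vi _] : V_of o nz a i by apply: dV => //; apply: hd; apply: between_l.
    have /andP[Vj _] : V_of o nz a j by apply: dV => //; apply: hd; apply: between_r.
    by have [] := nz_sub hnz Vj (dir_between (nzd Vi) dij).
  - move=> e h1 h2; have -> : d (src o e) by rewrite /d bc.
    symmetry; case/orP: h2 => [|/andP[_ h2]]; first exact: succ.
    have ea : e = a by apply: (@src_side_cross _ o); rewrite h2 (negbTE (nbside _ h1)).
    by rewrite ea.
  - move=> e h1 h2; have -> : d (tgt o e) by rewrite /d h2.
    case/orP: h1 => // /andP[h1 h3].
    by apply: (cc _ _ _ cs h2); apply: dir_between (nzd h1) (dir_arrow o e).
  - by move=> w bw cw; rewrite /d cw.
  - by move=> /(_ (src o a)); rewrite /d cs (negbTE nbs).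
  - by move=> E Vv; rewrite -E /d Vv orbT.
exists a; split=> // v; apply/andP/idP=> [[cv nbv]|Vv].
  by have := step2 v cv; rewrite (negbTE nbv).
by rewrite step3 //; split=> //; apply/negP=> /nbside; case/andP: Vv => _ ->.
Qed.

End ThinCombinatorics.

(** * Paths are determined by their ends *)

Section Paths.
Variables (n : nat) (o : 'I_n -> bool).
Implicit Types (i j k v w x : 'I_n.+1) (a e : 'I_n) (p q r : qpath o).
Notation walk := (is_walk (src o) (tgt o)).
Notation wend := (word_end (tgt o)).

Lemma src_neq_tgt a : src o a != tgt o a.
Proof. by apply/eqP=> /(congr1 val) /=; rewrite src_val tgt_val; case: (o a) => /=; lia. Qed.

Lemma arrow_eq a e : src o a = src o e -> tgt o a = tgt o e -> a = e.
Proof.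
move=> /(congr1 val) /= h1 /(congr1 val) /= h2; apply: val_inj => /=; move: h1 h2.
by rewrite !src_val !tgt_val; case: (o a); case: (o e) => /=; lia.
Qed.

Lemma dir_last i j : dir o i j -> i != j -> exists a, tgt o a = j /\ dir o i (src o a).
Proof.
move=> dij ij; have /dirP H := dij.
have {ij} : (i : nat) <> j by move=> h; case/eqP: ij; apply: val_inj.
case: (ltnP i j) => h ne.
  have jn : (j.-1 < n)%N by have := ltn_ord j; lia.
  have [/= h1 _] := H (Ordinal jn).
  have e : ~~ o (Ordinal jn) by apply: h1; lia.
  exists (Ordinal jn); split; first by apply: val_inj; rewrite /= tgt_val e /=; lia.
  by case: (dir_sub dij (x := src o (Ordinal jn))) => //; rewrite /between src_val (negbTE e) /=; lia.
have jn : (j < n)%N by have := ltn_ord i; lia.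
have [/= _ h1] := H (Ordinal jn).
have e : o (Ordinal jn) by apply: h1; lia.
exists (Ordinal jn); split; first by apply: val_inj; rewrite /= tgt_val e /=; lia.
by case: (dir_sub dij (x := src o (Ordinal jn))) => //; rewrite /between src_val e /=; lia.
Qed.

Lemma dir_not_back a i : dir o i (src o a) -> i != tgt o a.
Proof.
move=> d; apply/eqP=> ei; rewrite ei in d.
by have /eqP := dir_antisym (dir_arrow o a) d; rewrite (negbTE (src_neq_tgt a)).
Qed.

(** Two distinct arrows into one vertex come from its two neighbours, but a directed path from [i]
    arrives from the side of [i]. *)
Lemma last_arrow_unique a e i : dir o i (src o a) -> dir o i (src o e) ->
  tgt o a = tgt o e -> a = e.
Proof.
move=> da de h; apply: arrow_eq => //; apply: val_inj => /=.
have b1 := dir_between da (dir_arrow o a); have b2 := dir_between de (dir_arrow o e).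
have hv : (tgt o a : nat) = tgt o e by rewrite h.
move: b1 b2 hv; rewrite /between !src_val !tgt_val.
by case: (o a); case: (o e) => /=; lia.
Qed.

Lemma walk_dir i (s : seq 'I_n) : walk i s -> dir o i (wend i s).
Proof.
elim: s => [|a s IH] /=; first by rewrite dir_refl.
by case/andP=> /eqP h /IH d; apply: dir_trans (dir_arrow o a); rewrite h.
Qed.

Lemma walk_unique i (s t : seq 'I_n) : walk i s -> walk i t -> wend i s = wend i t -> s = t.
Proof.
elim: s t => [|a s IH] [|e t] //=.
- move=> _ /andP[/eqP h /walk_dir d] E.
  by rewrite -h in d; move: (dir_not_back d); rewrite E eqxx.
- move=> /andP[/eqP h /walk_dir d] _ E.
  by rewrite -h in d; move: (dir_not_back d); rewrite E eqxx.
move=> /andP[/eqP h1 w1] /andP[/eqP h2 w2] E.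
have ea : a = e by apply: (@last_arrow_unique _ _ i) => //; rewrite ?h1 ?h2; apply: walk_dir.
by rewrite ea (IH t) // -h1 -h2 ea.
Qed.

(** A walk never turns back, so its length is the distance of its ends; this yields the bound n
    built into [qpath]. *)
Lemma walk_size i (s : seq 'I_n) : walk i s ->
  size s = ((i - wend i s) + (wend i s - i))%N.
Proof.
elim: s => [|a s IH] /=; first by lia.
case/andP=> /eqP h ws; rewrite IH //.
have := dir_between (walk_dir ws) (x := wend i s) (j := tgt o a).
rewrite -h => /(_ (dir_arrow o a)); rewrite /between src_val tgt_val.
by case: (o a) => /=; lia.
Qed.

Lemma dir_walk i j : dir o i j -> exists s, walk i s /\ wend i s = j.
Proof.
have [m] := ubnP ((i - j) + (j - i))%N; elim: m j => // m IH j hm dij.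
case: (eqVneq i j) => [->|ij]; first by exists [::].
have [a [ta da]] := dir_last dij ij.
have [|s [ws es]] := IH _ _ da; last by exists (a :: s); rewrite /= ta es eqxx.
have := dir_between da (dir_arrow o a); move: hm; rewrite -ta.
have := dir_not_back da; rewrite -(inj_eq val_inj) /= /between src_val tgt_val.
by case: (o a) => /=; lia.
Qed.

Lemma word_end_cat (T : Type) (e : T -> 'I_n.+1) i s t :
  word_end e (word_end e i t) s = word_end e i (s ++ t).
Proof. by case: s. Qed.

Lemma is_walk_cat (T : Type) (f g : T -> 'I_n.+1) i s t :
  is_walk f g i (s ++ t) = is_walk f g (word_end g i t) s && is_walk f g i t.
Proof. by elim: s => //= c s ->; rewrite word_end_cat andbA. Qed.

Lemma walk_qpath i (s : seq 'I_n) : walk i s -> exists p, pstart p = i /\ pword p = s.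
Proof.
move=> ws; have sn : (size s <= n)%N.
  by rewrite (walk_size ws); have := ltn_ord i; have := ltn_ord (wend i s); lia.
by exists (exist _ (i, Bseq sn) ws).
Qed.

Lemma qpath_walk p : walk (pstart p) (pword p).
Proof. exact: (valP p). Qed.

Lemma dir_qpath i j : dir o i j -> exists p, pstart p = i /\ pend p = j.
Proof.
move=> /dir_walk[s [/walk_qpath[p [pi ps]] es]].
by exists p; rewrite /pend pi ps.
Qed.

Lemma qpath_dir p : dir o (pstart p) (pend p).
Proof. exact: walk_dir (qpath_walk p). Qed.

Lemma qpath_word p q : pstart p = pstart q -> pend p = pend q -> pword p = pword q.
Proof.
move=> h1 h2; apply: (@walk_unique (pstart q)); last by rewrite -[RHS]h2 /pend h1.
  by rewrite -h1 qpath_walk.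
exact: qpath_walk.
Qed.

Lemma qpath_word_inj p q : pstart p = pstart q -> pword p = pword q -> p = q.
Proof.
move=> h1 h2; apply: val_inj; move: h1 h2; rewrite /pstart /pword.
case: (val p) => i s; case: (val q) => j t /= -> h.
by congr (_, _); apply: val_inj.
Qed.

Lemma qpath_unique p q : pstart p = pstart q -> pend p = pend q -> p = q.
Proof. by move=> h1 h2; apply: qpath_word_inj => //; apply: qpath_word. Qed.

Lemma qpath_cat p q r : pstart q = pend p -> pstart r = pstart p -> pend r = pend q ->
  pword r = pword q ++ pword p.
Proof.
move=> h1 h2 h3; apply: (@walk_unique (pstart r)); first exact: qpath_walk.
  by rewrite is_walk_cat h2 -[word_end _ _ _]/(pend p) -h1 !qpath_walk.
by rewrite -word_end_cat h2 -[word_end _ (pstart p) (pword p)]/(pend p) -h1 -[RHS]/(pend q) -h3 /pend h2.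
Qed.

Lemma pend_nil p : (pword p == [::]) = (pend p == pstart p).
Proof.
apply/eqP/eqP => [e|e]; first by rewrite /pend e.
by apply: (@walk_unique (pstart p)) => //; apply: qpath_walk.
Qed.

End Paths.

(** * Multiplication of basis paths *)

Section PathAlgebra.
Local Open Scope ring_scope.
Variables (K : fieldType) (n : nat) (o : 'I_n -> bool).
Implicit Types (i j k : 'I_n.+1) (a : 'I_n) (p q r : qpath o).
Notation A := (path_alg K o).

(** As a path is determined by its ends, this is the basis element of the path from [i] to [j], or
    zero when there is none; no path has to be chosen. *)
Definition pij i j : A := [ffun p => ((pstart p == i) && (pend p == j))%:R].

Lemma pij_pelt p : pij (pstart p) (pend p) = pelt K p.
Proof.
apply/ffunP=> q; rewrite !ffunE; congr (_%:R); apply/congr1.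
by apply/andP/eqP=> [[/eqP h1 /eqP h2]|->//]; apply: qpath_unique.
Qed.

Lemma pij0 i j : ~~ dir o i j -> pij i j = 0.
Proof.
move=> h; apply/ffunP=> q; rewrite !ffunE.
by case: eqP => // e1; case: eqP => // e2; case/negP: h; rewrite -e1 -e2 qpath_dir.
Qed.

Lemma pidemE i : pidem K o i = pij i i.
Proof.
apply/ffunP=> q; rewrite !ffunE pend_nil; congr ((nat_of_bool _)%:R).
by case: (eqVneq (pstart q) i) => [->|].
Qed.

Lemma parrowE a : parrow K o a = pij (src o a) (tgt o a).
Proof.
apply/ffunP=> q; rewrite !ffunE; congr ((nat_of_bool _)%:R).
have wa : is_walk (src o) (tgt o) (src o a) [:: a] by rewrite /= eqxx.
apply/eqP/andP=> [h|[/eqP h1 /eqP h2]]; last first.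
  apply: walk_unique wa _; first by rewrite -h1; exact: qpath_walk.
  by rewrite -[RHS]/(tgt o a) -h2 /pend h1.
by have := qpath_walk q; rewrite /pend h /= andbT => /eqP->.
Qed.

Lemma pmulE (x y : A) p : pmul x y p = \sum_(q : qpath o) \sum_(r : qpath o |
     [&& pstart q == pend r, pstart p == pstart r
       & pword p == pword q ++ pword r]) x q * y r.
Proof. by rewrite ffunE. Qed.

Lemma pmul_linl y : linear (fun x : A => pmul x y : A).
Proof.
move=> c u v; apply/ffunP=> p; rewrite !ffunE scaler_sumr -big_split /=.
apply: eq_bigr => q _; rewrite scaler_sumr -big_split /=; apply: eq_bigr => r _.
by rewrite !ffunE mulrDl -scalerAl.
Qed.

Lemma pmul_linr x : linear (fun y : A => pmul x y : A).
Proof.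
move=> c u v; apply/ffunP=> p; rewrite !ffunE scaler_sumr -big_split /=.
apply: eq_bigr => q _; rewrite scaler_sumr -big_split /=; apply: eq_bigr => r _.
by rewrite !ffunE mulrDr -scalerAr.
Qed.

Lemma pelt_cond p q r : (pstart q == pend r) && (pstart p == pstart r) &&
   (pword p == pword q ++ pword r) = [&& pstart q == pend r, pstart p == pstart r & pend p == pend q].
Proof.
rewrite -andbA; case: eqP => //= h1; case: eqP => //= h2.
apply/eqP/eqP=> [e|e]; last by apply: qpath_cat.
by rewrite /pend e h2 -word_end_cat -[word_end _ (pstart r) _]/(pend r) -h1.
Qed.

Lemma pmul_pelt q r : pmul (pelt K q) (pelt K r) =
  if pstart q == pend r then pij (pstart r) (pend q) else 0.
Proof.
apply/ffunP=> p; rewrite pmulE (bigD1 q) //= [X in _ + X]big1 ?addr0; last first.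
  by move=> q' /negbTE e; apply: big1 => r' _; rewrite !ffunE e mul0r.
under eq_bigl => r' do rewrite andbA pelt_cond.
rewrite big_mkcond (bigD1 r) //= [X in _ + X]big1 ?addr0; last first.
  by move=> r' /negbTE e; case: ifP => // _; rewrite !ffunE e mulr0.
rewrite !ffunE !eqxx mulr1; case: (pstart q == pend r) => /=; last by rewrite ffunE.
by rewrite ffunE; case: (_ && _).
Qed.

Lemma pmul_pij i j k : dir o i j -> dir o j k -> pmul (pij j k) (pij i j) = pij i k.
Proof.
move=> /dir_qpath[p [<- <-]] /dir_qpath[q [e <-]].
by rewrite -{1}e !pij_pelt pmul_pelt e eqxx.
Qed.

Lemma pmul_idl j (x : A) p : pmul (pij j j) x p = if pend p == j then x p else 0.
Proof.
have [t [ti te]] := dir_qpath (dir_refl o j).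
rewrite -{1}ti -te pij_pelt pmulE (bigD1 t) //= [X in _ + X]big1 ?addr0; last first.
  by move=> q' /negbTE e; apply: big1 => r' _; rewrite !ffunE e mul0r.
under eq_bigl => r' do rewrite andbA pelt_cond.
under eq_bigr => r' _ do rewrite ffunE eqxx mul1r.
rewrite big_mkcond (bigD1 p) //= [X in _ + X]big1 ?addr0; last first.
  move=> r' /eqP ne; case: ifP => // /and3P[/eqP h1 /eqP h2 /eqP h3].
  by case: ne; apply: qpath_unique; rewrite -?h1 // h3 te.
by rewrite eqxx /= te ti eq_sym andbb.
Qed.

Lemma pmul_idr i (x : A) p : pmul x (pij i i) p = if pstart p == i then x p else 0.
Proof.
have [t [ti te]] := dir_qpath (dir_refl o i).
rewrite -{1}ti -te pij_pelt pmulE (exchange_big_dep predT) //=.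
rewrite (bigD1 t) //= [X in _ + X]big1 ?addr0; last first.
  by move=> q' /negbTE e; apply: big1 => r' _; rewrite !ffunE e mulr0.
under eq_bigl => r' do rewrite andbA pelt_cond.
under eq_bigr => r' _ do rewrite ffunE eqxx mulr1.
rewrite big_mkcond (bigD1 p) //= [X in _ + X]big1 ?addr0; last first.
  move=> r' /eqP ne; case: ifP => // /and3P[/eqP h1 /eqP h2 /eqP h3].
  by case: ne; apply: qpath_unique; rewrite ?h3 // h1 h2 ti te.
by rewrite eqxx /= te ti andbT andbb.
Qed.

End PathAlgebra.

(** * Admissible ideals are spanned by paths *)

Section Ideal.
Local Open Scope ring_scope.
Variables (K : fieldType) (n : nat) (o : 'I_n -> bool) (I : {vspace path_alg K o}).
Hypothesis hI : admissible I.
Implicit Types (i j k : 'I_n.+1) (a : 'I_n) (p q r : qpath o).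
Notation A := (path_alg K o).

Definition nz i j : bool := pij K o i j \notin I.

Lemma ideal_l (x y : A) : y \in I -> pmul x y \in I.
Proof. by case: hI => h _ /h H; case: (H x). Qed.

Lemma ideal_r (x y : A) : x \in I -> pmul x y \in I.
Proof. by case: hI => h _ /h H; case: (H y). Qed.

Lemma nz_short p : (size (pword p) < 2)%N -> pelt K p \notin I.
Proof.
case: hI => _ [m _ [_ H]] sp; apply/negP=> /H /(_ p sp); rewrite ffunE eqxx => /eqP.
by rewrite oner_eq0.
Qed.

Lemma nz_nonzero_paths : nonzero_paths o nz.
Proof.
split.
- by move=> i j; apply: contraNT => /pij0 ->; apply: mem0v.
- move=> i; have [p [e1 e2]] := dir_qpath (dir_refl o i).
  rewrite /nz -{1}e1 -e2 pij_pelt; apply: nz_short.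
  by have := pend_nil p; rewrite e1 e2 eqxx => /eqP->.
- move=> a; have [p [e1 e2]] := dir_qpath (dir_arrow o a).
  rewrite /nz -e1 -e2 pij_pelt; apply: nz_short.
  by rewrite (walk_size (qpath_walk p)) -[word_end _ _ _]/(pend p) e1 e2 src_val tgt_val; case: (o a) => /=; lia.
- move=> i j x h b.
  have dij : dir o i j by apply: contraR h => /pij0 ->; apply: mem0v.
  have [d1 d2] := dir_sub dij b.
  by split; apply: contra h => h; rewrite /nz -(pmul_pij K d1 d2); [apply: ideal_l|apply: ideal_r].
Qed.

(** Cutting [x] with the trivial paths at the ends of [p] leaves its coefficient at [p] alone,
    because no other path has these ends. *)
Lemma ideal_coef (x : A) p : x \in I -> x p != 0 -> pelt K p \in I.
Proof.
move=> xI xp; have H : pmul (pij K o (pend p) (pend p)) (pmul x (pij K o (pstart p) (pstart p))) = (x p : K) *: (pelt K p : A).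
  apply/ffunP=> q; rewrite pmul_idl pmul_idr !ffunE.
  case: (eqVneq q p) => [->|ne]; first by rewrite !eqxx [_ *: _]mulr1.
  rewrite [_ *: _]mulr0; case: eqP => // h1; case: eqP => // h2.
  by case/eqP: ne; apply: qpath_unique.
have : (x p : K) *: (pelt K p : A) \in I by rewrite -H; apply/ideal_l/ideal_r.
move=> h; have := memvZ (x p : K)^-1 h.
by rewrite scalerA mulVf // scale1r.
Qed.

Lemma nz_pelt p : (pelt K p \in I) = ~~ nz (pstart p) (pend p).
Proof. by rewrite /nz negbK pij_pelt. Qed.

End Ideal.

(** * Action of a path on a representation *)

Section PathMaps.
Local Open Scope ring_scope.
Variables (K : fieldType) (n : nat) (o : 'I_n -> bool).
Implicit Types (X Y : rep K o) (i j k : 'I_n.+1) (a : 'I_n) (p q : qpath o).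

Lemma single_in X i (x : X i) : single x i = x.
Proof. by rewrite /single dfwith_in. Qed.

Lemma single_out X i (x : X i) j : j != i -> single x j = 0.
Proof. by move=> ji; rewrite /single dfwith_out // eq_sym. Qed.

Lemma single_linear X i j : linear (fun x : X i => single x j).
Proof.
move=> c x y; case: (eqVneq j i) => [->|ji]; first by rewrite !single_in.
by rewrite !single_out // scaler0 addr0.
Qed.

Definition word_act X i (s : seq 'I_n) (v : forall i, X i) : forall i, X i :=
  foldr (fun a u => single (rmap X a (u (src o a)))) (single (v i)) s.

Lemma path_actE X p (v : forall i, X i) : path_act p v = word_act (pstart p) (pword p) v.
Proof. by []. Qed.

Lemma word_act_linear X i s j : linear (fun x : X i => word_act i s (single x) j).
Proof.
move=> c x y; elim: s j => [|a s IH] j /=.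
  by rewrite /word_act /= !single_in single_linear.
by rewrite /word_act /= -!/(word_act _ _ _) IH linearP single_linear.
Qed.

Lemma word_act_out X i s (v : forall i, X i) j : j != word_end (tgt o) i s -> word_act i s v j = 0.
Proof. by case: s => [|a s] /= h; rewrite /word_act /= single_out. Qed.

Lemma word_act_single X i s (v : forall i, X i) : word_act i s (single (v i)) = word_act i s v.
Proof. by rewrite /word_act single_in. Qed.

(** The action of the path from [i] to [j], with default value zero when there is none, so that it
    is total in the vertices. *)
Definition pmap_fun X i j (x : X i) : X j :=
  if [pick p : qpath o | (pstart p == i) && (pend p == j)] is Some p
  then word_act i (pword p) (single x) j else 0.

Definition pm X i j : 'Hom(X i, X j) := linfun (@pmap_fun X i j).

Lemma pm_fun X i j x : pm X i j x = pmap_fun j x.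
Proof.
apply: linfunE => c u v; rewrite /pmap_fun; case: pickP => [p _|_]; last by rewrite scaler0 addr0.
exact: word_act_linear.
Qed.

Lemma pm_word X i s x : is_walk (src o) (tgt o) i s ->
  pm X i (word_end (tgt o) i s) x = word_act i s (single x) (word_end (tgt o) i s).
Proof.
move=> ws; rewrite pm_fun /pmap_fun; case: pickP => [p /andP[/eqP h1 /eqP h2]|H]; last first.
  by have [p [h1 h2]] := walk_qpath ws; have := H p; rewrite /pend h1 h2 !eqxx.
have -> // : pword p = s.
by apply: (@walk_unique _ o i) => //; rewrite -{1}h1 ?qpath_walk // -h1.
Qed.

Lemma pm_wordE X i j s x : is_walk (src o) (tgt o) i s -> word_end (tgt o) i s = j ->
  pm X i j x = word_act i s (single x) j.
Proof. by move=> ws <-; apply: pm_word. Qed.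

Lemma pm_path X p (v : forall i, X i) : pm X (pstart p) (pend p) (v (pstart p)) = path_act p v (pend p).
Proof. by rewrite (pm_word _ (qpath_walk p)) word_act_single. Qed.

Lemma pm0 X i j x : ~~ dir o i j -> pm X i j x = 0.
Proof.
move=> h; rewrite pm_fun /pmap_fun; case: pickP => // p /andP[/eqP h1 /eqP h2].
by case/negP: h; rewrite -h1 -h2 qpath_dir.
Qed.

Lemma pm_refl X i x : pm X i i x = x.
Proof. by rewrite (@pm_word X i [::]) //= /word_act /= !single_in. Qed.

Lemma pm_arrow X i a x : dir o i (src o a) -> rmap X a (pm X i (src o a) x) = pm X i (tgt o a) x.
Proof.
move=> /dir_walk[s [ws es]].
have ws' : is_walk (src o) (tgt o) i (a :: s) by rewrite /= es eqxx.
by rewrite (pm_wordE _ ws es) (pm_wordE _ ws' (erefl _)) /word_act /= !single_in.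
Qed.

Lemma pm_arrow_r X a j x : dir o (tgt o a) j -> pm X (tgt o a) j (rmap X a x) = pm X (src o a) j x.
Proof.
move=> /dir_walk[s [ws <-]].
have ws' : is_walk (src o) (tgt o) (src o a) (s ++ [:: a]) by rewrite is_walk_cat /= eqxx ws.
have e : word_end (tgt o) (src o a) (s ++ [:: a]) = word_end (tgt o) (tgt o a) s.
  by rewrite -word_end_cat.
rewrite (pm_wordE _ ws (erefl _)) (pm_wordE _ ws' e) /word_act foldr_cat /=.
by rewrite !single_in.
Qed.

Lemma dir_ind i (P : 'I_n.+1 -> Prop) : P i ->
  (forall a, dir o i (src o a) -> P (src o a) -> P (tgt o a)) ->
  forall j, dir o i j -> P j.
Proof.
move=> Pi Pa j /dir_walk[s [ws <-]].
elim: s ws => //= a s IH /andP[/eqP h ws]; apply: Pa; rewrite h; last exact: IH.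
exact: walk_dir.
Qed.

Lemma pm_comp X i k j x : dir o i k -> dir o k j -> pm X k j (pm X i k x) = pm X i j x.
Proof.
move=> d; move: j; apply: dir_ind => [|a d' IH]; first by rewrite pm_refl.
by rewrite -pm_arrow // IH pm_arrow //; apply: dir_trans d'.
Qed.

Lemma pm_hom X Y (f : rhom X Y) i j x : f j (pm X i j x) = pm Y i j (f i x).
Proof.
case: (boolP (dir o i j)) => d; last by rewrite !pm0 // linear0.
move: j d; apply: dir_ind => [|a d IH]; first by rewrite !pm_refl.
by rewrite -pm_arrow // -rhomE IH pm_arrow.
Qed.

Variable I : {vspace path_alg K o}.
Hypothesis hI : admissible I.

(** A relation can be tested on one path at a time, since every path with a nonzero coefficient in
    an element of I lies in I. *)
Lemma in_modP X : in_mod I X <-> forall i j x, ~~ nz I i j -> pm X i j x = 0.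
Proof.
split=> [H i j x|H u uI v j].
  case: (boolP (dir o i j)) => d; last by move=> _; apply: pm0.
  have [p [e1 e2]] := dir_qpath d; rewrite -{}e1 -{}e2 in x * => hp.
  have pI : pelt K p \in I by rewrite nz_pelt.
  have := H _ pI (single x) (pend p); rewrite (bigD1 p) //= [X in _ + X]big1 ?addr0.
    by rewrite ffunE eqxx scale1r -pm_path single_in.
  by move=> q /negbTE e; rewrite ffunE e scale0r.
apply: big1 => p _; case: (eqVneq (u p) 0) => [->|up]; first by rewrite scale0r.
have := ideal_coef hI uI up; rewrite nz_pelt => hp.
case: (eqVneq j (pend p)) => [->|h]; first by rewrite -pm_path H // scaler0.
by rewrite path_actE word_act_out ?scaler0.
Qed.

End PathMaps.

(** * Thin representations and their morphisms *)

Section Thin.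
Local Open Scope ring_scope.
Variables (K : fieldType) (n : nat) (o : 'I_n -> bool).
Implicit Types (X Y M N : rep K o) (i j k v w : 'I_n.+1) (a : 'I_n) (b c d : pred 'I_n.+1).

(** [string_rep] unfolds to this with b an interval. [const_mx 1] is the identity between two
    one-dimensional spaces and an empty matrix otherwise. *)
Definition thin b : rep K o :=
  Rep (fun k => 'rV[K]_(b k) : vectType K)
      (fun a => linfun (mulmxr (const_mx 1 : 'M[K]_(b (src o a), b (tgt o a))))).

Arguments thin : simpl never.

Definition thin1 b k : thin b k := const_mx 1.
(** The coordinate of a vector, as a sum of at most one entry: total in [k], and zero outside the
    support. *)
Definition cf b k (u : thin b k) : K := \sum_j (u : 'rV[K]_(b k)) 0 j.

Lemma cfP b k (c : K) (u v : thin b k) : cf (c *: u + v) = c * cf u + cf v.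
Proof.
by rewrite /cf mulr_sumr -big_split /=; apply: eq_bigr => j _; rewrite !mxE.
Qed.

Lemma cf0 b k : cf (0 : thin b k) = 0.
Proof. by rewrite /cf big1 // => j _; rewrite mxE. Qed.

Lemma cfZ b k (c : K) (u : thin b k) : cf (c *: u) = c * cf u.
Proof. by rewrite -[_ *: _]addr0 cfP cf0 addr0. Qed.

Lemma cf_thin1 b k : cf (thin1 b k) = (b k)%:R.
Proof. by rewrite /cf /thin1; case: (b k); rewrite ?big_ord0 // big_ord1 mxE. Qed.

Lemma cfK b k (u : thin b k) : cf u *: thin1 b k = u.
Proof.
apply/rowP=> j; rewrite !mxE mulr1 /cf; move: u j; rewrite /thin /=.
by case: (b k) => u j; [rewrite big_ord1 (ord1 j)|case: j].
Qed.

Lemma thin_out0 b k (u : thin b k) : ~~ b k -> u = 0.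
Proof.
by move=> /negbTE h; rewrite -[u]cfK -[thin1 b k]cfK cf_thin1 h scale0r scaler0.
Qed.

Lemma cf_out b k (u : thin b k) : ~~ b k -> cf u = 0.
Proof. by move=> h; rewrite (thin_out0 u h) cf0. Qed.

Lemma thin1_neq0 b k : b k -> thin1 b k != 0.
Proof.
by move=> h; apply/eqP=> /(congr1 (@cf b k)); rewrite cf_thin1 h cf0 => /eqP; rewrite oner_eq0.
Qed.

Lemma thin_map b a u : rmap (thin b) a u = cf u *: thin1 b (tgt o a).
Proof. by rewrite lfunE /=; apply/rowP=> j; rewrite !mxE mulr1; apply: eq_bigr => k _; rewrite !mxE mulr1. Qed.

Lemma thin_homE b X (f : rhom (thin b) X) v u : f v u = cf u *: f v (thin1 b v).
Proof. by rewrite -{1}[u]cfK linearZ. Qed.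

(** A morphism from [thin b] amounts to images of the basis vectors, constrained only by arrows that
    start in b. In the dual [thin_hom_out] only arrows that end in b count. *)
Lemma thin_hom_in b X (x : forall v, X v) :
  (forall a, b (src o a) -> rmap X a (x (src o a)) = if b (tgt o a) then x (tgt o a) else 0) ->
  exists f : rhom (thin b) X, forall v, b v -> f v (thin1 b v) = x v.
Proof.
move=> H; have [v c y z|a u|f fE] := @linear_rhom _ _ _ (thin b) X (fun v u => cf u *: x v).
- by rewrite cfP scalerDl scalerA.
- rewrite thin_map linearZ cfZ /= cf_thin1.
  have [h|h] := boolP (b (src o a)); last by rewrite cf_out // scale0r mul0r scale0r.
  rewrite H //; have [h'|h'] := boolP (b (tgt o a)); first by rewrite mulr1.
  by rewrite mulr0 scale0r scaler0.
by exists f => v bv; rewrite fE cf_thin1 bv scale1r.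
Qed.

Lemma thin_hom_out b X (phi : forall v, 'Hom(X v, K^o)) :
  (forall a x, b (tgt o a) ->
     phi (tgt o a) (rmap X a x) = if b (src o a) then phi (src o a) x else 0) ->
  exists f : rhom X (thin b), forall v x, f v x = phi v x *: thin1 b v.
Proof.
move=> H; apply: (@linear_rhom _ _ _ X (thin b) (fun v x => (phi v x : K) *: thin1 b v)).
  by move=> v c y z; rewrite linearP scalerDl scalerA.
move=> a x; rewrite thin_map cfZ cf_thin1.
have [h|h] := boolP (b (tgt o a)); last by rewrite !(thin_out0 (thin1 b (tgt o a)) h) !scaler0.
by rewrite H //; have [h'|h'] := boolP (b (src o a)); rewrite ?mulr1 // mulr0.
Qed.

Lemma thin_can b c : compatible o b c ->
  exists f : rhom (thin b) (thin c), forall v u, f v u = cf u *: thin1 c v.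
Proof.
move=> H; have [a ba|f fE] := @thin_hom_in b (thin c) (fun v => thin1 c v).
  rewrite thin_map cf_thin1; have [h|h] := boolP (c (tgt o a)).
    by rewrite (H a) //; have [h'|h'] := boolP (b (tgt o a)); rewrite ?scale1r // scale0r.
  by rewrite !(thin_out0 (thin1 c (tgt o a)) h) scaler0 if_same.
exists f => v u; rewrite thin_homE; have [h|h] := boolP (b v); first by rewrite fE.
by rewrite cf_out // !scale0r.
Qed.

Definition coef b c (f : rhom (thin b) (thin c)) v : K := cf (f v (thin1 b v)).

Lemma thin_homE2 b c (f : rhom (thin b) (thin c)) v u : f v u = (coef f v * cf u) *: thin1 c v.
Proof. by rewrite thin_homE mulrC -scalerA cfK. Qed.

Lemma coef_arrow b c (f : rhom (thin b) (thin c)) a :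
  b (src o a) -> c (tgt o a) -> coef f (src o a) = coef f (tgt o a).
Proof.
move=> h1 h2; have := congr1 (@cf _ _) (rhomE f (thin1 b (src o a))).
by rewrite !thin_map cf_thin1 h1 scale1r cfZ cf_thin1 h2 mulr1.
Qed.

(** A change of the coefficient would occur along an arrow with both ends in the common support,
    where commutation forbids it. *)
Lemma coef_const b c (f : rhom (thin b) (thin c)) v w :
  convex (fun k => b k && c k) -> b v && c v -> b w && c w -> coef f v = coef f w.
Proof.
move=> cvx hv hw; apply/eqP; apply: contraT => ne.
rewrite eq_sym in ne.
have [a [ha [b1 b2]]] := @crossing _ o (fun k => coef f k == coef f v) v w (eqxx _) ne.
have /andP[h1 _] := cvx _ _ _ hv hw b1; have /andP[_ h2] := cvx _ _ _ hv hw b2.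
by move: ha; rewrite (coef_arrow f h1 h2) eqxx.
Qed.

Lemma pm_thin b i j : (forall x, between i j x -> b x) -> dir o i j ->
  pm (thin b) i j (thin1 b i) = thin1 b j.
Proof.
move=> H d; move: j d H; apply: dir_ind => [_|a d IH H]; first by rewrite pm_refl.
rewrite -pm_arrow // IH ?thin_map ?cf_thin1 ?H ?scale1r //.
  exact: dir_between (dir_arrow o a).
move=> x hx; apply: H; have := dir_between d (dir_arrow o a).
by move: hx; rewrite /between; lia.
Qed.

Section InMod.
Variable I : {vspace path_alg K o}.
Hypothesis hI : admissible I.

(** A path that lies in I leaves the support on its way, so it acts through a zero space. *)
Lemma thin_in_mod b : path_closed o (nz I) b -> in_mod I (thin b).
Proof.
move=> gb; apply/(in_modP hI) => i j u hn; case: (boolP (dir o i j)) => d; last exact: pm0.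
have [x hx nbx] : exists2 x, between i j x & ~~ b x.
  case: (boolP [forall x, between i j x ==> b x]) => [/forallP h|].
    by case/negP: hn; apply: gb => // x hx; have := h x; rewrite hx.
  by rewrite negb_forall => /existsP[x]; rewrite negb_imply => /andP[]; exists x.
have [d1 d2] := dir_sub d hx.
by rewrite -(pm_comp _ d1 d2) (thin_out0 (pm (thin b) i x u) nbx) linear0.
Qed.

Lemma in_mod_thin b : in_mod I (thin b) -> path_closed o (nz I) b.
Proof.
move=> /(in_modP hI) H i j d hb; apply: contraT => hn; have := H i j (thin1 b i) hn.
by rewrite pm_thin // => /eqP; rewrite (negbTE (thin1_neq0 _)) // hb // between_r.
Qed.

End InMod.

Lemma convexx b : convex b -> convex (fun k => b k && b k).
Proof. by move=> cb; apply: convexI. Qed.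

Lemma is_zero_thin b : is_zero (thin b) <-> forall v, ~~ b v.
Proof.
split=> [/is_zeroP H v|H]; last by apply/is_zeroP=> v u; apply: thin_out0.
by apply/negP=> /thin1_neq0; rewrite (H v (thin1 b v)) eqxx.
Qed.

(** Endomorphisms are scalars, so the projection onto a summand is scalar too; whether the scalar is
    zero decides which summand vanishes. *)
Lemma thin_indec b v0 : b v0 -> convex b -> indecomposable (thin b).
Proof.
move=> b0 cb; split=> [/is_zero_thin /(_ v0)|X Y [f /iso_inv[g [ig gf fg]]]]; first by rewrite b0.
have [q qE] := dsum_fst X Y; have [r rE] := dsum_inl X Y.
pose p := rcomp r q; have pE v u : p v u = (u.1, 0) by rewrite rcompE rE qE.
pose e := rcomp g (rcomp p f).
have ec v : b v -> coef e v = coef e v0.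
  by move=> bv; apply: coef_const; rewrite ?bv ?b0 //; apply: convexx.
have eE v u : e v u = coef e v0 *: u.
  have [bv|bv] := boolP (b v); last by rewrite (thin_out0 u bv) !linear0.
  by rewrite thin_homE2 ec // -scalerA cfK.
have pS v x : p v x = coef e v0 *: x.
  have eg : e v (g v x) = g v (p v x) by rewrite !rcompE fg.
  by have := congr1 (f v) (eE v (g v x)); rewrite eg fg => ->; rewrite linearZ /= fg.
case: (eqVneq (coef e v0) 0) => c0; [left|right]; apply/is_zeroP=> v x.
  by have := pS v (x, 0); rewrite pE c0 scale0r => /(congr1 fst).
have := pS v (0, x); rewrite pE => /(congr1 snd) /= /esym /eqP.
by rewrite scaler_eq0 (negbTE c0) => /eqP.
Qed.

Lemma thin_iso_support b c : isomorphic (thin b) (thin c) -> forall v, b v = c v.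
Proof.
move=> [f /iso_inv[g [_ gf fg]]] v; have [bv|bv] := boolP (b v); have [cv|cv] := boolP (c v) => //.
  have := gf v (thin1 b v); rewrite (thin_out0 (f v _) cv) linear0 => /esym /eqP.
  by rewrite (negbTE (thin1_neq0 bv)).
have := fg v (thin1 c v); rewrite (thin_out0 (g v _) bv) linear0 => /esym /eqP.
by rewrite (negbTE (thin1_neq0 cv)).
Qed.

(** An equality rather than an isomorphism, so that the types of morphisms can be rewritten with
    it. *)
Lemma thin_eq b c : b =1 c -> thin b = thin c.
Proof. by move=> /functional_extensionality ->. Qed.

End Thin.

(** * An interval and its retraction inside a representation *)

Section Decomposition.
Local Open Scope ring_scope.
Variables (K : fieldType) (n : nat) (o : 'I_n -> bool) (M : rep K o) (i : 'I_n.+1).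
Implicit Types (v w : 'I_n.+1) (a : 'I_n).

(** These are the data from which maps out of and into an interval module are built. Nothing is
    asked away from the interval, so a family can be altered there at will. *)
Definition section_upto w (x : forall v, M v) : Prop :=
  forall a, (i <= a < w)%N -> rmap M a (x (src o a)) = x (tgt o a).
Definition cosection_upto w (phi : forall v, 'Hom(M v, K^o)) : Prop :=
  forall a, (i <= a < w)%N -> forall y, phi (tgt o a) (rmap M a y) = phi (src o a) y.

Lemma section_upto_linear w c x y : section_upto w x -> section_upto w y ->
  section_upto w (fun v => c *: x v + y v).
Proof. by move=> hx hy a ha; rewrite linearP /= hx // hy. Qed.

Lemma section_upto_0 w : section_upto w (fun v => 0).
Proof. by move=> a _; rewrite linear0. Qed.

Lemma src_le a w : (a < w)%N -> (src o a <= w)%N.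
Proof. by rewrite src_val; case: (o a) => /=; lia. Qed.
Lemma tgt_le a w : (a < w)%N -> (tgt o a <= w)%N.
Proof. by rewrite tgt_val; case: (o a) => /=; lia. Qed.

Lemma neq_of_le v w : (v < w)%N -> w != v.
Proof. by move=> h; apply/eqP=> e; rewrite e ltnn in h. Qed.

(** Induct on the interval, moving the functional at [w] across the last edge; agreement on
    compatible vectors is what makes each move well defined. *)
Lemma cosection_extend w (psi : 'Hom(M i, K^o)) (phi' : 'Hom(M w, K^o)) :
  (i <= w)%N ->
  (forall x, section_upto w x -> psi (x i) = phi' (x w)) ->
  exists phi, [/\ cosection_upto w phi, phi i = psi & phi w = phi'].
Proof.
move=> iw; have [m em] : exists m, w = (i + m)%N :> nat by exists (w - i)%N; rewrite subnKC.
elim: m w em phi' {iw} => [|m IH] w em phi' H.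
  have ew : w = i by apply: val_inj; rewrite /= em addn0.
  subst w; pose phi0 : forall v, 'Hom(M v, K^o) := fun v => 0.
  exists (dfwith phi0 psi); split.
  - by move=> a; lia.
  - by rewrite dfwith_in.
  rewrite dfwith_in; apply/lfunP=> y; have := H (single y); rewrite single_in; apply.
  by move=> a; lia.
have an : (i + m < n)%N by have := ltn_ord w; lia.
pose a := Ordinal an.
have [oa|oa] := boolP (o a).
  have ew : w = src o a by apply: val_inj; rewrite /= src_val oa em /=; lia.
  have ew' : tgt o a = (i + m)%N :> nat by rewrite tgt_val oa /=; lia.
  have lt : (tgt o a < src o a)%N by rewrite src_val ew' oa /=; lia.
  have lti : (i < src o a)%N by rewrite src_val /=; lia.
  subst w.
  (* The edge points towards [i]: the functional at its target must induce [phi'] through the arrow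
     and match [psi] on compatible families. *)
  pose R (y : M (tgt o a)) (c : K^o) := exists x z, [/\ section_upto (tgt o a) x,
    y = x (tgt o a) + rmap M a z & c = psi (x i) + phi' z].
  have [f hf] : exists f : 'Hom(M (tgt o a), K^o), forall y c, R y c -> f y = c.
    apply: linear_relation_hom.
    - by exists (fun v => 0), 0; rewrite !linear0 !addr0; split=> //; apply: section_upto_0.
    - move=> c _ _ _ _ [x [z [sx -> ->]]] [x' [z' [sx' -> ->]]].
      exists (fun v => c *: x v + x' v), (c *: z + z'); split.
      + exact: section_upto_linear.
      + by rewrite linearP /= scalerDr addrACA.
      + by rewrite !linearP /= scalerDr addrACA.
    - move=> _ [x [z [sx e ->]]].
      (* If the two contributions cancel, - z prolongs [x] by one edge and the hypothesis applies to
         the longer family. *)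
      pose x' := dfwith x (- z).
      have xi : x' i = x i by rewrite /x' dfwith_out // neq_of_le.
      have xw : x' (src o a) = - z by rewrite /x' dfwith_in.
      suff sx' : section_upto (src o a) x'.
        by have := H x' sx'; rewrite xi xw linearN => ->; rewrite addNr.
      move=> a' ha'; case: (eqVneq a' a) => [->|ne].
        rewrite xw /x' dfwith_out ?neq_of_le // linearN.
        by apply/eqP; rewrite eq_sym -addr_eq0 -e.
      have ltw : (a' < tgt o a)%N.
        have ne' : (a' : nat) <> a by move=> h; case/eqP: ne; apply: val_inj.
        by rewrite ew'; move: ha' ne'; rewrite em /=; lia.
      rewrite /x' !dfwith_out; first by apply: sx; move: ha'; lia.
        by apply: neq_of_le; apply: leq_ltn_trans lt; apply: tgt_le.
      by apply: neq_of_le; apply: leq_ltn_trans lt; apply: src_le.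
  have [|phi [h1 h2 h3]] := IH _ ew' f.
    move=> x sx; symmetry; apply: hf; exists x, 0.
    by rewrite !linear0 !addr0.
  exists (dfwith phi phi'); split.
  - move=> a' ha' y; case: (eqVneq a' a) y => [->|ne] y.
      rewrite dfwith_in dfwith_out ?neq_of_le // h3; apply: hf.
      by exists (fun v => 0), y; rewrite linear0 !add0r; split=> //; apply: section_upto_0.
    have ltw : (a' < tgt o a)%N.
      have ne' : (a' : nat) <> a by move=> h; case/eqP: ne; apply: val_inj.
      by rewrite ew'; move: ha' ne'; rewrite em /=; lia.
    rewrite !dfwith_out; first by apply: h1; move: ha'; lia.
      by apply: neq_of_le; apply: leq_ltn_trans lt; apply: src_le.
    by apply: neq_of_le; apply: leq_ltn_trans lt; apply: tgt_le.
  - by rewrite dfwith_out // neq_of_le.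
  - by rewrite dfwith_in.
have ew : w = tgt o a by apply: val_inj; rewrite /= tgt_val oa em /=; lia.
have ew' : src o a = (i + m)%N :> nat by rewrite src_val (negbTE oa) /=; lia.
have lt : (src o a < tgt o a)%N by rewrite tgt_val ew' oa /=; lia.
have lti : (i < tgt o a)%N by rewrite tgt_val oa /=; lia.
subst w.
have old a' : (i <= a' < tgt o a)%N -> a' != a -> (a' < src o a)%N.
  move=> ha' ne.
  have ne' : (a' : nat) <> a by move=> h; case/eqP: ne; apply: val_inj.
  by rewrite ew'; move: ha' ne'; rewrite em /=; lia.
(* The edge points away from [i]: the functional at its source is forced to be the pullback of
   [phi']. *)
have [|phi [h1 h2 h3]] := IH _ ew' (phi' \o rmap M a)%VF.
  move=> x sx; rewrite comp_lfunE.
  pose x' := dfwith x (rmap M a (x (src o a))).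
  have xi : x' i = x i by rewrite /x' dfwith_out // neq_of_le.
  rewrite -xi H; first by rewrite /x' dfwith_in.
  move=> a' ha'; case: (eqVneq a' a) => [->|ne].
    by rewrite /x' dfwith_in dfwith_out // neq_of_le.
  have ltw := old _ ha' ne.
  rewrite /x' !dfwith_out; first by apply: sx; move: ha'; lia.
    by apply: neq_of_le; apply: leq_ltn_trans lt; apply: tgt_le.
  by apply: neq_of_le; apply: leq_ltn_trans lt; apply: src_le.
exists (dfwith phi phi'); split.
- move=> a' ha' y; case: (eqVneq a' a) y => [->|ne] y.
    by rewrite dfwith_in dfwith_out ?neq_of_le // h3 comp_lfunE.
  have ltw := old _ ha' ne.
  rewrite !dfwith_out; first by apply: h1; move: ha'; lia.
    by apply: neq_of_le; apply: leq_ltn_trans lt; apply: src_le.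
  by apply: neq_of_le; apply: leq_ltn_trans lt; apply: tgt_le.
- by rewrite dfwith_out // neq_of_le.
- by rewrite dfwith_in.
Qed.

Definition vanishes w (z : M i) : Prop :=
  exists x, [/\ section_upto w x, x i = z & x w = 0].
Definition extends w (z : M i) : Prop := exists2 x, section_upto w x & x i = z.

Lemma cosection_at w (x : forall v, M v) : (i <= w)%N ->
  section_upto w x -> ~ vanishes w (x i) ->
  exists2 phi, cosection_upto w phi & phi i (x i) = 1.
Proof.
move=> iw sx nv.
(* On pairs of end values, ask for 0 on every (y i, - y w) and 1 on (x i, 0). This is consistent
   because [x i] does not vanish at [w], and the two components are functionals at the ends that
   agree on compatible families. *)
pose R (p : (M i * M w)%type) (c : K^o) := exists2 y, section_upto w y &
   p = (y i + (c : K) *: x i, - y w).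
have [f hf] : exists f : 'Hom((M i * M w)%type, K^o), forall y c, R y c -> f y = c.
  apply: linear_relation_hom.
  - exists (fun v => 0); first exact: section_upto_0.
    by rewrite scale0r addr0 oppr0.
  - move=> c _ d _ d' [y sy ->] [y' sy' ->]; exists (fun v => c *: y v + y' v).
      exact: section_upto_linear.
    apply: injective_projections => /=; last by rewrite opprD scalerN.
    by rewrite scalerDr scalerDl scalerA addrACA.
  - move=> c [y sy [e1 e2]]; apply/eqP; apply: contra_notT nv => c0.
    exists (fun v => - c^-1 *: y v + 0); split.
    + by apply: section_upto_linear; [exact: sy|exact: section_upto_0].
    + have -> : y i = - (c *: x i) by apply/eqP; rewrite -addr_eq0 -e1.
      by rewrite addr0 scalerN scaleNr opprK scalerA mulVf // scale1r.
    + by rewrite -[y w]opprK -e2 oppr0 scaler0 addr0.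
pose psi : 'Hom(M i, K^o) := linfun (fun z => f (z, 0)).
pose phi' : 'Hom(M w, K^o) := linfun (fun z => f (0, z)).
have psiE z : psi z = f (z, 0).
  rewrite /psi linfunE // => c u u'; rewrite -linearP; congr (f _).
  by apply: injective_projections; rewrite /= ?scaler0 ?addr0.
have phiE z : phi' z = f (0, z).
  rewrite /phi' linfunE // => c u u'; rewrite -linearP; congr (f _).
  by apply: injective_projections; rewrite /= ?scaler0 ?addr0.
have [y sy|phi [h1 h2 h3]] := cosection_extend (psi := psi) (phi' := phi') iw.
  rewrite psiE phiE; apply/eqP; rewrite -subr_eq0 -linearB; apply/eqP.
  apply: hf; exists y => //.
  by apply: injective_projections; rewrite /= ?scale0r ?subr0 ?addr0 ?sub0r.
exists phi => //; rewrite h2 psiE; apply: hf.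
exists (fun v => 0); first exact: section_upto_0.
by apply: injective_projections; rewrite /= ?scale1r ?add0r ?oppr0.
Qed.

(** A functional that is 1 on z and kills the start of every family reaching [w] meets the extension
    criterion with zero at [w]. *)
Lemma cosection_vanishing w (z : M i) : (i <= w)%N -> ~ extends w z ->
  exists phi, [/\ cosection_upto w phi, phi i z = 1 & phi w = 0].
Proof.
move=> iw ne.
pose R (p : M i) (c : K^o) := exists2 y, section_upto w y & p = y i + (c : K) *: z.
have [psi hf] : exists f : 'Hom(M i, K^o), forall y c, R y c -> f y = c.
  apply: linear_relation_hom.
  - by exists (fun v => 0); [exact: section_upto_0|rewrite scale0r addr0].
  - move=> c _ d _ d' [y sy ->] [y' sy' ->]; exists (fun v => c *: y v + y' v).
      exact: section_upto_linear.
    by rewrite scalerDr scalerDl scalerA addrACA.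
  - move=> c [y sy e1]; apply/eqP; apply: contra_notT ne => c0.
    exists (fun v => - c^-1 *: y v + 0).
      by apply: section_upto_linear; [exact: sy|exact: section_upto_0].
    have -> : y i = - (c *: z) by apply/eqP; rewrite -addr_eq0 -e1.
    by rewrite addr0 scalerN scaleNr opprK scalerA mulVf // scale1r.
have [y sy|phi [h1 h2 h3]] := cosection_extend (psi := psi) (phi' := 0 : 'Hom(M w, K^o)) iw.
  by rewrite zero_lfunE; apply: hf; exists y; rewrite ?scale0r ?addr0.
exists phi; split=> //; rewrite h2; apply: hf.
by exists (fun v => 0); [exact: section_upto_0|rewrite scale1r add0r].
Qed.

Lemma minimal_vertex (P : 'I_n.+1 -> Prop) w : P w ->
  exists w, P w /\ forall v, (v < w)%N -> ~ P v.
Proof.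
have [m] := ubnP w; elim: m w => // m IH w hm Pw.
case: (classic (exists2 v : 'I_n.+1, (v < w)%N & P v)) => [[v vw Pv]|h].
  by apply: IH Pv; lia.
by exists w; split=> // v vw Pv; apply: h; exists v.
Qed.

(* Follow a nonzero vector z of M i to the right.  Either it dies (is mapped to
   zero) or it stops lifting at some arrow, or it survives to the last vertex;
   in each case a functional separates z from the vectors with another fate. *)
Lemma interval_section (z : M i) : z != 0 ->
  exists w x phi, [/\ (i <= w)%N, section_upto w x, cosection_upto w phi & phi i (x i) = 1] /\
    forall a, (a = w :> nat) ->
      if o a then forall y, phi (tgt o a) (rmap M a y) = 0
      else rmap M a (x (src o a)) = 0.
Proof.
move=> z0.
(* The interval ends just before the first vertex where z has died or stopped lifting. *)
case: (classic (exists2 w : 'I_n.+1, (i <= w)%N & vanishes w z \/ ~ extends w z)) => [[w0 iw0 hw0]|H].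
  have [w [[iw hw] minw]] := @minimal_vertex (fun w => (i <= w)%N /\ (vanishes w z \/ ~ extends w z)) w0 (conj iw0 hw0).
  have ltiw : (i < w)%N.
    rewrite ltn_neqAle iw andbT; apply/eqP=> /val_inj e; subst w.
    case: hw => [[x [_ xi x0]]|[]]; first by rewrite -xi x0 eqxx in z0.
    by exists (single z); [move=> a; lia|rewrite single_in].
  have an : (w.-1 < n)%N by have := ltn_ord w; lia.
  have [a ea] : exists a : 'I_n, a = w.-1 :> nat by exists (Ordinal an).
  have [u [eu [nu xu]]] : exists u : 'I_n.+1, u = w.-1 :> nat /\ ~ vanishes u z /\ extends u z.
    have un : (w.-1 < n.+1)%N by lia.
    exists (Ordinal un); split=> //=.
    have h : (i <= Ordinal un)%N by rewrite /=; lia.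
    have := minw (Ordinal un); rewrite /= => hmin.
    split; [move=> hv|apply: NNPP => hv]; apply: (hmin); rewrite /=; try lia; split=> //.
      by left.
    by right.
  have iu : (i <= u)%N by lia.
  have [oa|oa] := boolP (o a).
    have ew : w = src o a by apply: val_inj; rewrite /= src_val oa /=; lia.
    have eu' : u = tgt o a by apply: val_inj; rewrite /= tgt_val oa /=; lia.
    subst w u.
    (* The arrow points back from this vertex, so dying here would mean dying already at its target;
       z must have failed to lift. *)
    have {}hw : ~ extends (src o a) z.
      case: hw => // [[x [sx xi x0]]]; case: nu; exists x; split=> //.
        by move=> a' ha'; apply: sx; move: ha' ltiw; lia.
      by rewrite -sx ?x0 ?linear0 // src_val oa /=; lia.
    have [phi [h1 h2 h3]] := cosection_vanishing iw hw.
    have [x sx xi] := xu.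
    exists (tgt o a), x, phi; split.
      by split=> //; [move=> a' ha'; apply: h1; move: ha' ltiw; lia|rewrite xi].
    move=> a' ea'; have -> : a' = a by apply: val_inj; rewrite /= ea' eu.
    rewrite oa => y; rewrite h1 ?h3 ?zero_lfunE //.
    by rewrite src_val oa /=; lia.
  have ew : w = tgt o a by apply: val_inj; rewrite /= tgt_val oa /=; lia.
  have eu' : u = src o a by apply: val_inj; rewrite /= src_val (negbTE oa) /=; lia.
  subst w u.
  (* The arrow points forward, so every family extends along it; z must have died. *)
  have [x [sx xi x0]] : vanishes (tgt o a) z.
    case: hw => // hn; case: hn; have [x sx xi] := xu.
    exists (dfwith x (rmap M a (x (src o a)))).
      move=> a' ha'; case: (eqVneq a' a) => [->|ne].
        by rewrite dfwith_in dfwith_out //; apply: neq_of_le; lia.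
      have ltw : (a' < src o a)%N.
        have ne' : (a' : nat) <> a by move=> h; case/eqP: ne; apply: val_inj.
        by move: ha' ne'; rewrite eu /=; lia.
      rewrite !dfwith_out; first by apply: sx; move: ha'; lia.
        by apply: neq_of_le; have := tgt_le ltw; lia.
      by apply: neq_of_le; have := src_le ltw; lia.
    by rewrite dfwith_out // neq_of_le.
  have sx' : section_upto (src o a) x.
    by move=> a' ha'; apply: sx; move: ha' ltiw; lia.
  have [|phi h1 h2] := cosection_at iu sx'; first by rewrite xi.
  exists (src o a), x, phi; split=> // a' ea'.
  have -> : a' = a by apply: val_inj; rewrite /= ea' eu.
  by rewrite (negbTE oa) sx ?x0 // tgt_val oa /=; lia.
have im : (i <= @ord_max n)%N by rewrite /=; have := ltn_ord i; lia.
have [x sx xi] : extends ord_max z by apply: NNPP => h; apply: H; exists ord_max => //; right.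
have [|phi h1 h2] := cosection_at im sx.
  by rewrite xi => h; apply: H; exists ord_max => //; left.
exists ord_max, x, phi; split=> // a /= ea; have := ltn_ord a; lia.
Qed.

End Decomposition.

(** * Indecomposable representations are interval modules *)

Section Classification.
Local Open Scope ring_scope.
Variables (K : fieldType) (n : nat) (o : 'I_n -> bool).

(** The vectors [x] map an interval module into M and the functionals [phi] map M back; the
    composite is the identity, so this module is a nonzero summand. *)
Lemma indecomposable_thin (M : rep K o) : indecomposable M ->
  exists (b : pred 'I_n.+1) v0, [/\ b v0, convex b & isomorphic M (thin K o b)].
Proof.
move=> dM; have [nz _] := dM.
have [i1 h1] : exists i, fullv != 0%VS :> {vspace M i}.
  by apply: NNPP => h; apply: nz => i; apply/eqP; apply: contra_notT h => h; exists i.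
(* Starting at the leftmost nonzero space removes any condition at the left end of the interval. *)
have [i [/= hi mini]] := @minimal_vertex n (fun i => fullv != 0%VS :> {vspace M i}) i1 h1.
have M0 v (y : M v) : (v < i)%N -> y = 0.
  by move=> /mini /negP; rewrite negbK => /eqP e; apply/eqP; rewrite -memv0 -e memvf.
have [z z0] : exists z : M i, z != 0.
  by exists (vpick fullv); rewrite vpick0.
have [w [x [phi [[iw sx cphi phix] hw]]]] := interval_section z0.
pose b (v : 'I_n.+1) := (i <= v <= w)%N.
have cb : convex b by move=> v v' y; rewrite /b /between; lia.
have bi : b i by rewrite /b leqnn.
have arrow_in a : b (src o a) -> b (tgt o a) -> (i <= a < w)%N.
  by rewrite /b src_val tgt_val; case: (o a) => /=; lia.
have [a bs|f fE] := @thin_hom_in K n o b M x.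
  have [bt|bt] := boolP (b (tgt o a)); first by apply: sx; apply: arrow_in.
  case: (ltnP (tgt o a) i) => lti; first exact: M0.
  have [ea oa] : (a = w :> nat) /\ ~~ o a.
    by move: bs bt lti; rewrite /b src_val tgt_val; case: (o a) => /=; lia.
  by have := hw a ea; rewrite (negbTE oa).
have [a y bt|g gE] := @thin_hom_out K n o b M phi.
  have [bs|bs] := boolP (b (src o a)); first by apply: cphi; apply: arrow_in.
  case: (ltnP (src o a) i) => lti; first by rewrite (M0 _ y lti) !linear0.
  have [ea oa] : (a = w :> nat) /\ o a.
    by move: bs bt lti; rewrite /b src_val tgt_val; case: (o a) => /=; lia.
  by have := hw a ea; rewrite oa.
(* Both families are compatible along the interval, so the pairing keeps its value at [i]. *)
have phi1 v : b v -> phi v (x v) = 1.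
  move=> bv; have hc : phi i (x i) == 1 by rewrite phix.
  apply/eqP; apply: contraT => ne.
  have [a [ha [b1 b2]]] := @crossing _ o (fun k => phi k (x k) == 1) i v hc ne.
  have hin := arrow_in _ (cb _ _ _ bi bv b1) (cb _ _ _ bi bv b2).
  by move: ha; rewrite -(sx _ hin) (cphi _ hin) eqxx.
exists b, i; split=> //; apply: isomorphic_sym; exists f; apply: split_mono_indec => //.
  by move=> /is_zero_thin /(_ i); rewrite bi.
exists g => v; apply/comp_lfunP=> u; rewrite id_lfunE.
have [bv|bv] := boolP (b v); last by rewrite (thin_out0 u bv) !linear0.
by rewrite gE thin_homE fE // linearZ /= phi1 // [_ *: 1]mulr1 cfK.
Qed.

End Classification.

(** * Cokernels and kernels of irreducible morphisms *)

Section Irreducible.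
Local Open Scope ring_scope.
Variables (K : fieldType) (n : nat) (o : 'I_n -> bool) (I : {vspace path_alg K o}).
Implicit Types (X Y M N : rep K o) (i j k v w : 'I_n.+1) (a : 'I_n) (b c d : pred 'I_n.+1).

Lemma split_monoP M N (f : rhom M N) : split_mono f <-> exists g : rhom N M, forall i x, g i (f i x) = x.
Proof.
split=> [[g gf]|[g gf]]; exists g => i; last by apply/comp_lfunP=> x; rewrite gf id_lfunE.
by move=> x; rewrite ((comp_lfunP _ _ _).1 (gf i)) id_lfunE.
Qed.

Lemma split_epiP M N (f : rhom M N) : split_epi f <-> exists g : rhom N M, forall i x, f i (g i x) = x.
Proof.
split=> [[g gf]|[g gf]]; exists g => i; last by apply/comp_lfunP=> x; rewrite gf id_lfunE.
by move=> x; rewrite ((comp_lfunP _ _ _).1 (gf i)) id_lfunE.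
Qed.

Lemma split_mono_mono M N (f : rhom M N) : split_mono f -> mono f.
Proof.
by case/split_monoP=> g gf; apply/mono_injP=> i x y /(congr1 (g i)); rewrite !gf.
Qed.

Lemma split_epi_epi M N (f : rhom M N) : split_epi f -> epi f.
Proof. by case/split_epiP=> g gf; apply/epi_surj=> i y; exists (g i y). Qed.

Lemma irreducible_iso M N M' N' (f : rhom M N) (f' : rhom M' N') :
  iso_morphisms f f' -> irreducible I f -> irreducible I f'.
Proof.
move=> [s [t [is_ it E]]] [iM iN nm ne H].
have [s' [is' s's ss']] := iso_inv is_; have [t' [it' t't tt']] := iso_inv it.
have tf i x : t i (f i x) = f' i (s i x) by rewrite -!comp_lfunE E.
split.
- by apply: in_mod_iso iM; exists s.
- by apply: in_mod_iso iN; exists t.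
- move=> /split_monoP[r rf]; apply/nm/split_monoP; exists (rcomp s' (rcomp r t)) => i x.
  by rewrite !rcompE tf rf s's.
- move=> /split_epiP[r fr]; apply/ne/split_epiP; exists (rcomp s' (rcomp r t)) => i x.
  by rewrite -[LHS]t't tf !rcompE ss' fr t't.
move=> X h g iX fgh.
have fgh' i x : f' i x = g i (h i x) by rewrite fgh comp_lfunE.
have [|/split_monoP[r rh]|/split_epiP[r gr]] := H X (rcomp h s) (rcomp t' g) iX.
- by move=> i; apply/esym/comp_lfunP=> x; rewrite !rcompE -fgh' -tf t't.
- left; apply/split_monoP; exists (rcomp s r) => i x.
  by rewrite rcompE -{1}(ss' i x); have := rh i (s' i x); rewrite rcompE => ->.
right; apply/split_epiP; exists (rcomp r t') => i x.
have := gr i (t' i x); rewrite !rcompE => /(congr1 (t i)).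
by rewrite !tt'.
Qed.

Lemma rscale_subproof M N (f : rhom M N) (l : K) a x :
  rmap N a ((l *: f (src o a)) x) = (l *: f (tgt o a)) (rmap M a x).
Proof. by rewrite !scale_lfunE linearZ /= rhomE. Qed.

Definition rscale M N (l : K) (f : rhom M N) : rhom M N :=
  mk_rhom (h := fun i => l *: f i) (@rscale_subproof M N f l).

Lemma rscaleE M N (l : K) (f : rhom M N) i x : rscale l f i x = l *: f i x.
Proof. exact: scale_lfunE. Qed.

Hypothesis hI : admissible I.
Let hnz := nz_nonzero_paths hI.

(** F is a multiple of the canonical map, which factors through [thin d]. The factor that splits is
    an isomorphism since [thin d] is indecomposable, and isomorphisms preserve supports. *)
Lemma irreducible_thin_between b c (F : rhom (thin K o b) (thin K o c)) (l : K) v0 :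
  (forall v u, F v u = (l * cf u) *: thin1 K o c v) -> irreducible I F ->
  b v0 -> c v0 -> convex b -> convex c ->
  forall d, convex d -> path_closed o (nz I) d -> compatible o b d -> compatible o d c ->
    (forall v, b v -> c v -> d v) -> (forall v, d v = b v) \/ (forall v, d v = c v).
Proof.
move=> FE [_ _ _ _ H] b0 c0 cb cc d cd gd hbd hdc sub.
have d0 : d v0 by apply: sub.
have [h hE] := @thin_can K _ _ _ _ hbd; have [g gE] := @thin_can K _ _ _ _ hdc.
have dd := @thin_indec K _ o _ _ d0 cd.
have [||hs|gs] := H _ h (rscale l g); first exact: thin_in_mod.
- move=> v; apply/esym/comp_lfunP=> u; rewrite rscaleE gE hE FE cfZ cf_thin1.
  rewrite scalerA; have [bv|bv] := boolP (b v); last by rewrite cf_out // mul0r !mulr0.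
  have [cv|cv] := boolP (c v); first by rewrite sub // mulr1.
  by rewrite (thin_out0 (thin1 K o c v) cv) !scaler0.
- have ih : isomorphic (thin K o b) (thin K o d).
    by exists h; apply: split_mono_indec => // /is_zero_thin /(_ v0); rewrite b0.
  by left=> v; rewrite (thin_iso_support ih).
have ih : isomorphic (thin K o d) (thin K o c).
  by exists (rscale l g); apply: split_epi_indec => // /is_zero_thin /(_ v0); rewrite c0.
by right=> v; rewrite (thin_iso_support ih).
Qed.

Lemma thin_hom_const b c (F : rhom (thin K o b) (thin K o c)) v0 : b v0 -> c v0 ->
  convex (fun k => b k && c k) -> forall v u, F v u = (coef F v0 * cf u) *: thin1 K o c v.
Proof.
move=> b0 c0 cv v u; rewrite thin_homE2.
have [bv|bv] := boolP (b v); last by rewrite cf_out // !mulr0.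
have [cv'|cv'] := boolP (c v); last by rewrite (thin_out0 (thin1 K o c v) cv') !scaler0.
by rewrite (coef_const F (w := v0) cv) ?bv ?b0.
Qed.

Lemma indecomposable_iso_thin M N (f : rhom M N) : indecomposable M -> indecomposable N ->
  exists b c v0 v1 (F : rhom (thin K o b) (thin K o c)),
    [/\ b v0, c v1, convex b, convex c & iso_morphisms f F].
Proof.
move=> /indecomposable_thin[b [v0 [b0 cb [s is_]]]] /indecomposable_thin[c [v1 [c1 cc [t it]]]].
have [s' [is' s's ss']] := iso_inv is_.
exists b, c, v0, v1, (rcomp t (rcomp f s')); split=> //.
by exists s, t; split=> // i; apply/comp_lfunP=> x; rewrite !comp_lfunE s's.
Qed.

Lemma irreducible_mono_cokernel M N (f : rhom M N) : indecomposable M -> indecomposable N ->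
  irreducible I f -> mono f ->
  exists a (p : rhom N (thin K o (V_of o (nz I) a))), short_exact f p.
Proof.
move=> dM dN irf mf.
have [b [c [v0 [_ [F [b0 _ cb cc fF]]]]]] := indecomposable_iso_thin f dM dN.
have irF := irreducible_iso fF irf.
have [s [t [is_ it E]]] := fF.
have [s' [is' s's ss']] := iso_inv is_; have [t' [it' t't tt']] := iso_inv it.
have tf i x : t i (f i x) = F i (s i x) by rewrite -!comp_lfunE E.
have mF : mono F.
  apply: mono_eq0 => i x; rewrite -(ss' i x) -tf => e.
  by rewrite (mono0 mf (mono0 (iso_mono it) e)) linear0.
have F1 v : b v -> F v (thin1 K o b v) != 0.
  by move=> bv; apply/eqP=> /(mono0 mF) /eqP; rewrite (negbTE (thin1_neq0 _ _ bv)).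
have bc v : b v -> c v.
  by move=> /F1; apply: contraNT => cv; rewrite (thin_out0 (F v _) cv).
have bcb : (fun k => b k && c k) = b.
  by apply: functional_extensionality => v; have := bc v; case: (b v) => // ->.
have FE := @thin_hom_const b c F v0 b0 (bc _ b0) ltac:(by rewrite bcb).
have l0 : coef F v0 != 0.
  by have := F1 _ b0; rewrite FE cf_thin1 b0 mulr1 scaler_eq0 negb_or => /andP[].
have cF v : coef F v = coef F v0 * ((b v)%:R * (c v)%:R).
  by rewrite /coef FE cfZ !cf_thin1 mulrA.
(* An arrow of c leaving b would join a nonzero coefficient to a zero one. *)
have comp : compatible o b c.
  move=> a bs ct; have := coef_arrow F bs ct; rewrite (cF (src o a)) (cF (tgt o a)) bs ct (bc _ bs) !mulr1.
  case: (b (tgt o a)) => //= /eqP.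
  by rewrite mulr0 (negbTE l0).
have [_ iN _ _ _] := irF.
(* Equal supports would make F an isomorphism, against irreducibility. *)
have [v1 /andP[c1 b1]] : exists v1, c v1 && ~~ b v1.
  apply: NNPP => h; apply: (irreducible_not_iso irF); apply: bij_iso => //.
  apply/epi_surj=> v u; exists (((coef F v0)^-1 * cf u) *: thin1 K o b v).
  have [cv|cv] := boolP (c v); last by rewrite (thin_out0 u cv) (thin_out0 (F v _) cv).
  have bv : b v by apply: contra_notT h => bv; exists v; rewrite cv.
  by rewrite FE cfZ cf_thin1 bv mulr1 mulrA divff // mul1r cfK.
have [a [ta Va]] := thin_cokernel hnz cb cc (in_mod_thin hI iN) b0 c1 b1 bc comp
  (irreducible_thin_between FE irF b0 (bc _ b0) cb cc).
have Vc v : V_of o (nz I) a v -> c v /\ ~~ b v by rewrite -Va => /andP.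
have compV : compatible o c (V_of o (nz I) a).
  move=> e cs Vt; have [ct bt] := Vc _ Vt; rewrite ct -Va cs /=.
  by apply: contra bt => bs; rewrite -(comp _ bs ct).
have [p pE] := @thin_can K _ _ _ _ compV.
exists a, (rcomp p t); apply/short_exactP; split=> //.
- apply/epi_surj=> v u; exists (t' v (cf u *: thin1 K o c v)).
  rewrite rcompE tt' pE cfZ cf_thin1.
  have [Vv|Vv] := boolP (V_of o (nz I) a v); last by rewrite (thin_out0 u Vv) cf0 mul0r scale0r.
  by have [-> _] := Vc _ Vv; rewrite mulr1 cfK.
- move=> v x; rewrite rcompE tf pE.
  have [Vv|Vv] := boolP (V_of o (nz I) a v); last by rewrite (thin_out0 (thin1 K o _ v) Vv) scaler0.
  have [_ bv] := Vc _ Vv.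
  by rewrite (thin_out0 (s v x) bv) linear0 cf0 scale0r.
move=> v y; rewrite rcompE pE => e.
exists (s' v (((coef F v0)^-1 * cf (t v y)) *: thin1 K o b v)).
rewrite -[LHS]t't -[RHS]t't tf ss'; congr (t' v _).
have [cv|cv] := boolP (c v); last by rewrite (thin_out0 (t v y) cv) (thin_out0 (F v _) cv).
have [bv|bv] := boolP (b v).
  by rewrite FE cfZ cf_thin1 bv mulr1 mulrA divff // mul1r cfK.
have Vv : V_of o (nz I) a v by rewrite -Va cv.
move: e => /eqP; rewrite scaler_eq0 (negbTE (thin1_neq0 K o Vv)) orbF => /eqP e.
by rewrite -[LHS]cfK e mulr0 !scale0r linear0.
Qed.

Lemma irreducible_epi_kernel M N (f : rhom M N) : indecomposable M -> indecomposable N ->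
  irreducible I f -> epi f ->
  exists a (j : rhom (thin K o (U_of o (nz I) a)) M), short_exact j f.
Proof.
move=> dM dN irf ef.
have [b [c [_ [v0 [F [_ c0 cb cc fF]]]]]] := indecomposable_iso_thin f dM dN.
have irF := irreducible_iso fF irf.
have [s [t [is_ it E]]] := fF.
have [s' [is' s's ss']] := iso_inv is_; have [t' [it' t't tt']] := iso_inv it.
have tf i x : t i (f i x) = F i (s i x) by rewrite -!comp_lfunE E.
have eF : epi F.
  apply/epi_surj=> i y; have [x ex] := (epi_surj f).1 ef i (t' i y).
  by exists (s i x); rewrite -tf -ex tt'.
have F1 v : c v -> coef F v != 0.
  move=> cv; have [x ex] := (epi_surj F).1 eF v (thin1 K o c v).
  apply/eqP=> e; have := thin1_neq0 K o cv; rewrite ex thin_homE2 e mul0r scale0r.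
  by rewrite eqxx.
have cb' v : c v -> b v.
  move=> /F1; apply: contraNT => bv.
  by rewrite /coef (thin_out0 (thin1 K o b v) bv) linear0 cf0.
have bcb : (fun k => b k && c k) = c.
  by apply: functional_extensionality => v; have := cb' v; case: (c v) => [->|_] //; rewrite andbF.
have FE := @thin_hom_const b c F v0 (cb' _ c0) c0 ltac:(by rewrite bcb).
have l0 : coef F v0 != 0 by apply: F1.
have cF v : coef F v = coef F v0 * ((b v)%:R * (c v)%:R).
  by rewrite /coef FE cfZ !cf_thin1 mulrA.
have comp : compatible o b c.
  move=> a bs ct; have := coef_arrow F bs ct; rewrite (cF (src o a)) (cF (tgt o a)) bs ct (cb' _ ct) !mulr1.
  case: (c (src o a)) => //= /esym /eqP.
  by rewrite !mulr0 (negbTE l0).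
have [iM _ _ _ _] := irF.
have [v1 /andP[b1 c1]] : exists v1, b v1 && ~~ c v1.
  apply: NNPP => h; apply: (irreducible_not_iso irF); apply: bij_iso => //.
  apply: mono_eq0 => v u; rewrite FE => /eqP.
  have [bv|bv] := boolP (b v); last by rewrite (thin_out0 u bv).
  have cv : c v by apply: contra_notT h => cv; exists v; rewrite bv.
  rewrite scaler_eq0 (negbTE (thin1_neq0 K o cv)) orbF mulf_eq0 (negbTE l0) => /eqP e.
  by rewrite -[u]cfK e scale0r.
(* The predicate lemma is applied to the opposite quiver, where the quotient c of b becomes a sub;
   reversing twice must give back [o] itself. *)
have oo : (fun a => ~~ ~~ o a) = o by apply: functional_extensionality => a; rewrite negbK.
have H d : convex d -> path_closed (fun a => ~~ o a) (fun i j => nz I j i) d ->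
    compatible (fun a => ~~ o a) c d -> compatible (fun a => ~~ o a) d b ->
    (forall v, c v -> b v -> d v) -> (forall v, d v = c v) \/ (forall v, d v = b v).
  move=> cd /path_closed_neg gd /compatible_neg h1 /compatible_neg h2 sub.
  rewrite oo in gd h1 h2.
  have sub' v : b v -> c v -> d v by move=> bv cv; apply: sub.
  by case: (irreducible_thin_between FE irF (cb' _ c0) c0 cb cc cd gd h2 h1 sub') => h; [right|left].
have [a [_ Ua']] := thin_cokernel (nonzero_paths_neg hnz) cc cb
  (path_closed_neg (in_mod_thin hI iM)) c0 b1 c1 cb' (compatible_neg comp) H.
have Ua v : (b v && ~~ c v) = U_of o (nz I) a v by rewrite Ua' V_set_neg.
have Ub v : U_of o (nz I) a v -> b v /\ ~~ c v by rewrite -Ua => /andP.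
have compU : compatible o (U_of o (nz I) a) b.
  move=> e Us bt; have [bs cs] := Ub _ Us; rewrite bs -Ua bt /=.
  by apply/esym; apply: contra cs => ct; rewrite (comp _ bs ct).
have [j jE] := @thin_can K _ _ _ _ compU.
exists a, (rcomp s' j); apply/short_exactP; split=> //.
- apply: mono_eq0 => v u; rewrite rcompE => /(mono0 (iso_mono is')) /eqP.
  have [Uv|Uv] := boolP (U_of o (nz I) a v); last by rewrite (thin_out0 u Uv).
  have [bv _] := Ub _ Uv.
  rewrite jE scaler_eq0 (negbTE (thin1_neq0 K o bv)) orbF => /eqP e.
  by rewrite -[u]cfK e scale0r.
- move=> v x; apply: (mono0 (iso_mono it)); rewrite tf rcompE ss' jE.
  have [Uv|Uv] := boolP (U_of o (nz I) a v); last by rewrite (thin_out0 x Uv) cf0 scale0r linear0.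
  have [_ cv] := Ub _ Uv.
  by rewrite (thin_out0 (F v _) cv).
move=> v y fy; exists (cf (s v y) *: thin1 K o _ v).
rewrite -[LHS]s's rcompE jE cfZ cf_thin1; congr (s' v _).
have [bv|bv] := boolP (b v); last by rewrite (thin_out0 (s v y) bv) (thin_out0 (thin1 K o b v) bv) scaler0.
have [cv|cv] := boolP (c v); last by rewrite -Ua bv cv mulr1 cfK.
have : F v (s v y) == 0 by rewrite -tf fy linear0.
rewrite FE scaler_eq0 (negbTE (thin1_neq0 K o cv)) orbF mulf_eq0 (negbTE l0) => /eqP e.
by rewrite e mul0r scale0r -[LHS]cfK e scale0r.
Qed.

End Irreducible.

(** * Thin models of P(i), I(i) and the almost split sequences *)

Section ThinModules.
Local Open Scope ring_scope.
Variables (K : fieldType) (n : nat) (o : 'I_n -> bool) (I : {vspace path_alg K o}).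
Hypothesis hI : admissible I.
Implicit Types (X Y Z M N : rep K o) (i j k v w : 'I_n.+1) (a e : 'I_n) (b c d : pred 'I_n.+1).
Let hnz := nz_nonzero_paths hI.
Notation thin := (thin K o).
Notation thin1 := (thin1 K o).
Notation thin1_neq0 := (thin1_neq0 K o).
Notation U_set := (U_of o (nz I)).
Notation V_set := (V_of o (nz I)).

(* Supports of P(i), I(i) and M(N_a), of the summand X of rad P(src a) through a,
   and of the summand Y of I(tgt a) / soc through a. *)
Definition P_of i : pred 'I_n.+1 := nz I i.
Definition I_of i : pred 'I_n.+1 := fun v => nz I v i.
Definition N_of a : pred 'I_n.+1 := fun v => U_set a v || V_set a v.
Definition X_of a : pred 'I_n.+1 := fun v => nz I (src o a) v && ~~ src_side o a v.
Definition Y_of a : pred 'I_n.+1 := fun v => nz I v (tgt o a) && src_side o a v.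

Lemma I_path_closed i : path_closed o (nz I) (I_of i).
Proof.
have := nz_path_closed (nonzero_paths_neg hnz) (i := i) => /path_closed_neg.
have -> // : (fun a => ~~ ~~ o a) = o by apply: functional_extensionality => a; rewrite negbK.
Qed.

Lemma P_in_mod i : in_mod I (thin (P_of i)).
Proof. by apply: thin_in_mod => //; apply: nz_path_closed. Qed.

Lemma I_in_mod i : in_mod I (thin (I_of i)).
Proof. by apply: thin_in_mod => //; apply: I_path_closed. Qed.

(** Yoneda: a morphism from P(i) is given by its value at [i]. Dually, [I_hom] and [I_homE] say that
    a morphism into I(i) is a functional at [i]. *)
Lemma P_hom i X (y : X i) : in_mod I X ->
  exists h : rhom (thin (P_of i)) X, forall v, P_of i v -> h v (thin1 (P_of i) v) = pm X i v y.
Proof.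
move=> /(in_modP hI) iX.
apply: (@thin_hom_in _ _ _ (P_of i) X (fun v => pm X i v y)) => a ns.
rewrite pm_arrow; last exact: (nz_dir hnz).
by case: (boolP (P_of i (tgt o a))) => // /iX ->.
Qed.

Lemma P_homE i X (h : rhom (thin (P_of i)) X) v : P_of i v ->
  h v (thin1 (P_of i) v) = pm X i v (h i (thin1 (P_of i) i)).
Proof.
move=> nv; rewrite -pm_hom pm_thin //; last exact: (nz_dir hnz).
by move=> x /(nz_sub hnz nv)[].
Qed.

Lemma I_hom i X (phi : 'Hom(X i, K^o)) : in_mod I X ->
  exists h : rhom X (thin (I_of i)), forall v x, h v x = (phi (pm X v i x) : K) *: thin1 (I_of i) v.
Proof.
move=> /(in_modP hI) iX.
have [a x nt|h hE] := @thin_hom_out _ _ _ (I_of i) X (fun v => (phi \o pm X v i)%VF).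
  rewrite !comp_lfunE pm_arrow_r; last exact: (nz_dir hnz).
  by have [//|/iX ->] := boolP (I_of i (src o a)); rewrite linear0.
by exists h => v x; rewrite hE comp_lfunE.
Qed.

Lemma I_homE i X (h : rhom X (thin (I_of i))) v x :
  h v x = cf (h i (pm X v i x)) *: thin1 (I_of i) v.
Proof.
have [nv|nv] := boolP (I_of i v); last by rewrite (thin_out0 (h v x) nv) (thin_out0 (thin1 _ v) nv) scaler0.
rewrite pm_hom -[in RHS](cfK (h v x)) linearZ /= cfZ pm_thin ?cf_thin1.
- by rewrite /I_of (nz_refl hnz) mulr1 cfK.
- by move=> y /(nz_sub hnz nv)[].
- exact: (nz_dir hnz).
Qed.

Lemma P_projective i : projective I (thin (P_of i)).
Proof.
split=> [|X Y g h iX iY eg]; first exact: P_in_mod.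
have [x ex] := (epi_surj g).1 eg i (h i (thin1 _ i)).
have [h' h'E] := P_hom x iX.
exists h' => v; apply/comp_lfunP=> u; rewrite [RHS]thin_homE thin_homE lfunZ.
have [nv|nv] := boolP (P_of i v); last by rewrite cf_out // !scale0r.
by rewrite h'E // pm_hom -ex -P_homE.
Qed.

Lemma I_injective i : injective_rep I (thin (I_of i)).
Proof.
split=> [|X Y g h iX iY mg]; first exact: I_in_mod.
pose phi : 'Hom(X i, K^o) := linfun (fun x => cf (h i x) : K^o).
have phiE x : phi x = cf (h i x).
  by rewrite /phi linfunE // => c u w; rewrite linearP /= cfP.
pose psi := (phi \o (g i)^-1)%VF.
have psiE x : psi (g i x) = cf (h i x).
  by rewrite comp_lfunE lker0_lfunK ?phiE //; apply/eqP/mg.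
have [h' h'E] := I_hom psi iY.
exists h' => v; apply/comp_lfunP=> x.
by rewrite h'E -pm_hom psiE [RHS]I_homE.
Qed.

Lemma projective_iso P Q : isomorphic P Q -> projective I P -> projective I Q.
Proof.
move=> [f jf] [iP pP]; split; first by apply: in_mod_iso iP; exists f.
have [f' [if' f'f ff']] := iso_inv jf.
move=> X Y g h iX iY eg; have [h' h'E] := pP _ _ g (rcomp h f) iX iY eg.
exists (rcomp h' f') => v; apply/comp_lfunP=> x.
by rewrite rcompE -comp_lfunE h'E rcompE ff'.
Qed.

Lemma U_set_tgt a : U_set a (tgt o a).
Proof. by rewrite /U_of (nz_refl hnz) src_side_tgt. Qed.

Lemma U_set_between a v w : U_set a v -> between v (tgt o a) w -> U_set a w.
Proof.
rewrite -!V_set_neg between_sym => h1 h2.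
by apply: (V_set_dir (nonzero_paths_neg hnz)) h1 _; rewrite src_neg.
Qed.

Lemma U_set_in a e : U_set a (tgt o e) -> ~~ U_set a (src o e) ->
  e = a \/ ~~ nz I (src o e) (tgt o a).
Proof.
rewrite -!V_set_neg -(src_neg o e) -(tgt_neg o e) => h1 h2.
by have := V_set_out h1 h2; rewrite src_neg tgt_neg.
Qed.

(** A path inside N_a stays in U_a, stays in V_a, or crosses from V_a to U_a. In the last case it is
    [a] itself, since [src o a] is the first vertex of V_a and [tgt o a] the last of U_a. *)
Lemma N_set_path_closed a : path_closed o (nz I) (N_of a).
Proof.
move=> v w d H.
have Nv : N_of a v by apply: H; apply: between_l.
have Nw : N_of a w by apply: H; apply: between_r.
case/orP: Nv => Nv; case/orP: Nw => Nw; have /andP[nv sv] := Nv; have /andP[nw sw] := Nw.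
- by have [] := nz_sub hnz nv (dir_between d (nz_dir hnz nw)).
- by case/negP: sv; apply: src_side_dir d sw.
- have [bs bt] := @src_side_between _ o a v w ltac:(by rewrite sv (negbTE sw)).
  have [d1 _] := dir_sub d bs; have [_ d2] := dir_sub d bt.
  rewrite (dir_antisym d1 (nz_dir hnz nv)) (dir_antisym (nz_dir hnz nw) d2).
  exact: (nz_arrow hnz).
- by have [] := nz_sub hnz nw (dir_between (nz_dir hnz nv) d).
Qed.

Lemma N_in_mod a : in_mod I (thin (N_of a)).
Proof. by apply: thin_in_mod => //; apply: N_set_path_closed. Qed.

Lemma N_set_src a : N_of a (src o a).
Proof. by rewrite /N_of (V_set_src hnz) orbT. Qed.

Lemma N_set_tgt a : N_of a (tgt o a).
Proof. by rewrite /N_of U_set_tgt. Qed.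

Lemma U_N_compatible a : compatible o (U_set a) (N_of a).
Proof.
move=> e Us; rewrite /N_of Us /= => /orP[->//|Vt].
by case: (U_V_arrow Us Vt).
Qed.

Lemma N_V_compatible a : compatible o (N_of a) (V_set a).
Proof.
move=> e /orP[Us|->] Vt; last by rewrite /N_of Vt orbT.
by case: (U_V_arrow Us Vt).
Qed.

Lemma V_in_mod a : in_mod I (thin (V_set a)).
Proof.
apply: thin_in_mod => //; apply: (@path_closed_sub _ _ _ _ (N_of a)) (@N_set_path_closed a) => v h.
by rewrite /N_of h orbT.
Qed.

Lemma U_in_mod a : in_mod I (thin (U_set a)).
Proof.
apply: thin_in_mod => //; apply: (@path_closed_sub _ _ _ _ (N_of a)) (@N_set_path_closed a) => v h.
by rewrite /N_of h.
Qed.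

Lemma V_indec a : indecomposable (thin (V_set a)).
Proof. by apply: (@thin_indec K _ o _ _ (V_set_src hnz a)); exact: V_set_convex. Qed.

Lemma thin_exact b c d (f : rhom (thin b) (thin c)) (g : rhom (thin c) (thin d)) :
  (forall v u, f v u = cf u *: thin1 c v) -> (forall v u, g v u = cf u *: thin1 d v) ->
  (forall v, c v = b v || d v) -> (forall v, b v -> d v = false) ->
  short_exact f g.
Proof.
move=> fE gE cE bd; apply/short_exactP; split.
- apply: mono_eq0 => v u; have [bv|bv] := boolP (b v); last by rewrite (thin_out0 u bv).
  have cv : c v by rewrite cE bv.
  move/eqP; rewrite fE scaler_eq0 (negbTE (thin1_neq0 cv)) orbF => /eqP e.
  by rewrite -[u]cfK e scale0r.
- apply/epi_surj=> v u; exists (cf u *: thin1 c v); rewrite gE cfZ cf_thin1 cE.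
  have [dv|dv] := boolP (d v); first by rewrite orbT mulr1 cfK.
  by rewrite (thin_out0 u dv) (thin_out0 (thin1 d v) dv) scaler0.
- move=> v u; rewrite fE gE cfZ; have [bv|bv] := boolP (b v).
    by rewrite (thin_out0 (thin1 d v)) ?scaler0 // bd.
  by rewrite (thin_out0 u bv) cf0 mul0r scale0r.
move=> v u; rewrite gE => e; exists (cf u *: thin1 b v); rewrite fE cfZ cf_thin1.
have [bv|bv] := boolP (b v); first by rewrite mulr1 cfK.
have [dv|dv] := boolP (d v); last by rewrite (thin_out0 u) ?cE ?negb_or ?bv // mulr0 scale0r.
move/eqP: e; rewrite scaler_eq0 (negbTE (thin1_neq0 dv)) orbF => /eqP e.
by rewrite -[u in LHS]cfK e mul0r !scale0r.
Qed.

(* A morphism h out of M(U_a) extends to M(N_a) as soon as its value at tgt a is in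
   the image of the arrow a; otherwise a functional separating the two retracts h. *)
Lemma U_left_extension a X (h : rhom (thin (U_set a)) X) : in_mod I X -> ~ split_mono h ->
  exists x : (forall v, X v),
    (forall v, U_set a v -> x v = h v (thin1 _ v)) /\
    (forall e, N_of a (src o e) -> rmap X e (x (src o e)) = if N_of a (tgt o e) then x (tgt o e) else 0).
Proof.
move=> iX hs; have /(in_modP hI) zX := iX.
case: (boolP (h (tgt o a) (thin1 _ (tgt o a)) \in limg (rmap X a))) => [/memv_imgP[y _ hy]|hz].
  exists (fun v => if U_set a v then h v (thin1 _ v) else pm X (src o a) v y).
  split=> [v ->//|e /orP[Us|Vs]].
    rewrite Us rhomE thin_map cf_thin1 Us scale1r.
    have [Ut|Ut] := boolP (U_set a (tgt o e)); first by rewrite /N_of Ut.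
    rewrite (thin_out0 (thin1 _ (tgt o e)) Ut) linear0 /N_of (negbTE Ut) /=.
    by case: ifP => // Vt; case: (U_V_arrow Us Vt).
  have Us : U_set a (src o e) = false.
    by apply/negP=> Us; have := U_V_disjoint Us; rewrite Vs.
  have ds : dir o (src o a) (src o e) by case/andP: Vs => /(nz_dir hnz).
  rewrite Us pm_arrow //.
  have [Ut|Ut] := boolP (U_set a (tgt o e)).
    rewrite /N_of Ut /=; have -> := V_U_arrow Vs Ut.
    by rewrite -pm_arrow ?dir_refl // pm_refl -hy.
  rewrite /N_of (negbTE Ut) /=.
  have [//|Vt] := boolP (V_set a (tgt o e)).
  case: (V_set_out Vs Vt) => [ea|/zX -> //].
  by rewrite ea U_set_tgt in Ut.
case: hs.
(* Pulled back along the paths to [tgt o a], the functional retracts [h]: an arrow entering U_a is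
   [a], whose image [phi] kills, or begins a path that acts by zero. *)
have [phi [phi1 phi0]] := separating_functional hz.
have [e x Ut|r rE] := @thin_hom_out _ _ _ (U_set a) X (fun v => (phi \o pm X v (tgt o a))%VF).
  rewrite !comp_lfunE pm_arrow_r; last by case/andP: Ut => /(nz_dir hnz).
  have [//|Us] := boolP (U_set a (src o e)).
  case: (U_set_in Ut Us) => [ea|/zX ->]; last by rewrite linear0.
  by subst e; rewrite -pm_arrow_r ?dir_refl // pm_refl phi0.
apply/split_monoP; exists r => v u.
have [Uv|Uv] := boolP (U_set a v); last by rewrite (thin_out0 u Uv) !linear0.
rewrite rE thin_homE comp_lfunE !lfunZ -pm_hom pm_thin.
- by rewrite phi1 [_ *: 1]mulr1 cfK.
- by move=> w; apply: U_set_between.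
- by case/andP: Uv => /(nz_dir hnz).
Qed.

(* Dually, h lifts as soon as it kills the kernel of the arrow a at src a; otherwise
   a vector of that kernel on which h does not vanish gives a section of h. *)
Lemma V_right_extension a X (h : rhom X (thin (V_set a))) : in_mod I X -> ~ split_epi h ->
  exists phi : (forall v, 'Hom(X v, K^o)),
    (forall v x, V_set a v -> phi v x = cf (h v x)) /\
    (forall e x, N_of a (tgt o e) -> phi (tgt o e) (rmap X e x) = if N_of a (src o e) then phi (src o e) x else 0).
Proof.
move=> iX hs; have /(in_modP hI) zX := iX.
have chiL v : linear (fun x => cf (h v x) : K^o).
  by move=> c u w; rewrite linearP /= cfP.
pose chi v : 'Hom(X v, K^o) := linfun (fun x => cf (h v x) : K^o).
have chiE v x : chi v x = cf (h v x) by rewrite /chi linfunE //; apply: chiL.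
case: (classic (exists y, rmap X a y = 0 /\ chi (src o a) y != 0)) => [[y [y0 cy]]|ny].
  case: hs.
  (* An arrow leaving V_a is [a], which kills y, or ends a path that acts by zero; hence y generates
     an image of M(V_a). *)
  have [e Vs|t tE] := @thin_hom_in _ _ _ (V_set a) X (fun v => pm X (src o a) v y).
    rewrite pm_arrow; last by case/andP: Vs => /(nz_dir hnz).
    have [//|Vt] := boolP (V_set a (tgt o e)).
    case: (V_set_out Vs Vt) => [->|/zX ->//].
    by rewrite -pm_arrow ?dir_refl // pm_refl y0.
  have hK v : V_set a v -> h v (pm X (src o a) v y) = (chi (src o a) y : K) *: thin1 _ v.
    move=> Vv; rewrite pm_hom -[h _ y]cfK lfunZ -chiE pm_thin //.
      by move=> w hw; apply: (V_set_dir hnz Vv).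
    by case/andP: Vv => /(nz_dir hnz).
  apply/split_epiP; exists (rscale (chi (src o a) y : K)^-1 t) => v u.
  have [Vv|Vv] := boolP (V_set a v); last by rewrite (thin_out0 u Vv) !linear0.
  by rewrite rscaleE thin_homE tE // !lfunZ hK // !scalerA mulrAC mulVf // mul1r cfK.
(* On the image of [a] the functional is found by going back to [src o a]; it is single valued
   because the kernel of [a] is killed there. *)
have [f fE] : exists f : 'Hom(X (tgt o a), K^o), forall x, f (rmap X a x) = chi (src o a) x.
  pose R z (c : K^o) := exists x, z = rmap X a x /\ c = chi (src o a) x.
  have [|||f fR] := @linear_relation_hom _ _ _ R.
  - by exists 0; rewrite !linear0.
  - by move=> c _ _ _ _ [x [-> ->]] [x' [-> ->]]; exists (c *: x + x'); rewrite !linearP.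
  - move=> _ [x [e ->]]; apply/eqP; apply: contra_notT ny => cx.
    by exists x; rewrite -e.
  by exists f => x; apply: fR; exists x.
exists (fun v => if V_set a v then chi v else (f \o pm X v (tgt o a))%VF).
split=> [v x ->|e x /orP[Ut|Vt]]; first exact: chiE.
  have Vt : V_set a (tgt o e) = false by apply: U_V_disjoint Ut.
  rewrite Vt comp_lfunE pm_arrow_r; last by case/andP: Ut => /(nz_dir hnz).
  have [Vs|Vs] := boolP (V_set a (src o e)).
    by have ea := V_U_arrow Vs Ut; subst e; rewrite /N_of Vs orbT -pm_arrow_r ?dir_refl // pm_refl fE.
  rewrite /N_of (negbTE Vs) orbF.
  have [_|Us] := boolP (U_set a (src o e)); first by rewrite comp_lfunE.
  case: (U_set_in Ut Us) => [ea|/zX -> //]; last by rewrite linear0.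
  by rewrite ea (V_set_src hnz) in Vs.
rewrite Vt chiE -rhomE thin_map cfZ cf_thin1 Vt mulr1.
have [Us|Us] := boolP (U_set a (src o e)); first by case: (U_V_arrow Us Vt).
rewrite /N_of (negbTE Us) orFb.
have [Vs|Vs] := boolP (V_set a (src o e)); first by rewrite chiE.
by rewrite cf_out.
Qed.

(** In M(N_a) the arrow [a] acts as the identity from V_a to U_a, which prevents both splittings;
    the two extension lemmas give the lifting properties. *)
Lemma almost_split a : exists (f : rhom (thin (U_set a)) (thin (N_of a)))
    (g : rhom (thin (N_of a)) (thin (V_set a))), almost_split_seq I f g.
Proof.
have [f fE] := @thin_can K _ _ _ _ (@U_N_compatible a).
have [g gE] := @thin_can K _ _ _ _ (@N_V_compatible a).
have Ns := N_set_src a; have Nt := N_set_tgt a.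
have Vs := V_set_src hnz a; have Ut := U_set_tgt a.
have Us : ~~ U_set a (src o a) by apply/negP=> /U_V_disjoint; rewrite Vs.
have Vt : ~~ V_set a (tgt o a) by rewrite (U_V_disjoint Ut).
exists f, g; split.
- by split; [apply: U_in_mod|apply: N_in_mod|apply: V_in_mod].
- by apply: (thin_exact fE gE) => // v; apply: U_V_disjoint.
- split=> [/split_monoP[r rf]|X h iX nh].
    have := rf (tgt o a) (thin1 _ (tgt o a)); rewrite fE cf_thin1 Ut scale1r.
    have := rhomE r (thin1 _ (src o a)); rewrite (thin_out0 (r _ _) Us) linear0.
    rewrite thin_map cf_thin1 Ns scale1r => <- /esym /eqP.
    by rewrite (negbTE (thin1_neq0 Ut)).
  have [x [xU xN]] := U_left_extension iX nh.
  have [h' h'E] := thin_hom_in xN.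
  exists h' => v; apply/comp_lfunP=> u; rewrite fE lfunZ [RHS]thin_homE.
  have [Uv|Uv] := boolP (U_set a v); last by rewrite cf_out // !scale0r.
  by rewrite h'E ?xU // /N_of Uv.
split=> [/split_epiP[r gr]|X h iX nh].
  have := rhomE r (thin1 _ (src o a)); rewrite !thin_map (thin_out0 (thin1 _ (tgt o a)) Vt).
  rewrite scaler0 linear0 => /eqP; rewrite scaler_eq0 (negbTE (thin1_neq0 Nt)) orbF.
  have := gr (src o a) (thin1 _ (src o a)); rewrite gE => e /eqP e'.
  by move: e; rewrite e' scale0r => /esym /eqP; rewrite (negbTE (thin1_neq0 Vs)).
have [phi [phiV phiN]] := V_right_extension iX nh.
have [h' h'E] := thin_hom_out phiN.
exists h' => v; apply/comp_lfunP=> x; rewrite gE h'E cfZ cf_thin1.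
have [Vv|Vv] := boolP (V_set a v); last by rewrite (thin_out0 (h v x) Vv) (thin_out0 (thin1 _ v) Vv) scaler0.
by rewrite phiV // /N_of Vv orbT mulr1 cfK.
Qed.

End ThinModules.

(** * Irreducible maps into P(src a) and out of I(tgt a) *)

Section BoundaryMaps.
Local Open Scope ring_scope.
Variables (K : fieldType) (n : nat) (o : 'I_n -> bool) (I : {vspace path_alg K o}).
Hypothesis hI : admissible I.
Implicit Types (X Y Z M N : rep K o) (i j k v w : 'I_n.+1) (a e : 'I_n) (b c d : pred 'I_n.+1).
Let hnz := nz_nonzero_paths hI.
Notation thin := (thin K o).
Notation thin1 := (thin1 K o).
Notation thin1_neq0 := (thin1_neq0 K o).
Notation U_set := (U_of o (nz I)).
Notation V_set := (V_of o (nz I)).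
Notation P_set := (P_of I).
Notation I_set := (I_of I).
Notation X_set := (X_of I).
Notation Y_set := (Y_of I).

Lemma side_arrow a e : src_side o a (tgt o e) -> src_side o a (src o e).
Proof. exact: src_side_dir (dir_arrow o e). Qed.

Lemma side_leave a e : src_side o a (src o e) -> ~~ src_side o a (tgt o e) -> e = a.
Proof. by move=> h1 h2; apply: (@src_side_cross _ o); rewrite h1 (negbTE h2). Qed.

Lemma X_P_compatible a : compatible o (X_set a) (P_set (src o a)).
Proof.
move=> e /andP[h1 h2] h3; rewrite /P_of h1 /X_of.
have -> : nz I (src o a) (tgt o e) by [].
by symmetry; apply: contra h2; apply: side_arrow.
Qed.

Lemma P_V_compatible a : compatible o (P_set (src o a)) (V_set a).
Proof.
move=> e h1 /andP[h2 h3]; rewrite /P_of h2 /V_of side_arrow // andbT.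
exact: h1.
Qed.

Lemma U_I_compatible a : compatible o (U_set a) (I_set (tgt o a)).
Proof.
move=> e /andP[h1 h2] h3; rewrite /I_of h1 /U_of.
have -> : nz I (tgt o e) (tgt o a) by [].
by symmetry; apply: contra h2; apply: side_arrow.
Qed.

Lemma I_Y_compatible a : compatible o (I_set (tgt o a)) (Y_set a).
Proof.
move=> e h1 /andP[h2 h3]; rewrite /I_of h2 /Y_of side_arrow // andbT.
exact: h1.
Qed.

Lemma X_set_tgt a : X_set a (tgt o a).
Proof. by rewrite /X_of (nz_arrow hnz) src_side_tgt. Qed.

Lemma Y_set_src a : Y_set a (src o a).
Proof. by rewrite /Y_of (nz_arrow hnz) src_side_src. Qed.

Lemma X_in_mod a : in_mod I (thin (X_set a)).
Proof.
apply: thin_in_mod => //; apply: (@path_closed_sub _ _ _ _ (P_set (src o a))) (@nz_path_closed _ _ _ hnz _) => v.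
by case/andP.
Qed.

Lemma Y_in_mod a : in_mod I (thin (Y_set a)).
Proof.
apply: thin_in_mod => //; apply: (@path_closed_sub _ _ _ _ (I_set (tgt o a))) (@I_path_closed _ _ _ _ hI _) => v.
by case/andP.
Qed.

Lemma X_indec a : indecomposable (thin (X_set a)).
Proof.
apply: (@thin_indec K _ o _ _ (X_set_tgt a)).
by apply: convexI; [apply: (nz_convex hnz)|apply: tgt_side_convex].
Qed.

Lemma I_convex i : convex (I_set i).
Proof. exact: (nz_convex (nonzero_paths_neg hnz)). Qed.

Lemma Y_indec a : indecomposable (thin (Y_set a)).
Proof.
apply: (@thin_indec K _ o _ _ (Y_set_src a)).
by apply: convexI; [apply: I_convex|apply: src_side_convex].
Qed.

Lemma P_indec i : indecomposable (thin (P_set i)).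
Proof.
apply: (@thin_indec K _ o _ i); [exact: (nz_refl hnz)|exact: (nz_convex hnz)].
Qed.

Lemma I_indec i : indecomposable (thin (I_set i)).
Proof.
apply: (@thin_indec K _ o _ i); [exact: (nz_refl hnz)|exact: I_convex].
Qed.

(** A vector over the top of P(i) generates, after scaling, a section. Dually, [I_split] retracts
    with a functional that is 1 on the image of the socle. *)
Lemma P_split i Z (g : rhom Z (thin (P_set i))) (z : Z i) : in_mod I Z ->
  g i z != 0 -> split_epi g.
Proof.
move=> iZ gz; have cz : cf (g i z) != 0.
  by apply: contraNneq gz => e; rewrite -[g i z]cfK e scale0r.
have [t tE] := P_hom hI ((cf (g i z))^-1 *: z) iZ.
apply/split_epiP; exists t => v u.
have [nv|nv] := boolP (P_set i v); last by rewrite (thin_out0 u nv) !linear0.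
rewrite thin_homE lfunZ tE // pm_hom lfunZ -{2}[g i z]cfK scalerA mulVf // scale1r.
rewrite pm_thin ?cfK //; last exact: (nz_dir hnz).
by move=> x /(nz_sub hnz nv)[].
Qed.

Lemma I_split i Z (h : rhom (thin (I_set i)) Z) : in_mod I Z ->
  h i (thin1 _ i) != 0 -> split_mono h.
Proof.
move=> iZ hz.
have [|phi [phi1 _]] := @separating_functional K (Z i) (Z i) 0 (h i (thin1 _ i)).
  by rewrite lim0g memv0.
have [t tE] := I_hom hI phi iZ.
apply/split_monoP; exists t => v u.
have [nv|nv] := boolP (I_set i v); last by rewrite (thin_out0 u nv) !linear0.
rewrite tE -pm_hom -{1}[u]cfK lfunZ pm_thin.
- by rewrite !lfunZ phi1 [_ *: 1]mulr1 cfK.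
- by move=> x /(nz_sub hnz nv)[].
- exact: (nz_dir hnz).
Qed.

(** In f = g h, either g reaches the top of P(src a) and splits, or it lands in the radical; then
    its component on the summand X retracts h. *)
Lemma X_P_irreducible a (f : rhom (thin (X_set a)) (thin (P_set (src o a)))) :
  (forall v u, f v u = cf u *: thin1 _ v) -> irreducible I f.
Proof.
move=> fE.
have Xs : ~~ X_set a (src o a) by rewrite /X_of src_side_src andbF.
have Ps : P_set (src o a) (src o a) by apply: (nz_refl hnz).
have Pt : P_set (src o a) (tgt o a) by apply: (nz_arrow hnz).
split.
- exact: X_in_mod.
- exact: P_in_mod.
- case/split_monoP=> r rf.
  have := rf (tgt o a) (thin1 _ (tgt o a)); rewrite fE cf_thin1 X_set_tgt scale1r.
  have := rhomE r (thin1 _ (src o a)); rewrite (thin_out0 (r _ _) Xs) linear0.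
  rewrite thin_map cf_thin1 Ps scale1r => <- /esym /eqP.
  by rewrite (negbTE (thin1_neq0 (X_set_tgt a))).
- move=> /split_epi_epi /epi_surj /(_ (src o a) (thin1 _ (src o a)))[x].
  rewrite (thin_out0 x Xs) linear0 => /eqP.
  by rewrite (negbTE (thin1_neq0 Ps)).
move=> Z h g iZ fgh.
have fgh' v u : f v u = g v (h v u) by rewrite fgh comp_lfunE.
case: (classic (exists z, g (src o a) z != 0)) => [[z gz]|ng].
  by right; apply: P_split gz.
have g0 z : g (src o a) z = 0.
  by apply/eqP; apply: contra_notT ng => gz; exists z.
left; pose chi v : 'Hom(Z v, K^o) := linfun (fun x => cf (g v x) : K^o).
have chiE v x : chi v x = cf (g v x).
  by rewrite /chi linfunE // => c u w; rewrite linearP /= cfP.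
have [e z Xt|r rE] := @thin_hom_out _ _ _ (X_set a) Z chi.
  have Pt' : P_set (src o a) (tgt o e) by case/andP: Xt.
  rewrite !chiE -rhomE thin_map cfZ cf_thin1 Pt' mulr1.
  have [//|Xs'] := boolP (X_set a (src o e)).
  have [Ps'|Ps'] := boolP (P_set (src o a) (src o e)); last by rewrite cf_out.
  have ea : e = a.
    case/andP: Xt => _; apply: side_leave.
    by move: Xs'; rewrite /X_of -/(P_set _ _) Ps' negbK.
  by subst e; rewrite g0 cf0.
apply/split_monoP; exists r => v u.
have [Xv|Xv] := boolP (X_set a v); last by rewrite (thin_out0 u Xv) !linear0.
rewrite rE chiE -fgh' fE cfZ cf_thin1; case/andP: Xv => h1 _.
by rewrite /P_of h1 mulr1 cfK.
Qed.

(** In g = q h, either h is nonzero on the socle of I(tgt a) and splits, or it factors through the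
    quotient by the socle, whose summand Y gives a section of q. *)
Lemma I_Y_irreducible a (g : rhom (thin (I_set (tgt o a))) (thin (Y_set a))) :
  (forall v u, g v u = cf u *: thin1 _ v) -> irreducible I g.
Proof.
move=> gE.
have Yt : ~~ Y_set a (tgt o a) by rewrite /Y_of (negbTE (src_side_tgt _ _)) andbF.
have It : I_set (tgt o a) (tgt o a) by apply: (nz_refl hnz).
have Is : I_set (tgt o a) (src o a) by apply: (nz_arrow hnz).
split.
- exact: I_in_mod.
- exact: Y_in_mod.
- move=> /split_mono_mono /mono0 => h.
  have := h (tgt o a) (thin1 _ (tgt o a)); rewrite (thin_out0 (g _ _) Yt) => /(_ erefl) /eqP.
  by rewrite (negbTE (thin1_neq0 It)).
- case/split_epiP=> r gr.
  have := rhomE r (thin1 _ (src o a)); rewrite !thin_map (thin_out0 (thin1 _ (tgt o a)) Yt).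
  rewrite scaler0 linear0 => /eqP; rewrite scaler_eq0 (negbTE (thin1_neq0 It)) orbF.
  have := gr (src o a) (thin1 _ (src o a)); rewrite gE => e /eqP e'.
  by move: e; rewrite e' scale0r => /esym /eqP; rewrite (negbTE (thin1_neq0 (Y_set_src a))).
move=> Z h q iZ gqh.
have gqh' v u : g v u = q v (h v u) by rewrite gqh comp_lfunE.
case: (eqVneq (h (tgt o a) (thin1 _ (tgt o a))) 0) => [h0|hn]; last first.
  by left; apply: I_split hn.
right.
have [e Ys|s sE] := @thin_hom_in _ _ _ (Y_set a) Z (fun v => h v (thin1 _ v)).
  have Is' : I_set (tgt o a) (src o e) by case/andP: Ys.
  rewrite rhomE thin_map cf_thin1 Is' scale1r.
  have [//|Yt'] := boolP (Y_set a (tgt o e)).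
  have [It'|It'] := boolP (I_set (tgt o a) (tgt o e)); last by rewrite (thin_out0 (thin1 _ (tgt o e)) It') linear0.
  have ea : e = a.
    case/andP: Ys => _ h1; apply: side_leave h1 _.
    by move: Yt'; rewrite /Y_of -/(I_set _ _) It'.
  by subst e; rewrite h0.
apply/split_epiP; exists s => v u.
have [Yv|Yv] := boolP (Y_set a v); last by rewrite (thin_out0 u Yv) !linear0.
rewrite thin_homE sE // lfunZ -gqh' gE cf_thin1; case/andP: Yv => h1 _.
by rewrite /I_of h1 scale1r cfK.
Qed.

Lemma X_P_exists a : exists f : rhom (thin (X_set a)) (thin (P_set (src o a))),
  irreducible I f /\ exists p : rhom (thin (P_set (src o a))) (thin (V_set a)), short_exact f p.
Proof.
have [f fE] := @thin_can K _ _ _ _ (@X_P_compatible a).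
have [g gE] := @thin_can K _ _ _ _ (@P_V_compatible a).
exists f; split; first exact: X_P_irreducible.
exists g; apply: (thin_exact fE gE) => v; rewrite /X_of /P_of /V_of.
  by case: (nz _ _ _); case: src_side.
by case/andP=> _ /negbTE->; rewrite andbF.
Qed.

Lemma I_Y_exists a : exists g : rhom (thin (I_set (tgt o a))) (thin (Y_set a)),
  irreducible I g /\ exists j : rhom (thin (U_set a)) (thin (I_set (tgt o a))), short_exact j g.
Proof.
have [f fE] := @thin_can K _ _ _ _ (@U_I_compatible a).
have [g gE] := @thin_can K _ _ _ _ (@I_Y_compatible a).
exists g; split; first exact: I_Y_irreducible.
exists f; apply: (thin_exact fE gE) => v; rewrite /Y_of /I_of /U_of.
  by case: (nz _ _ _); case: src_side.
by case/andP=> _ /negbTE->; rewrite andbF.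
Qed.

End BoundaryMaps.

(** * The algebra KQ/I; its projectives and injectives are thin *)

Section BoundAlgebra.
Local Open Scope ring_scope.
Variables (K : fieldType) (n : nat) (o : 'I_n -> bool) (I : {vspace path_alg K o}).
Hypothesis hI : admissible I.
Implicit Types (i j k v w : 'I_n.+1) (a e : 'I_n).
Let hnz := nz_nonzero_paths hI.
Notation A := (path_alg K o).
Notation thin := (thin K o).
Notation thin1 := (thin1 K o).
Notation P_set := (P_of I).
Notation I_set := (I_of I).

Lemma bclass_linear : linear (@bclass K n o I).
Proof. by move=> c x y; rewrite /bclass !linearP. Qed.

Lemma bclass_split (x : A) : exists2 y, y \in I & x = vsval (bclass I x) + y.
Proof.
have dis : (I^C :&: I = 0)%VS by rewrite capvC capv_compl.
exists (daddv_pi I (I^C)%VS x); first exact: memv_pi.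
rewrite /bclass vsprojK ?memv_pi // daddv_pi_add //.
by rewrite addvC addv_complf memvf.
Qed.

Lemma bclass_eq0 (x : A) : bclass I x = 0 <-> x \in I.
Proof.
have [y yI e] := bclass_split x; split=> [h|xI]; first by rewrite e h linear0 add0r.
apply: subvs_inj; rewrite linear0; apply/eqP; rewrite -memv0 -(capv_compl I) memv_cap subvsP andbT.
have -> : vsval (bclass I x) = x - y by rewrite {2}e addrK.
exact: memvB.
Qed.

Lemma bclass_eq (x y : A) : x - y \in I -> bclass I x = bclass I y.
Proof.
move=> /bclass_eq0 h; apply/eqP; rewrite -subr_eq0; apply/eqP; rewrite -h.
have e := bclass_linear (-1) y x.
by rewrite !scaleN1r ![- _ + _]addrC in e; rewrite e.
Qed.

Lemma bclass_val (x : bound_alg I) : bclass I (vsval x) = x.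
Proof.
apply: subvs_inj; rewrite /bclass vsprojK ?memv_pi // daddv_pi_id ?subvsP //.
by rewrite capvC capv_compl.
Qed.

(** The product is formed on chosen representatives; changing them adds elements of the ideal. *)
Lemma bmul_bclass (x y : A) : bmul (bclass I x) (bclass I y) = bclass I (pmul x y).
Proof.
have [x' x'I ex] := bclass_split x; have [y' y'I ey] := bclass_split y.
apply: bclass_eq; rewrite -memvN opprB.
have -> : pmul x y = pmul (vsval (bclass I x)) (vsval (bclass I y)) +
    (pmul (vsval (bclass I x)) y' + pmul x' y).
  have l1 := pmul_linl y 1 (vsval (bclass I x)) x'; rewrite !scale1r -ex in l1.
  have l2 := pmul_linr (vsval (bclass I x)) 1 (vsval (bclass I y)) y'; rewrite !scale1r -ey in l2.
  by rewrite l1 l2 addrA.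
rewrite addrC addKr; apply: memvD; [exact: ideal_l|exact: ideal_r].
Qed.

Definition pclass i j : bound_alg I := bclass I (pij K o i j).

Lemma pclass_mul i j k : dir o i j -> dir o j k -> bmul (pclass j k) (pclass i j) = pclass i k.
Proof. by move=> h1 h2; rewrite bmul_bclass pmul_pij. Qed.

Lemma pclass_eq0 i j : pclass i j = 0 <-> ~~ nz I i j.
Proof. by rewrite /nz negbK; apply: bclass_eq0. Qed.

Lemma bmul_linl (y : bound_alg I) : linear (fun x : bound_alg I => bmul x y).
Proof. by move=> c u v; rewrite /bmul linearP /= pmul_linl bclass_linear. Qed.

Lemma bmul_linr (x : bound_alg I) : linear (fun y : bound_alg I => bmul x y).
Proof. by move=> c u v; rewrite /bmul linearP /= pmul_linr bclass_linear. Qed.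

Lemma peirceE j i : peirce I j i = <[pclass i j]>%VS.
Proof.
have E x : linfun (fun x : bound_alg I =>
    bmul (bmul (bclass I (pidem K o j)) x) (bclass I (pidem K o i))) x =
    bclass I (pmul (pij K o j j) (pmul (vsval x) (pij K o i i))).
  rewrite linfunE => [|c u v]; last by rewrite bmul_linr bmul_linl.
  rewrite -{1}[x]bclass_val !pidemE !bmul_bclass; congr bclass.
  by apply/ffunP=> p; rewrite pmul_idr !pmul_idl pmul_idr; case: eqP; case: eqP.
apply/vspaceP=> y; apply/idP/idP=> [/memv_imgP[x _ ->]|/vlineP[c ->]]; last first.
  apply: memvZ; case: (boolP (dir o i j)) => d; last first.
    have -> : pclass i j = 0 by apply/pclass_eq0; apply: contra d; apply: (nz_dir hnz).
    exact: mem0v.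
  apply/memv_imgP; exists (pclass i j); rewrite ?memvf // E.
  by rewrite -bmul_bclass -bmul_bclass bclass_val !pclass_mul // dir_refl.
rewrite E; case: (boolP (dir o i j)) => d; last first.
  have -> : pmul (pij K o j j) (pmul (vsval x) (pij K o i i)) = 0.
    apply/ffunP=> p; rewrite pmul_idl pmul_idr ffunE.
    by case: eqP => // e1; case: eqP => // e2; case/negP: d; rewrite -e1 -e2 qpath_dir.
  have -> : bclass I (0 : A) = 0 by apply/bclass_eq0; apply: mem0v.
  exact: mem0v.
have [p [e1 e2]] := dir_qpath d.
have -> : pmul (pij K o j j) (pmul (vsval x) (pij K o i i)) = (vsval x p : K) *: pij K o i j.
  apply/ffunP=> q; rewrite pmul_idl pmul_idr !ffunE.
  case: eqP => [f1|_] //=; case: eqP => [f2|_] //=; rewrite ?andbF ?[_ *: _]mulr0 //.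
  by rewrite [_ *: _]mulr1; congr (vsval x _); apply: qpath_unique; rewrite ?f1 ?f2 ?e1 ?e2.
have := bclass_linear (vsval x p : K) (pij K o i j) 0.
have -> : bclass I (0 : A) = 0 by apply/bclass_eq0; apply: mem0v.
by rewrite !addr0 => ->; apply: memvZ; apply: memv_line.
Qed.

Definition pgen i j : subvs_of (peirce I j i) := vsproj _ (pclass i j).

Lemma pgen_val i j : vsval (pgen i j) = pclass i j.
Proof. by rewrite vsprojK // peirceE memv_line. Qed.

Lemma pgen_span i j (x : subvs_of (peirce I j i)) : exists c, x = c *: pgen i j.
Proof.
have := subvsP x; rewrite {2}peirceE => /vlineP[c e]; exists c.
by apply: subvs_inj; rewrite linearZ /= pgen_val.
Qed.

Lemma pgen_eq0 i j : pgen i j = 0 <-> ~~ nz I i j.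
Proof.
rewrite -pclass_eq0 -pgen_val; split=> [->|h]; first by rewrite linear0.
by apply: subvs_inj; rewrite h linear0.
Qed.

Lemma proj_at_map i a : dir o i (src o a) -> rmap (proj_at I i) a (pgen i (src o a)) = pgen i (tgt o a).
Proof.
move=> d; rewrite linfunE => [|c x y]; last by rewrite linearP /= bmul_linr linearP.
by apply: subvs_inj; rewrite pgen_val parrowE -/(pclass _ _) pclass_mul ?dir_arrow.
Qed.

Lemma proj_at_thin i : isomorphic (thin (P_set i)) (proj_at I i).
Proof.
have [a ns|f fE] := @thin_hom_in _ _ _ (P_set i) (proj_at I i) (pgen i).
  rewrite proj_at_map; last exact: (nz_dir hnz).
  by have [//|/pgen_eq0] := boolP (P_set i (tgt o a)).
exists f; apply: bij_iso.
  apply: mono_eq0 => v u; have [nv|nv] := boolP (P_set i v); last by rewrite (thin_out0 u nv).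
  rewrite thin_homE fE // => /eqP; rewrite scaler_eq0 => /orP[/eqP e|/eqP/pgen_eq0].
    by rewrite -[u]cfK e scale0r.
  by rewrite -/(P_set i v) nv.
apply/epi_surj=> v x; have [c ->] := pgen_span x.
have [nv|nv] := boolP (P_set i v); first by exists (c *: thin1 _ v); rewrite lfunZ fE.
by exists 0; rewrite linear0 (pgen_eq0 i v).2 // scaler0.
Qed.

Lemma inj_at_map i a (x : inj_at I i (src o a)) : dir o (tgt o a) i ->
  (rmap (inj_at I i) a x : 'Hom(_, K^o)) (pgen (tgt o a) i) = (x : 'Hom(_, K^o)) (pgen (src o a) i).
Proof.
move=> d; rewrite linfunE => [|c y z]; last first.
  by rewrite comp_lfunDl comp_lfunZl.
rewrite comp_lfunE; congr (x _); rewrite linfunE => [|c y z].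
  by rewrite /rmul_arrow pgen_val parrowE -/(pclass _ _) pclass_mul ?dir_arrow.
by rewrite /rmul_arrow linearP /= bmul_linl linearP.
Qed.

Lemma inj_at_thin i : exists J : rhom (inj_at I i) (thin (I_set i)),
  iso J /\ forall v (x : inj_at I i v), J v x = ((x : 'Hom(_, K^o)) (pgen v i) : K) *: thin1 _ v.
Proof.
have phiL v : linear (fun x : 'Hom(subvs_of (peirce I i v), K^o) => x (pgen v i)).
  by move=> c x y; rewrite add_lfunE scale_lfunE.
pose phi v : 'Hom(inj_at I i v, K^o) :=
  linfun (fun x : 'Hom(subvs_of (peirce I i v), K^o) => x (pgen v i)).
have phiE v (x : 'Hom(subvs_of (peirce I i v), K^o)) : phi v x = x (pgen v i).
  by rewrite /phi linfunE //; apply: phiL.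
have [a x nt|J JE] := @thin_hom_out _ _ _ (I_set i) (inj_at I i) phi.
  rewrite !phiE inj_at_map; last exact: (nz_dir hnz).
  by have [//|/pgen_eq0 ->] := boolP (I_set i (src o a)); rewrite linear0.
exists J; split; last by move=> v x; rewrite JE phiE.
apply: bij_iso.
  apply: mono_eq0 => v x; rewrite JE phiE => e; apply/lfunP=> y.
  have [c ->] := pgen_span y; rewrite zero_lfunE lfunZ.
  have [nv|nv] := boolP (I_set i v); last by rewrite (pgen_eq0 v i).2 // linear0 scaler0.
  move/eqP: e; rewrite scaler_eq0 (negbTE (thin1_neq0 K o nv)) orbF => /eqP->.
  exact: scaler0.
apply/epi_surj=> v u; have [nv|nv] := boolP (I_set i v); last first.
  by exists 0; rewrite linear0 (thin_out0 u nv).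
have [|psi [psi1 _]] := @separating_functional K (subvs_of (peirce I i v)) (subvs_of (peirce I i v)) 0 (pgen v i).
  by rewrite lim0g memv0; apply/eqP=> /pgen_eq0; rewrite -/(I_set i v) nv.
exists (cf u *: psi : 'Hom(_, K^o)).
by rewrite JE phiE scale_lfunE psi1 [_ *: 1]mulr1 cfK.
Qed.

Lemma inj_arrow_gen a k (x : inj_at I (tgt o a) k) : dir o k (src o a) ->
  (inj_arrow I a k x : 'Hom(_, K^o)) (pgen k (src o a)) = (x : 'Hom(_, K^o)) (pgen k (tgt o a)).
Proof.
move=> d; rewrite /inj_arrow linfunE => [|c y z]; last by rewrite comp_lfunDl comp_lfunZl.
rewrite comp_lfunE; congr (x _); rewrite linfunE => [|c y z].
  by rewrite /lmul_arrow pgen_val parrowE -/(pclass _ _) pclass_mul ?dir_arrow.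
by rewrite /lmul_arrow linearP /= bmul_linr linearP.
Qed.

(** [inj_arrow] is given vertex by vertex; identified with a canonical map of thin modules, it
    becomes a morphism that others can be composed with. *)
Lemma inj_arrow_hom a : exists h : rhom (inj_at I (tgt o a)) (inj_at I (src o a)),
  forall k x, h k x = inj_arrow I a k x.
Proof.
have [J [jJ JE]] := inj_at_thin (tgt o a); have [J' [jJ' JE']] := inj_at_thin (src o a).
have [J'' [_ J's J's']] := iso_inv jJ'.
have comp : compatible o (I_set (tgt o a)) (I_set (src o a)).
  move=> e h1 h2; have d1 := dir_arrow o e; have d2 := dir_arrow o a.
  have d3 := nz_dir hnz h2.
  have [h3 _] := nz_sub hnz h1 (dir_between (dir_trans d1 d3) d2).
  have [_ h4] := nz_sub hnz h1 (dir_between d1 (dir_trans d3 d2)).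
  by rewrite /I_of h3 h4.
have [c cE] := @thin_can K _ _ _ _ comp.
exists (rcomp J'' (rcomp c J)) => k x; apply: ((mono_injP J').1 (iso_mono jJ') k).
rewrite !rcompE J's' cE JE JE'.
have [nk|nk] := boolP (I_set (src o a) k); last by rewrite (thin_out0 (thin1 _ k) nk) !scaler0.
rewrite inj_arrow_gen; last exact: (nz_dir hnz).
rewrite cfZ cf_thin1; have [nk'|/pgen_eq0 ->] := boolP (I_set (tgt o a) k); first by rewrite mulr1.
by rewrite linear0 mul0r.
Qed.

End BoundAlgebra.

(** * The inverse translate: uniqueness, and its value on M(U_a) *)

Section TauInverse.
Local Open Scope ring_scope.
Variables (K : fieldType) (n : nat) (o : 'I_n -> bool) (I : {vspace path_alg K o}).
Hypothesis hI : admissible I.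
Implicit Types (J C M N T X Y Z : rep K o) (i j k v w : 'I_n.+1) (a e : 'I_n).
Let hnz := nz_nonzero_paths hI.
Notation thin := (thin K o).
Notation thin1 := (thin1 K o).
Notation U_set := (U_of o (nz I)).
Notation V_set := (V_of o (nz I)).
Notation P_set := (P_of I).
Notation I_set := (I_of I).
Notation Y_set := (Y_of I).

Lemma envelope_ext M J (f : rhom M J) X (h : rhom J X) : injective_envelope I f ->
  in_mod I X -> mono (rcomp h f) -> mono h.
Proof.
by move=> [_ _ H] iX; apply: H => // i; apply/comp_lfunP=> x; rewrite rcompE.
Qed.

Lemma envelope_precomp M M' J (f : rhom M J) (s : rhom M' M) :
  iso s -> injective_envelope I f -> injective_envelope I (rcomp f s).
Proof.
move=> is_ [jJ mf H]; have [s' [is' s's ss']] := iso_inv is_; split=> //.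
  apply: mono_eq0 => i x; rewrite rcompE => /(mono0 mf).
  exact: (mono0 (iso_mono is_)).
move=> X h hf iX hfE mhf; apply: (H X h (rcomp hf s')) => //.
  by move=> i; apply/comp_lfunP=> x; rewrite rcompE -hfE comp_lfunE rcompE ss'.
apply: mono_eq0 => i x; rewrite rcompE => /(mono0 mhf).
exact: (mono0 (iso_mono is')).
Qed.

Lemma envelope_unique M J J' (f : rhom M J) (f' : rhom M J') :
  injective_envelope I f -> injective_envelope I f' ->
  exists s : rhom J J', iso s /\ forall i x, s i (f i x) = f' i x.
Proof.
move=> ef ef'; have [[iJ jJ] mf _] := ef; have [[iJ' jJ'] mf' _] := ef'.
have iM := in_mod_sub mf iJ.
have [s sE] := jJ' _ _ f f' iM iJ mf.
have sf i x : s i (f i x) = f' i x by rewrite -comp_lfunE sE.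
have ms : mono s.
  apply: (envelope_ext ef) => //; apply: mono_eq0 => i x.
  by rewrite rcompE sf; apply: mono0.
have [r rE] := jJ _ _ s (rid J) iJ iJ' ms.
have rs i x : r i (s i x) = x by rewrite -comp_lfunE rE id_lfunE.
have mr : mono r.
  apply: (envelope_ext ef') => //; apply: mono_eq0 => i x.
  by rewrite rcompE -sf rs; apply: mono0.
exists s; split=> //; apply: bij_iso => //; apply/epi_surj=> i y.
by exists (r i y); apply: ((mono_injP r).1 mr i); rewrite rs.
Qed.

Lemma is_tau_inv_iso M M' T : isomorphic M M' -> is_tau_inv I M T -> is_tau_inv I M' T.
Proof.
move=> /isomorphic_sym[s is_] [I0 [C [I1 [f [p [j [pi [[ef fp ej] H]]]]]]]].
exists I0, C, I1, (rcomp f s), p, j, pi; split=> //; split=> //.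
  exact: envelope_precomp.
move/short_exactP: fp => [mf ep pf fp]; apply/short_exactP; split=> //.
- by case: (envelope_precomp is_ ef).
- by move=> i x; rewrite rcompE pf.
move=> i y /fp[x ->]; have [z ->] := (epi_surj s).1 (iso_epi is_) i x.
by exists z; rewrite rcompE.
Qed.

(** Morphisms are records with a commutation proof, so pointwise equality is not equality. The
    linearity clause sees only values, and adding the zero morphism shows that [pi] does too. *)
Lemma linear_pointwise M N (T : vectType K) (pi : rhom M N -> T) :
  (forall (c : K) (phi psi chi : rhom M N), (forall k, chi k = c *: phi k + psi k) ->
     pi chi = c *: pi phi + pi psi) ->
  forall phi psi : rhom M N, (forall k x, phi k x = psi k x) -> pi phi = pi psi.
Proof.
move=> piL phi psi e; have z0 : pi (rzero M N) = 0.
  have h : pi (rzero M N) = 1 *: pi (rzero M N) + pi (rzero M N).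
    by apply: piL => k; rewrite [rzero M N k]/(0 : 'Hom(_, _)) scaler0 addr0.
  by apply: (addIr (pi (rzero M N))); rewrite add0r {3}h scale1r.
have -> : pi phi = 1 *: pi psi + pi (rzero M N); last by rewrite z0 addr0 scale1r.
apply: piL => k; rewrite [rzero M N k]/(0 : 'Hom(_, _)) scale1r addr0.
by apply/lfunP=> x.
Qed.

(** Isomorphisms of the envelopes, built from [I0] outwards, identify the two copresentations; the
    class of phi goes to the class of q phi. *)
Lemma is_tau_inv_unique M T T' : is_tau_inv I M T -> is_tau_inv I M T' -> isomorphic T T'.
Proof.
move=> [I0 [C [I1 [f [p [j [pi [[ef fp ej] [piL piS piK piN]]]]]]]]].
move=> [I0' [C' [I1' [f' [p' [j' [pi' [[ef' fp' ej'] [piL' piS' piK' piN']]]]]]]]].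
have [s [is_ sf]] := envelope_unique ef ef'.
have [s' [is' s's ss']] := iso_inv is_.
have [mf ep pf kp] := (short_exactP _ _).1 fp.
have [mf' ep' pf' kp'] := (short_exactP _ _).1 fp'.
have sp : short_exact f (rcomp p' s).
  apply/short_exactP; split=> //.
  - apply/epi_surj=> i y; have [x ->] := (epi_surj p').1 ep' i y.
    by exists (s' i x); rewrite rcompE ss'.
  - by move=> i x; rewrite rcompE sf pf'.
  - move=> i y; rewrite rcompE => /kp'[x ex]; exists x.
    by apply: ((mono_injP s).1 (iso_mono is_) i); rewrite sf ex.
have [|_ [t [_ it _ tE]]] := short_exact_unique fp sp.
  move=> i x; split=> [/kp[y ->]|].
    by rewrite rcompE sf pf'.
  rewrite rcompE => /kp'[y ey].
  suff -> : x = f i y by rewrite pf.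
  by apply: ((mono_injP s).1 (iso_mono is_) i); rewrite sf.
have tp i x : t i (p i x) = p' i (s i x) by rewrite tE rcompE.
have [q [iq qj]] := envelope_unique ej (envelope_precomp it ej').
have {}qj i x : q i (j i x) = j' i (t i x) by rewrite qj rcompE.
have [q' [iq' q'q qq']] := iso_inv iq.
have piX i := linear_pointwise (piL i); have piX' i := linear_pointwise (piL' i).
have [F FE] : exists F : forall i, 'Hom(T i, T' i), forall i phi, F i (pi i phi) = pi' i (rcomp q phi).
  have H i : exists F : 'Hom(T i, T' i), forall phi, F (pi i phi) = pi' i (rcomp q phi).
    pose R x y := exists phi, x = pi i phi /\ y = pi' i (rcomp q phi).
    have [|||F hF] := @linear_relation_hom _ _ _ R.
    - have piz : pi i (rzero _ _) = 0.
        by apply/(piK i); exists (rzero _ _) => k; apply/lfunP=> x; rewrite !comp_lfunE !rzeroE !linear0.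
      exists (rzero _ _); rewrite piz; split=> //; symmetry; apply/(piK' i).
      by exists (rzero _ _) => k; apply/lfunP=> x; rewrite rcompE !comp_lfunE !rzeroE !linear0.
    - move=> c _ _ _ _ [phi [-> ->]] [psi [-> ->]].
      have [chi chiE] : exists chi : rhom (inj_at I i) I1, forall k, chi k = c *: phi k + psi k.
        have Hc a x : rmap I1 a ((c *: phi (src o a) + psi (src o a)) x) =
            (c *: phi (tgt o a) + psi (tgt o a)) (rmap (inj_at I i) a x).
          by rewrite !add_lfunE !scale_lfunE -!rhomE; apply: linearP.
        by exists (mk_rhom (h := fun k => c *: phi k + psi k) Hc).
      exists chi; split; first by rewrite (piL i c phi psi chi).
      symmetry; apply: piL' => k; apply/lfunP=> x.
      by rewrite rcompE chiE !add_lfunE !scale_lfunE !rcompE linearP.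
    - move=> _ [phi [e ->]]; have [psi hpsi] := (piK i phi).1 (esym e).
      apply/(piK' i); exists (rcomp s psi) => k; apply/lfunP=> x.
      by rewrite rcompE hpsi !comp_lfunE qj tp.
    by exists F => phi; apply: hF; exists phi.
  exact: (@fin_all_exists _ (fun i => 'Hom(T i, T' i)) (fun i F => forall phi, F (pi i phi) = pi' i (rcomp q phi)) H).
have HF a x : rmap T' a (F (src o a) x) = F (tgt o a) (rmap T a x).
  have [phi <-] := piS _ x; have [A AE] := inj_arrow_hom hI a.
  rewrite (piN a phi (rcomp phi A)); last first.
    by move=> k; apply/lfunP=> y; rewrite rcompE comp_lfunE AE.
  rewrite !FE; apply: piN' => k; apply/lfunP=> y.
  by rewrite comp_lfunE !rcompE AE.
pose G := mk_rhom (h := F) HF; have GE i x : G i x = F i x by [].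
exists G; apply: bij_iso.
  apply: mono_eq0 => i x; have [phi <-] := piS i x.
  rewrite GE FE => /(piK' i)[psi hpsi].
  apply/(piK i); exists (rcomp s' psi) => k; apply/lfunP=> y.
  rewrite !comp_lfunE; apply: ((mono_injP q).1 (iso_mono iq) k).
  by rewrite qj tp ss' -rcompE hpsi !comp_lfunE.
apply/epi_surj=> i y; have [phi <-] := piS' i y.
exists (pi i (rcomp q' phi)); rewrite GE FE.
by apply: piX' => k x; rewrite !rcompE qq'.
Qed.

Lemma injective_zero Z : is_zero Z -> injective_rep I Z.
Proof.
move=> zZ; have /is_zeroP z := zZ; split=> [|X Y g h _ _ _]; first exact: in_mod_zero.
by exists (rzero _ _) => i; apply/lfunP=> x; rewrite [LHS]z [RHS]z.
Qed.

Lemma is_tau_inv_zero Z : is_zero Z -> is_tau_inv I Z (zero_rep K o).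
Proof.
move=> zZ; have zz := is_zero_zero_rep K o; have /is_zeroP z := zz.
have ez Y : is_zero Y -> injective_envelope I (rzero Y (zero_rep K o)).
  move=> /is_zeroP zY; split; [exact: injective_zero|by apply: mono_eq0 => i x _; apply: zY|].
  by move=> X h hf _ _ _; apply: mono_eq0 => i x _; apply: z.
exists (zero_rep K o), (zero_rep K o), (zero_rep K o), (rzero _ _), (rid _), (rzero _ _).
exists (fun i _ => 0); split.
  split; [exact: ez| |exact: ez].
  apply/short_exactP; split.
  - by case: (ez _ zZ).
  - exact: iso_epi (iso_id _).
  - by move=> i x; apply: z.
  - by move=> i y _; exists 0; rewrite [y]z linear0.
split.
- by move=> *; rewrite scaler0 addr0.
- by move=> i t; exists (rzero _ _); rewrite [t]z.
- by move=> i phi; split=> // _; exists (rzero _ _) => k; apply/lfunP=> x; rewrite [LHS]z [RHS]z.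
- by move=> a phi psi _; rewrite linear0.
Qed.

Lemma is_tau_inv_of_zero Z T : is_zero Z -> is_tau_inv I Z T -> is_zero T.
Proof.
move=> zZ hT; apply: is_zero_iso (is_zero_zero_rep K o).
exact: is_tau_inv_unique (is_tau_inv_zero zZ) hT.
Qed.

Lemma thin_can_mono b c (f : rhom (thin b) (thin c)) : (forall v u, f v u = cf u *: thin1 c v) ->
  (forall v, b v -> c v) -> mono f.
Proof.
move=> fE bc; apply: mono_eq0 => v u.
have [bv|bv] := boolP (b v); last by rewrite (thin_out0 u bv).
rewrite fE => /eqP; rewrite scaler_eq0 (negbTE (thin1_neq0 K o (bc _ bv))) orbF => /eqP e.
by rewrite -[u]cfK e scale0r.
Qed.

(** The socle vertex [i] lies in b: a nonzero vector killed by [h] could be moved along its path to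
    [i], where [h] does not vanish. *)
Lemma thin_envelope b i (f : rhom (thin b) (thin (I_set i))) :
  (forall v u, f v u = cf u *: thin1 _ v) -> (forall v, b v -> I_set i v) -> b i ->
  injective_envelope I f.
Proof.
move=> fE bI bi; split; [exact: I_injective|exact: thin_can_mono bI|].
move=> X h hf iX hE mhf; apply: mono_eq0 => v u hu.
have [nv|nv] := boolP (I_set i v); last by rewrite (thin_out0 u nv).
suff e : cf u = 0 by rewrite -[u]cfK e scale0r.
have e : h i (thin1 _ i) = hf i (thin1 _ i).
  by rewrite -hE comp_lfunE fE cf_thin1 bi scale1r.
have hn : h i (thin1 _ i) != 0.
  by rewrite e; apply/eqP=> /(mono0 mhf) /eqP; rewrite (negbTE (thin1_neq0 K o bi)).
have := congr1 (pm X v i) hu; rewrite linear0 -pm_hom -[u]cfK lfunZ pm_thin.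
- by rewrite lfunZ cfK => /eqP; rewrite scaler_eq0 (negbTE hn) orbF => /eqP.
- by move=> x /(nz_sub hnz nv)[].
- exact: (nz_dir hnz).
Qed.

Lemma inj_at_in_mod i : in_mod I (inj_at I i).
Proof.
have [J [jJ _]] := inj_at_thin hI i.
exact: in_mod_iso (isomorphic_sym (ex_intro _ J jJ)) (@I_in_mod _ _ _ _ hI i).
Qed.

Lemma inj_at_out i v (x : inj_at I i v) : ~~ nz I v i -> x = 0.
Proof.
have [J [jJ _]] := inj_at_thin hI i => nv.
by apply: (mono0 (iso_mono jJ)); apply: thin_out0.
Qed.

Lemma inj_at_eq i v (x y : inj_at I i v) :
  (x : 'Hom(_, K^o)) (pgen I v i) = (y : 'Hom(_, K^o)) (pgen I v i) -> x = y.
Proof.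
have [J [jJ JE]] := inj_at_thin hI i => e.
by apply: ((mono_injP J).1 (iso_mono jJ) v); rewrite !JE e.
Qed.

Lemma inj_at_delta i v : exists x : inj_at I i v, (x : 'Hom(_, K^o)) (pgen I v i) = (nz I v i)%:R.
Proof.
have [J [jJ JE]] := inj_at_thin hI i.
have [x ex] := (epi_surj J).1 (iso_epi jJ) v (thin1 _ v); exists x.
have := congr1 (@cf _ _ _ _ _) ex; rewrite JE cfZ !cf_thin1 /I_of.
case: (boolP (nz I v i)) => nv; first by rewrite mulr1.
by rewrite (inj_at_out x nv) zero_lfunE.
Qed.

Lemma Y_set_sub a v : Y_set a v -> nz I v (src o a).
Proof.
move=> /andP[nv sv]; have [|bs _] := @src_side_between _ o a v (tgt o a).
  by rewrite sv (negbTE (src_side_tgt _ _)).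
by have [] := nz_sub hnz nv bs.
Qed.

Lemma Y_I_compatible a : compatible o (Y_set a) (I_set (src o a)).
Proof.
move=> e Ye It; rewrite /I_of (Y_set_sub Ye) /Y_of.
have -> : src_side o a (tgt o e) by apply: src_side_dir (nz_dir hnz It) (src_side_src _ _).
have /andP[ne _] := Ye; rewrite andbT.
have [_ ->] // := nz_sub hnz ne (dir_between (dir_arrow o e) (dir_trans (nz_dir hnz It) (dir_arrow o a))).
Qed.

(** The copresentation is M(U_a) -> I(tgt a) -> Y -> I(src a). Hom(I(v), I(src a)) is
    one-dimensional if a nonzero path leads from src a to v and zero otherwise; its elements factor
    through I(tgt a) when that path uses [a]. What survives in the cokernel is V_a. *)
Lemma is_tau_inv_U a : is_tau_inv I (thin (U_set a)) (thin (V_set a)).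
Proof.
set s := src o a; set t := tgt o a.
have [f fE] := @thin_can K _ _ _ _ (@U_I_compatible _ _ _ I a).
have [p pE] := @thin_can K _ _ _ _ (@I_Y_compatible _ _ _ I a).
have [j jE] := @thin_can K _ _ _ _ (@Y_I_compatible a).
(* [d v] is the dual basis vector of the path from src a to v, or zero; the quotient map will read
   off the coefficient of phi on it. *)
have [d dE] : exists d : forall v, inj_at I v s, forall v, (d v : 'Hom(_, K^o)) (pgen I s v) = (nz I s v)%:R.
  exact: (@fin_all_exists _ (fun v => inj_at I v s) (fun v d => (d : 'Hom(_, K^o)) (pgen I s v) = (nz I s v)%:R) (fun v => inj_at_delta v s)).
have Is : I_set s s by apply: (nz_refl hnz).
have It : I_set t t by apply: (nz_refl hnz).
have Its : I_set t s by apply: (nz_arrow hnz).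
have Ys := Y_set_src hI a.
have sp v (x : inj_at I v s) : x = ((x : 'Hom(_, K^o)) (pgen I s v) : K) *: d v.
  apply: inj_at_eq; rewrite scale_lfunE dE.
  have [nv|nv] := boolP (nz I s v); first by rewrite [_ *: 1]mulr1.
  by rewrite (inj_at_out x nv) zero_lfunE scale0r.
exists (thin (I_set t)), (thin (Y_set a)), (thin (I_set s)), f, p, j.
exists (fun v (phi : rhom (inj_at I v) (thin (I_set s))) => cf (phi s (d v)) *: thin1 (V_set a) v); split; [split|split].
- by apply: thin_envelope => // [v /andP[]//|]; apply: U_set_tgt.
- apply: (thin_exact fE pE) => v; rewrite /Y_of /I_of /U_of.
    by case: (nz _ _ _); case: src_side.
  by case/andP=> _ /negbTE->; rewrite andbF.
- by apply: thin_envelope => // v /Y_set_sub.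
- move=> v c phi psi chi chiE.
  by rewrite chiE add_lfunE scale_lfunE cfP scalerDl scalerA.
- move=> v u; have [Vv|Vv] := boolP (V_set a v); last first.
    by exists (rzero _ _); rewrite (thin_out0 u Vv) (thin_out0 (thin1 _ v) Vv) scaler0.
  have nv : nz I s v by case/andP: Vv.
  pose lam : 'Hom(inj_at I v s, K^o) :=
    linfun (fun x : 'Hom(subvs_of (peirce I v s), K^o) => cf u *: x (pgen I s v)).
  have lamE (x : inj_at I v s) : lam x = cf u *: (x : 'Hom(_, K^o)) (pgen I s v).
    rewrite /lam linfunE // => c y z.
    by rewrite add_lfunE scale_lfunE scalerDr !scalerA mulrC.
  have [phi phiE] := I_hom hI lam (@inj_at_in_mod v).
  exists phi; rewrite phiE pm_refl lamE dE nv cfZ cf_thin1 Is mulr1 [_ *: 1]mulr1.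
  by rewrite cfK.
- move=> v phi; split=> [e|[psi e]]; last first.
    have [Vv|Vv] := boolP (V_set a v); last by rewrite (thin_out0 (thin1 _ v) Vv) scaler0.
    have /andP[nv sv] := Vv.
    have nt : ~~ nz I t v.
      apply/negP=> /(nz_dir hnz) dt; have := src_side_dir dt sv.
      by rewrite (negbTE (src_side_tgt _ _)).
    have psi0 : psi s (d v) = 0.
      by rewrite I_homE // (inj_at_out (pm _ _ _ _) nt) linear0 cf0 scale0r.
    by rewrite e !comp_lfunE psi0 !linear0 cf0 scale0r.
  have [nv|nv] := boolP (nz I s v); last first.
    exists (rzero _ _) => k; apply/lfunP=> x.
    by rewrite !comp_lfunE rzeroE !linear0 I_homE // (inj_at_out (pm _ _ _ _) nv) linear0 cf0 scale0r.
  have [Vv|Vv] := boolP (V_set a v).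
    exists (rzero _ _) => k; apply/lfunP=> x; rewrite !comp_lfunE rzeroE !linear0 I_homE //.
    have phi0 : cf (phi s (d v)) = 0.
      by move/eqP: e; rewrite scaler_eq0 (negbTE (thin1_neq0 K o Vv)) orbF => /eqP.
    by rewrite (sp v (pm _ _ _ _)) lfunZ cfZ phi0 mulr0 scale0r.
  (* The path from src a to v passes tgt a; a functional there with the coefficient of phi gives the
     factorisation. *)
  have nsv : ~~ src_side o a v by move: Vv; rewrite /V_of nv.
  have [bs bt] : between s v s /\ between s v t.
    split; first exact: between_l.
    by have [|] := @src_side_between _ o a s v; rewrite ?src_side_src ?(negbTE nsv).
  have [_ nt] := nz_sub hnz nv bt.
  pose lam : 'Hom(inj_at I v t, K^o) :=
    linfun (fun x : 'Hom(subvs_of (peirce I v t), K^o) => cf (phi s (d v)) *: x (pgen I t v)).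
  have lamE (x : inj_at I v t) : lam x = cf (phi s (d v)) *: (x : 'Hom(_, K^o)) (pgen I t v).
    rewrite /lam linfunE // => c y z.
    by rewrite add_lfunE scale_lfunE scalerDr !scalerA mulrC.
  have [psi psiE] := I_hom hI lam (@inj_at_in_mod v).
  exists psi => k; apply/lfunP=> x.
  have jp : phi s (d v) = rcomp j (rcomp p psi) s (d v).
    rewrite !rcompE jE pE psiE lamE !cfZ !cf_thin1 Its Ys !mulr1.
    have -> : pm (inj_at I v) s t (d v) = rmap (inj_at I v) a (d v).
      by rewrite -pm_arrow ?dir_refl // pm_refl.
    rewrite inj_at_map //; last exact: (nz_dir hnz).
    by rewrite dE nv [_ *: 1]mulr1 cfK.
  have -> : ((j k \o p k) \o psi k)%VF x = rcomp j (rcomp p psi) k x.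
    by rewrite !comp_lfunE.
  rewrite [LHS]I_homE // [RHS]I_homE // (sp v (pm _ _ _ x)) !lfunZ.
  by rewrite jp.
move=> e phi psi psiE.
rewrite thin_map cfZ cf_thin1.
have [Vt|Vt] := boolP (V_set a (tgt o e)); last first.
  by rewrite (thin_out0 (thin1 _ (tgt o e)) Vt) !scaler0.
congr (_ *: _); rewrite psiE comp_lfunE; have /andP[nt st] := Vt.
have [Vs|Vs] := boolP (V_set a (src o e)).
  rewrite mulr1; congr (cf (phi s _)); apply: inj_at_eq.
  have ns : nz I s (src o e) by case/andP: Vs.
  by rewrite inj_arrow_gen ?dE ?ns ?nt //; apply: (nz_dir hnz).
rewrite mulr0 (inj_at_out (inj_arrow _ _ _ _)) ?linear0 ?cf0 //.
by apply: contra Vs => ns; rewrite /V_of ns side_arrow.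
Qed.

End TauInverse.

(** * Determiners of monomorphisms and epimorphisms *)

Section MinimalDeterminers.
Local Open Scope ring_scope.
Variables (K : fieldType) (n : nat) (o : 'I_n -> bool) (I : {vspace path_alg K o}).
Hypothesis hI : admissible I.
Implicit Types (C D M N P Q R T X Y Z : rep K o) (i j k v w : 'I_n.+1) (a e : 'I_n).
Let hnz := nz_nonzero_paths hI.
Notation thin := (thin K o).
Notation thin1 := (thin1 K o).
Notation U_set := (U_of o (nz I)).
Notation V_set := (V_of o (nz I)).
Notation P_set := (P_of I).

Lemma dsum_projective X Y : projective I X -> projective I Y -> projective I (dsum X Y).
Proof.
move=> [iX pX] [iY pY]; split.
  apply/(in_modP hI) => i j u hn.
  have [p pE] := dsum_fst X Y; have [q qE] := dsum_snd X Y.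
  apply: injective_projections.
    by rewrite -pE pm_hom (((in_modP hI _).1 iX)).
  by rewrite -qE pm_hom (((in_modP hI _).1 iY)).
move=> A B g h iA iB eg.
have [s sE] := dsum_inl X Y; have [t tE] := dsum_inr X Y.
have [h1 h1E] := pX _ _ g (rcomp h s) iA iB eg.
have [h2 h2E] := pY _ _ g (rcomp h t) iA iB eg.
have [h' h'E] := dsum_copair h1 h2.
exists h' => i; apply/comp_lfunP=> -[x y]; rewrite h'E linearD /=.
rewrite -[g i (h1 i x)]comp_lfunE -[g i (h2 i y)]comp_lfunE h1E h2E !rcompE sE tE -linearD.
by congr (h i _); apply: injective_projections; rewrite /= ?addr0 ?add0r.
Qed.

Lemma zero_projective Z : is_zero Z -> projective I Z.
Proof.
move=> zZ; have /is_zeroP z := zZ; split; first exact: in_mod_zero.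
by move=> X Y g h _ _ _; exists (rzero _ _) => i; apply/lfunP=> x; rewrite [x]z !linear0.
Qed.

Lemma kernel_zero M N (f : rhom M N) : mono f -> is_zero (kernel f).
Proof.
move=> mf; apply/is_zeroP=> i x; apply: (mono0 (@kernel_inc_mono _ _ _ _ _ f)).
exact: (mono0 mf) (kernel_comp x).
Qed.

(** The kernel is zero, hence so is its translate, and only projective summands remain. *)
Lemma min_det_mono_projective M N (f : rhom M N) D : mono f -> is_min_det I f D -> projective I D.
Proof.
move=> mf [T [m [P [hT hP _ _ hD]]]].
have zT := is_tau_inv_of_zero hI (kernel_zero mf) hT.
apply: projective_iso (isomorphic_sym hD) _ => //.
apply: dsum_projective; first exact: zero_projective.
elim/big_ind: _ => [|X Y pX pY|k _]; first exact/zero_projective/is_zero_zero_rep.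
  exact: dsum_projective.
by case: (hP k) => -[].
Qed.

Lemma min_det_epi M N (g : rhom M N) a (j : rhom (thin (U_set a)) M) : short_exact j g ->
  [/\ is_min_det I g (thin (V_set a)), is_tau_inv I (kernel g) (thin (V_set a)) &
      forall D, is_min_det I g D -> isomorphic D (thin (V_set a))].
Proof.
move=> jg; have [_ eg _] := jg.
have nf P : ~ almost_factors P g.
  by move=> [R [iota [u [h [_ _ H]]]]]; apply: H => i; rewrite eg subvf.
have tV : is_tau_inv I (kernel g) (thin (V_set a)).
  exact: is_tau_inv_iso (short_exact_iso jg) (is_tau_inv_U hI a).
split=> //.
  exists (thin (V_set a)), 0%N, (fun _ => zero_rep K o); split=> //.
  - by case.
  - by case.
  - by move=> X _ /nf.
  - by rewrite big_ord0; apply: dsum_zero_r; apply: is_zero_zero_rep.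
move=> D [T [m [P [hT hP _ _ hD]]]].
have em : m = 0%N by case: m P hP {hD} => // m P hP; case: (hP ord0) => _ /nf.
subst m; rewrite big_ord0 in hD.
apply: isomorphic_trans hD _; apply: isomorphic_trans (isomorphic_sym (dsum_zero_r _ (is_zero_zero_rep K o))) _.
exact: is_tau_inv_unique hT tV.
Qed.

Lemma V_not_projective a : ~ projective I (thin (V_set a)).
Proof.
move=> [_ pV]; have [f [g [[iU iN iV] [_ eg _] _ [ng _]]]] := almost_split hI a.
have [h' h'E] := pV _ _ g (rid _) iN iV eg.
by apply: ng; exists h'.
Qed.

(* The subrepresentation generated by the space at the target of e, added to a
   maximal U, is all or nothing; at the source of e it adds nothing to U. *)
Lemma maximal_sub_arrow X (U : forall i, {vspace X i}) e x : maximal_sub U ->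
  rmap X e x \in U (tgt o e).
Proof.
move=> [sU nU mU].
pose W v := (U v + limg (pm X (tgt o e) v))%VS.
have sW : stable W.
  move=> a; apply/subvP=> y /memv_imgP[z /memv_addP[z1 hz1 [z2 /memv_imgP[z3 _ ->] ->]] ->].
  rewrite linearD /=; apply: memv_add.
    by apply: (subvP (sU a)); apply: memv_img.
  case: (boolP (dir o (tgt o e) (src o a))) => d.
    by rewrite pm_arrow // memv_img // memvf.
  by rewrite pm0 // linear0 mem0v.
case: (mU W sW) => [v|E|E]; first exact: addvSl.
  by rewrite -E; apply: (subvP (addvSr _ _)); rewrite -{1}(pm_refl (rmap X e x)) memv_img // memvf.
apply: (subvP (sU e)); apply: memv_img.
have : x \in W (src o e) by rewrite E memvf.
rewrite /W; have -> : limg (pm X (tgt o e) (src o e)) = 0%VS; last by rewrite addv0.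
apply/eqP; rewrite -subv0; apply/subvP=> y /memv_imgP[z _ ->].
rewrite pm0 ?mem0v //; apply/negP=> d.
by have /eqP := dir_antisym (dir_arrow o e) d; rewrite (negbTE (src_neq_tgt o e)).
Qed.

Lemma radical_arrow X R (iota : rhom R X) e x : is_radical iota ->
  exists r, rmap X e x = iota (tgt o e) r.
Proof.
move=> [_ H]; have /memv_imgP[r _ ->] : rmap X e x \in limg (iota (tgt o e)).
  by apply/H => U mU; apply: maximal_sub_arrow.
by exists r.
Qed.

Definition R_set k : pred 'I_n.+1 := fun v => nz I k v && (v != k).

Lemma R_P_compatible k : compatible o (R_set k) (P_set k).
Proof.
move=> e /andP[h1 h2] h3; rewrite /P_of h1 /R_set.
have -> : nz I k (tgt o e) by [].
by rewrite eq_sym dir_not_back // (nz_dir hnz).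
Qed.

(** A submodule containing the generator [q] is everything, and any other lies in [W]; so W is the
    only maximal submodule. *)
Lemma P_radical Q k (phi : rhom (thin (P_set k)) Q) (c : rhom (thin (R_set k)) (thin (P_set k))) :
  iso phi -> (forall v u, c v u = cf u *: thin1 (P_set k) v) -> is_radical (rcomp phi c).
Proof.
move=> iphi cE; have [psi [ipsi psiphi phipsi]] := iso_inv iphi.
have Pk : P_set k k by apply: (nz_refl hnz).
have Rk : ~~ R_set k k by rewrite /R_set eqxx andbF.
pose q := phi k (thin1 _ k).
have qn : q != 0.
  by apply/eqP=> /(mono0 (iso_mono iphi)) /eqP; rewrite (negbTE (thin1_neq0 K o Pk)).
have gen v (x : Q v) : exists l : K, x = l *: pm Q k v q.
  exists (cf (psi v x)); rewrite -pm_hom.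
  have [nv|nv] := boolP (P_set k v); last first.
    by rewrite -[LHS](phipsi v) (thin_out0 (psi v x) nv) linear0 cf0 scale0r.
  rewrite pm_thin; first by rewrite -lfunZ cfK phipsi.
    by move=> y /(nz_sub hnz nv)[].
  exact: (nz_dir hnz).
pose iota := rcomp phi c; pose W v := limg (iota v).
have WP v (x : Q v) : x \in W v = (v != k) || (x == 0).
  apply/idP/idP=> [/memv_imgP[r _ ->]|].
    case: (eqVneq v k) r => [->|//] r; apply/eqP.
    by rewrite (thin_out0 r Rk) linear0.
  case/orP=> [vk|/eqP->]; last exact: mem0v.
  apply/memv_imgP; exists (cf (psi v x) *: thin1 _ v); rewrite ?memvf // rcompE cE cfZ cf_thin1.
  have [nv|nv] := boolP (P_set k v); last first.
    by rewrite (thin_out0 (thin1 _ v) nv) scaler0 linear0 -[LHS](phipsi v) (thin_out0 (psi v x) nv) linear0.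
  have -> : R_set k v by rewrite /R_set vk andbT.
  by rewrite mulr1 cfK phipsi.
have sW : stable W.
  move=> a; apply/subvP=> y /memv_imgP[z /memv_imgP[r _ ->] ->].
  by rewrite rhomE memv_img // memvf.
have full (S : forall v, {vspace Q v}) : stable S -> q \in S k -> forall v, S v = fullv.
  move=> sS qS v; apply/vspaceP=> x; rewrite memvf; have [l ->] := gen v x; apply: memvZ.
  case: (boolP (dir o k v)) => d; last by rewrite pm0 // mem0v.
  move: v d {x l}; apply: dir_ind => [|a d IH]; first by rewrite pm_refl.
  by rewrite -pm_arrow //; apply: (subvP (sS a)); apply: memv_img.
have below (S : forall v, {vspace Q v}) : q \notin S k -> forall v, (S v <= W v)%VS.
  move=> qS v; apply/subvP=> x xS; rewrite WP; case: (eqVneq v k) x xS => [->|//] x xS.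
  have [l el] := gen k x; rewrite pm_refl in el.
  case: (eqVneq l 0) el => [-> ->|ln el]; first by rewrite scale0r eqxx.
  case/negP: qS; have -> : q = l^-1 *: x by rewrite el scalerA mulVf // scale1r.
  exact: memvZ.
have nW : ~ (forall v, W v = fullv).
  by move=> /(_ k) e; have := memvf q; rewrite -e WP eqxx (negbTE qn).
split.
  apply: mono_eq0 => v u; rewrite rcompE => /(mono0 (iso_mono iphi)).
  apply: (mono0 (thin_can_mono cE _)) => w.
  by case/andP.
move=> v x; split=> [xW U mU|H].
  have [sU nU maxU] := mU.
  have qU : q \notin U k by apply/negP=> /(full _ sU).
  by case: (maxU W sW (below _ qU)) => // E; rewrite -E.
apply: (H W); split=> // S sS WS.
case: (boolP (q \in S k)) => qS; [right; exact: full|left=> w].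
by apply/eqP; rewrite eqEsubv below // WS.
Qed.

(** Send the generator of P(k) to a lift in N of the socle vector of M(V_a). Its radical dies in
    M(V_a), as no nontrivial path from [k] ends in V_a, so it lands in the image of [f]. *)
Lemma P_almost_factors M N (f : rhom M N) a (p : rhom N (thin (V_set a))) k Q :
  in_mod I N -> short_exact f p -> V_set a k -> (forall v, V_set a v -> dir o v k) ->
  isomorphic (thin (P_set k)) Q -> almost_factors Q f.
Proof.
move=> iN /short_exactP[mf ep pf kp] Vk deep [phi iphi].
have [psi [ipsi psiphi phipsi]] := iso_inv iphi.
have [c cE] := @thin_can K _ _ _ _ (@R_P_compatible k).
have [y ey] := (epi_surj p).1 ep k (thin1 _ k).
have [h hE] := P_hom hI y iN.
have hK : h k (thin1 _ k) = y by rewrite hE ?pm_refl //; apply: (nz_refl hnz).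
pose iota := rcomp phi c.
have [|u uE] := @factor_mono _ _ _ _ _ _ f (rcomp h c) mf.
  move=> v x; apply: kp; rewrite rcompE cE.
  have [Rv|Rv] := boolP (R_set k v); last by rewrite cf_out // scale0r !linear0.
  have /andP[nv vk] := Rv; rewrite !lfunZ hE // pm_hom -ey.
  have [Vv|Vv] := boolP (V_set a v); last by rewrite (thin_out0 (pm _ _ _ _) Vv) scaler0.
  by case/eqP: vk; apply: dir_antisym (deep _ Vv) (nz_dir hnz nv).
exists (thin (R_set k)), iota, u, (rcomp h psi); split.
- exact: P_radical.
- move=> v; apply/lfunP=> x; rewrite !comp_lfunE uE !rcompE.
  by rewrite psiphi.
move=> /(_ k) /subvP /(_ (rcomp h psi k (phi k (thin1 _ k)))).
case/(_ (memv_img _ (memvf _)))/memv_imgP=> x _; rewrite rcompE psiphi hK => e.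
have := thin1_neq0 K o Vk; rewrite ey e pf.
by rewrite eqxx.
Qed.

Lemma dir_first i j : dir o i j -> i != j -> exists a, src o a = i /\ dir o (tgt o a) j.
Proof.
move=> d ne; have := @dir_last _ (fun a => ~~ o a) j i; rewrite dir_neg eq_sym => /(_ d ne).
by case=> a; rewrite src_neg tgt_neg dir_neg => h; exists a.
Qed.

(** The composite X -> N -> M(V_a) kills the radical, so it maps onto the socle S(k). Lifted along
    P(k) -> S(k), it reaches the top of P(k) and therefore splits. *)
Lemma almost_factors_P M N (f : rhom M N) a (p : rhom N (thin (V_set a))) k X :
  short_exact f p -> V_set a k -> (forall v, V_set a v -> dir o v k) ->
  indec_projective I X -> almost_factors X f -> isomorphic X (thin (P_set k)).
Proof.
move=> /short_exactP[mf ep pf kp] Vk deep [[iX pX] dX] [R [iota [u [h [rad hiota nh]]]]].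
have kill e x : p _ (h _ (rmap X e x)) = 0.
  have [r ->] := @radical_arrow _ _ iota e x rad.
  by rewrite ((comp_lfunP _ _ _).1 (hiota (tgt o e))) comp_lfunE pf.
have [i [x phx]] : exists i x, p i (h i x) != 0.
  apply: NNPP => H; apply: nh => i; apply/subvP=> y /memv_imgP[x _ ->].
  have [|z ->] := kp i (h i x); last by rewrite memv_img // memvf.
  by apply/eqP; apply: contra_notT H => ne; exists i, x.
have Vi : V_set a i by apply: contraNT phx => Vi; rewrite (thin_out0 (p _ _) Vi).
have cx : cf (p i (h i x)) != 0.
  by apply: contraNneq phx => e; rewrite -[p i _]cfK e scale0r.
(* A vector at another vertex of M(V_a) survives the first arrow towards [k], whereas the composite
   kills the images of arrows. *)
have ik : i = k.
  apply/eqP; apply: contraT => ne; have [e [es et]] := dir_first (deep _ Vi) ne.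
  subst i; have Vt : V_set a (tgt o e).
    exact: (V_set_convex hnz Vi Vk (dir_between (dir_arrow o e) et)).
  have /eqP := kill e x; rewrite -!rhomE thin_map scaler_eq0 (negbTE cx).
  by rewrite (negbTE (thin1_neq0 K o Vt)).
subst i.
pose chi v : 'Hom(X v, K^o) := linfun (fun x => cf (p v (h v x)) : K^o).
have chiE v y : chi v y = cf (p v (h v y)).
  by rewrite /chi linfunE // => c z w; rewrite !linearP /= cfP.
have [e y /eqP et|s sE] := @thin_hom_out _ _ _ (pred1 k) X chi.
  rewrite !chiE kill cf0; have [/eqP es|//] := boolP (pred1 k (src o e)).
  by case/eqP: (src_neq_tgt o e); rewrite es et.
have comp : compatible o (P_set k) (pred1 k).
  move=> e h1 /eqP h2; have d := dir_arrow o e; rewrite h2 in d.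
  by case/eqP: (src_neq_tgt o e); rewrite (dir_antisym d (nz_dir hnz h1)).
have [q qE] := @thin_can K _ _ _ _ comp.
have Pk : P_set k k by apply: (nz_refl hnz).
have eq_ : epi q.
  apply/epi_surj=> v y; have [/eqP vk|nv] := boolP (pred1 k v); last first.
    by exists 0; rewrite (thin_out0 y nv) linear0.
  subst v; exists (cf y *: thin1 _ k).
  by rewrite qE cfZ cf_thin1 Pk mulr1 cfK.
have ik : in_mod I (thin (pred1 k)).
  apply: thin_in_mod => // v w d H.
  have /eqP -> : pred1 k v by apply: H; apply: between_l.
  have /eqP -> : pred1 k w by apply: H; apply: between_r.
  exact: (nz_refl hnz).
have [g gE] := pX _ _ q s (@P_in_mod _ _ _ _ hI k) ik eq_.
have gx : g k x != 0.
  apply: contraNneq cx => g0; have /comp_lfunP /(_ x) := gE k.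
  rewrite g0 linear0 sE chiE => /esym /eqP.
  by rewrite scaler_eq0 (negbTE (thin1_neq0 K o (b := pred1 k) (k := k) (eqxx k))) orbF.
exists g; apply: split_epi_indec => //; last exact: P_split gx.
by move=> /is_zero_thin /(_ k); rewrite Pk.
Qed.

Lemma min_det_mono M N (f : rhom M N) a (p : rhom N (thin (V_set a))) k :
  in_mod I N -> short_exact f p -> V_set a k -> (forall v, V_set a v -> dir o v k) ->
  is_min_det I f (proj_at I k).
Proof.
move=> iN fp Vk deep; have PQ := proj_at_thin hI k.
have zz := is_zero_zero_rep K o.
exists (zero_rep K o), 1%N, (fun _ => proj_at I k); split.
- by apply/is_tau_inv_iso/is_tau_inv_zero; [apply: is_zero_isomorphic => //; apply: kernel_zero; case: fp|].
- move=> _; split; last exact: (P_almost_factors iN fp Vk deep PQ).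
  by split; [apply: projective_iso PQ (P_projective hI k)|apply: indecomposable_iso PQ (P_indec hI k)].
- by move=> k1 k2 _; rewrite (ord1 k1) (ord1 k2).
- move=> X pX aX; exists ord0.
  exact: isomorphic_trans (almost_factors_P fp Vk deep pX aX) PQ.
rewrite big_ord_recl big_ord0.
by apply: isomorphic_trans (dsum_zero_r _ zz) _; apply: dsum_zero_l.
Qed.

End MinimalDeterminers.

(** * Inverse words and their factors *)

Section Words.
Variables (n : nat) (o : 'I_n -> bool).
Implicit Types (i j k t v w x : 'I_n.+1) (a b e : 'I_n) (s q : seq 'I_n).
Notation walk := (is_walk (src o) (tgt o)).
Notation wend := (word_end (tgt o)).
Notation lwalk := (is_walk (lsrc o) (ltgt o)).
Notation lend := (word_end (ltgt o)).

Definition inv_word s : seq (letter n) := rev [seq (a, true) | a <- s].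

Lemma inv_word_cons b s : inv_word (b :: s) = rcons (inv_word s) (b, true).
Proof. by rewrite /inv_word /= rev_cons. Qed.

Lemma inv_word_rcons b s : inv_word (rcons s b) = (b, true) :: inv_word s.
Proof. by rewrite /inv_word map_rcons rev_rcons. Qed.

Lemma inv_word_inverse s : inverse_word (inv_word s).
Proof. by rewrite /inverse_word /inv_word all_rev all_map; apply/allP. Qed.

Lemma inv_wordK s : rev (unzip1 (inv_word s)) = s.
Proof. by rewrite /unzip1 /inv_word map_rev revK -map_comp map_id. Qed.

Lemma inv_word_walk i s : walk i s -> lwalk (wend i s) (inv_word s) /\ lend (wend i s) (inv_word s) = i.
Proof.
elim: s => [//|c s IH] /= /andP[/eqP h /IH [h1 h2]].
have e : ltgt o (c, true) = wend i s by rewrite /ltgt /= h.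
by rewrite inv_word_cons -cats1 is_walk_cat -word_end_cat /= eqxx e h1 h2.
Qed.

Lemma inverse_walk j (w : seq (letter n)) : inverse_word w -> lwalk j w ->
  exists s, [/\ w = inv_word s, walk (lend j w) s & wend (lend j w) s = j].
Proof.
elim: w => [|[c d] w IH] /=; first by exists [::].
case/andP=> /= -> iw /andP[/eqP h lw]; have [s [es ws ews]] := IH iw lw.
have h' : tgt o c = lend j w := h; rewrite [ltgt _ _]/(src o c).
exists (rcons s c); split; first by rewrite inv_word_rcons es.
  by rewrite -cats1 is_walk_cat /= eqxx h' ws.
by rewrite -cats1 -word_end_cat /= h'.
Qed.

Definition reduced (c d : letter n) := d != linv c.

Lemma inverse_sorted (c : letter n) (w : seq (letter n)) : c.2 -> inverse_word w -> path reduced c w.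
Proof.
elim: w c => //= d w IH c hc /andP[hd hw]; rewrite IH // andbT.
by apply/eqP=> e; move: hd; rewrite e /linv /= hc.
Qed.

Lemma sorted_cross (u v : seq (letter n)) (c : letter n) : inverse_word u -> all (fun d => reduced d c) u ->
  path reduced c v -> sorted reduced (u ++ c :: v).
Proof.
case: u => [//|d u] /= /andP[hd hu] /andP[rd ru] pv.
elim: u d hd hu rd ru => [|d' u IH] d hd /= hu rd ru; first by rewrite rd pv.
case/andP: hu => hd' hu; case/andP: ru => rd' ru; rewrite IH // andbT.
by apply/eqP=> e; move: hd'; rewrite e /linv /= hd.
Qed.

Lemma reduced_adjacent (u v : seq (letter n)) c d : sorted reduced (u ++ c :: d :: v) -> reduced c d.
Proof. by case: u => [/andP[]//|e u] /=; rewrite cat_path => /andP[_ /= /and3P[]]. Qed.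

Lemma prefix_avoid (T : eqType) (p : pred T) (s1 u v : seq T) (c : T) : all p s1 -> ~~ p c ->
  prefix s1 (u ++ c :: v) -> prefix s1 u.
Proof.
move=> + pc; elim: u s1 => [|h u IH] [|x s1] //=.
  by case/andP=> px _ /andP[/eqP e]; rewrite -e px in pc.
by case/andP=> _ ps /andP[-> /=]; apply: IH.
Qed.

(** A factor whose letters all satisfy [p] cannot cover [c]. This confines inverted relations to one
    side of the single direct letter of N_a. *)
Lemma infix_avoid (T : eqType) (p : pred T) (s1 u v : seq T) (c : T) : all p s1 -> s1 != [::] -> ~~ p c ->
  infix s1 (u ++ c :: v) -> infix s1 u || infix s1 v.
Proof.
move=> ps s0 pc; elim: u => [|h u IH].
  rewrite cat0s infix_consl => /orP[|->]; last by rewrite orbT.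
  by case: s1 ps s0 => //= x s1 /andP[px _] _ /andP[/eqP e]; rewrite -e px in pc.
rewrite cat_cons !infix_consl => /orP[h1|/IH /orP[->|->]]; rewrite ?orbT //.
by have -> := @prefix_avoid _ p s1 (h :: u) v c ps pc h1.
Qed.

Lemma infix_count (T : eqType) (p : pred T) (s1 s2 : seq T) : infix s1 s2 -> (count p s1 <= count p s2)%N.
Proof. by case/infixP=> x [y ->]; rewrite !count_cat; lia. Qed.

Lemma inverse_count (w : seq (letter n)) : inverse_word w -> count (fun c => ~~ c.2) w = 0%N.
Proof. by move=> h; apply/eqP; rewrite -leqn0 leqNgt -has_count -all_predC; apply: sub_all h => c /=; rewrite negbK. Qed.

Lemma direct_count s : count (fun c : letter n => ~~ c.2) [seq (a, false) | a <- s] = size s.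
Proof. by rewrite count_map -[RHS]count_predT; apply: eq_count. Qed.

Lemma direct_infix s (w : seq (letter n)) : infix [seq (a, false) | a <- s] w ->
  (size s <= count (fun c => ~~ c.2) w)%N.
Proof. by move=> h; rewrite -direct_count; apply: infix_count. Qed.

Lemma walk_mem i s a : walk i s -> a \in s -> dir o i (src o a) /\ dir o (tgt o a) (wend i s).
Proof.
elim: s => //= c s IH /andP[/eqP h ws]; rewrite inE => /orP[/eqP->|/(IH ws)[h1 h2]].
  by rewrite h dir_refl; split=> //; apply: walk_dir.
by split=> //; apply: dir_trans h2 _; rewrite -h; apply: dir_arrow.
Qed.

Lemma walk_start i j s : s != [::] -> walk i s -> walk j s -> i = j.
Proof.
elim: s i j => //= c s IH i j _; case: s IH => [_ /=|d s IH] /andP[/eqP h1 w1] /andP[/eqP h2 w2].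
  by rewrite -h1 -h2.
exact: IH w1 w2.
Qed.

End Words.

(** * The strings U_a, N_a, V_a and their supports *)

Section Strings.
Variables (K : fieldType) (n : nat) (o : 'I_n -> bool) (I : {vspace path_alg K o}).
Hypothesis hI : admissible I.
Implicit Types (i j k t v w x : 'I_n.+1) (a b e : 'I_n) (s q : seq 'I_n).
Let hnz := nz_nonzero_paths hI.
Notation U_set := (U_of o (nz I)).
Notation V_set := (V_of o (nz I)).
Notation walk := (is_walk (src o) (tgt o)).
Notation wend := (word_end (tgt o)).
Notation lwalk := (is_walk (lsrc o) (ltgt o)).
Notation lend := (word_end (ltgt o)).

Lemma inv_infix_nz i s (p : qpath o) : walk i s -> nz I i (wend i s) -> pelt K p \in I ->
  ~~ infix (inv_word (pword p)) (inv_word s).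
Proof.
move=> ws ns pI; apply/negP=> /infixP[x [y e]].
have p2 : (1 < size (pword p))%N by rewrite ltnNge; apply/negP=> h; have := nz_short hI (p := p) h; rewrite pI.
have es : s = rev [seq c.1 | c <- y] ++ pword p ++ rev [seq c.1 | c <- x].
  have := congr1 (fun w : seq (letter n) => rev [seq c.1 | c <- w]) e.
  by rewrite !map_cat !rev_cat -/(unzip1 _) !inv_wordK catA.
move: ws ns; rewrite es !is_walk_cat -!word_end_cat => /and3P[w1 w2 w3] ns.
have e1 : wend i (rev [seq c.1 | c <- x]) = pstart p.
  apply: (walk_start _ w2 (qpath_walk p)).
  by case: (pword p) p2.
have d3 := walk_dir w3; have d2 := walk_dir w2; have d1 := walk_dir w1.
rewrite e1 in d1 d2 d3 ns; move: d1 d2 ns; rewrite -/(pend p) => d1 d2 ns.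
have [_ n1] := nz_sub hnz ns (dir_between d3 (dir_trans d2 d1)).
have [n2 _] := nz_sub hnz n1 (dir_between d2 d1).
by move: pI; rewrite nz_pelt n2.
Qed.

Lemma inv_pelt (p : qpath o) :
  rev (map (@linv n) [seq (a, false) | a <- pword p]) = inv_word (pword p).
Proof. by rewrite /inv_word -map_comp. Qed.

Lemma inv_word_string i s : walk i s -> nz I i (wend i s) -> is_string I (wend i s) (inv_word s).
Proof.
move=> ws ns; have [h1 h2] := inv_word_walk ws; have iw := inv_word_inverse s.
apply/and3P; split=> //.
  by case: (inv_word s) iw => //= c w /andP[hc hw]; exact: (inverse_sorted hc hw).
apply/forallP=> p; apply/implyP=> pI /=; rewrite inv_pelt (inv_infix_nz ws ns pI) andbT.
apply/negP=> /direct_infix; rewrite inverse_count // leqn0 => /eqP h.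
by have := nz_short hI (p := p); rewrite h pI => /(_ isT).
Qed.

(** A relation has length at least two, so it cannot occur directly in a word with one direct
    letter; its inverse would lie within one of the two inverse parts, which come from nonzero
    paths. *)
Lemma hook_string a t q s : walk t q -> wend t q = tgt o a -> walk (src o a) s ->
  U_set a t -> V_set a (wend (src o a) s) ->
  is_string I (wend (src o a) s) (inv_word q ++ (a, false) :: inv_word s).
Proof.
move=> wq eq_ ws /andP[nq sq] /andP[ns ss].
have [w1 w2] := inv_word_walk wq; have [w3 w4] := inv_word_walk ws.
have iq := inv_word_inverse q; have is_ := inv_word_inverse s.
have aq : a \notin q.
  by apply/negP=> /(walk_mem wq)[/src_side_dir /(_ (src_side_src _ _))]; rewrite (negbTE sq).
have as_ : a \notin s.
  by apply/negP=> /(walk_mem ws)[_ /src_side_dir /(_ ss)]; rewrite (negbTE (src_side_tgt _ _)).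
apply/and3P; split.
- rewrite is_walk_cat; apply/andP; split; first by rewrite eq_ in w1.
  by apply/andP; split=> //; rewrite w4.
- apply: sorted_cross => //.
    apply/allP=> c; rewrite mem_rev => /mapP[b bq ->]; apply/eqP=> -[e].
    by rewrite e bq in aq.
  have am c : c \in inv_word s -> reduced (a, false) c.
    rewrite mem_rev => /mapP[b bs ->]; apply/eqP=> -[e].
    by rewrite -e bs in as_.
  case: (inv_word s) is_ am => //= c w /andP[hc hw] am.
  by rewrite inverse_sorted // andbT; apply: am; rewrite mem_head.
apply/forallP=> p; apply/implyP=> pI /=; rewrite inv_pelt.
have p2 : (1 < size (pword p))%N by rewrite ltnNge; apply/negP=> h; have := nz_short hI (p := p) h; rewrite pI.
apply/andP; split.
  by apply/negP=> /direct_infix; rewrite count_cat /= !inverse_count //; lia.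
apply/negP=> /(@infix_avoid _ (fun c : letter n => c.2)).
case/(_ (inv_word_inverse _) _ isT)/orP.
- by rewrite -size_eq0 size_rev size_map; lia.
- by rewrite -eq_ in nq; rewrite (negbTE (inv_infix_nz wq nq pI)).
- by rewrite (negbTE (inv_infix_nz ws ns pI)).
Qed.

Lemma string_infix_nz j (w : seq (letter n)) i s : is_string I j w -> walk i s ->
  infix (inv_word s) w -> nz I i (wend i s).
Proof.
move=> /and3P[_ _ /forallP H] ws inf; apply: contraT => ns.
have [p [e1 e2]] := walk_qpath ws.
have := H p; rewrite nz_pelt /pend e1 e2 ns implyTb => /andP[_].
by rewrite -e2 inv_pelt e2 inf.
Qed.

Lemma src_side_chain a k x : src_side o a k -> src_side o a x ->
  between (src o a) k x \/ between (src o a) x k.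
Proof. by rewrite /src_side /between src_val; case: (o a) => /=; lia. Qed.

Lemma tgt_side_chain a k x : ~~ src_side o a k -> ~~ src_side o a x ->
  between (tgt o a) k x \/ between (tgt o a) x k.
Proof. by rewrite /src_side /between tgt_val; case: (o a) => /=; lia. Qed.

Lemma UNV_words a u k (v : seq (letter n)) : is_UNV I a u k v -> exists t q s,
  [/\ u = inv_word q /\ v = inv_word s, walk t q /\ wend t q = tgt o a,
      walk (src o a) s /\ wend (src o a) s = k,
      (U_set a t /\ forall x, U_set a x -> dir o t x) &
      (V_set a k /\ forall x, V_set a x -> dir o x k)].
Proof.
move=> [[stru iu] [strv iv] strw deep peak].
have /and3P[walkw sortw _] := strw.
move: (walkw); rewrite is_walk_cat => /andP[wu /andP[/eqP vs wv]].
have {wu}wu : lwalk (tgt o a) u := wu.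
have {vs}vs : src o a = lend k v := vs.
have [q [eu wq eq_]] := inverse_walk iu wu.
have [s [ev ws es]] := inverse_walk iv wv.
rewrite -vs in ws es; set t := lend (tgt o a) u in wq eq_.
have nq : nz I t (tgt o a) by rewrite -eq_; apply: (string_infix_nz stru) => //; rewrite eu infix_refl.
have ns : nz I (src o a) k by rewrite -es; apply: (string_infix_nz strv) => //; rewrite ev infix_refl.
(* A path to [tgt o a] through [a] ends with [a], so the inverse of [a] would stand next to [a] in
   the word. *)
have aq : a \notin q.
  apply/negP=> aq; have [d1 d2] := walk_mem wq aq; rewrite eq_ in d2.
  have [q' [wq' eq']] := dir_walk d1.
  have wq2 : walk t (a :: q') by rewrite /= eq' eqxx.
  have e : q = a :: q' by apply: (walk_unique wq wq2); rewrite eq_.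
  move: sortw; rewrite eu e inv_word_cons cat_rcons => /reduced_adjacent.
  by rewrite /reduced eqxx.
have as_ : a \notin s.
  apply/negP=> as_; have [d1 d2] := walk_mem ws as_; rewrite es in d2.
  have [s' [ws' es']] := dir_walk d2.
  have ws2 : walk (src o a) (rcons s' a) by rewrite -cats1 is_walk_cat /= eqxx ws'.
  have e : s = rcons s' a by apply: (walk_unique ws ws2); rewrite es -cats1 -word_end_cat /= es'.
  move: sortw; rewrite ev e inv_word_rcons => /reduced_adjacent.
  by rewrite /reduced eqxx.
have walk_through i j x r e : walk i r -> wend i r = j -> dir o i (src o e) -> dir o (tgt o e) j -> e \in r.
  move=> wr er d1 d2; have [r1 [w1 e1]] := dir_walk d1; have [r2 [w2 e2]] := dir_walk d2.
  have w3 : walk i (r2 ++ e :: r1).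
    by rewrite is_walk_cat /= w2 e1 eqxx w1.
  have -> : r = r2 ++ e :: r1 by apply: (walk_unique wr w3); rewrite er -word_end_cat /= e2.
  by rewrite mem_cat mem_head orbT.
have Ut : U_set a t.
  rewrite /U_of nq andTb; apply: contra aq => st.
  have [|bs bt] := @src_side_between _ o a t (tgt o a).
    by rewrite st (negbTE (src_side_tgt _ _)).
  have [d _] := dir_sub (nz_dir hnz nq) bs.
  by apply: walk_through wq eq_ d (dir_refl _ _); exact: t.
have Vk : V_set a k.
  rewrite /V_of ns andTb; apply: contraNT as_ => sk.
  have [|_ bt] := @src_side_between _ o a (src o a) k.
    by rewrite src_side_src (negbTE sk).
  have [_ d] := dir_sub (nz_dir hnz ns) bt.
  by apply: walk_through ws es (dir_refl _ _) d; exact: t.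
exists t, q, s; split=> //; split=> // x.
  move=> Ux; have /andP[nx sx] := Ux; have /andP[_ st] := Ut.
  case: (tgt_side_chain st sx) => bt.
    by case: (dir_sub (nz_dir hnz nq) (x := x)); rewrite // between_sym.
  rewrite between_sym in bt; have [dxt dt] := dir_sub (nz_dir hnz nx) bt.
  case: (eqVneq x t) => [->|ne]; first exact: dir_refl.
  have [b [tb db]] := dir_last dxt ne.
  have db' : dir o (src o b) (tgt o a) by apply: dir_trans dt; rewrite -tb dir_arrow.
  have [_ nb] := nz_sub hnz nx (dir_between db db').
  have Ub : U_set a (src o b).
    by rewrite /U_of nb; apply: contra sx; apply: src_side_dir db.
  have wqb : walk (src o b) (rcons q b) by rewrite -cats1 is_walk_cat /= eqxx tb wq.
  have eqb : wend (src o b) (rcons q b) = tgt o a by rewrite -cats1 -word_end_cat /= tb.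
  have := hook_string wqb eqb ws Ub; rewrite es => /(_ Vk).
  by have /forallP /(_ b) := peak; rewrite inv_word_rcons eu ev => /negP h /h.
move=> Vx; have /andP[nx sx] := Vx; have /andP[_ sk] := Vk.
case: (src_side_chain sk sx) => bt; first by case: (dir_sub (nz_dir hnz ns) bt).
have [dsk dkx] := dir_sub (nz_dir hnz nx) bt.
case: (eqVneq k x) => [->|ne]; first exact: dir_refl.
have [b [sb db]] := dir_first dkx ne.
have db' : dir o (src o a) (tgt o b) by apply: dir_trans dsk _; rewrite -sb dir_arrow.
have [nb _] := nz_sub hnz nx (dir_between db' db).
have Vb : V_set a (tgt o b) by rewrite /V_of nb (src_side_dir db sx).
have wsb : walk (src o a) (b :: s) by rewrite /= es sb eqxx.
have := hook_string wq eq_ wsb Ut Vb; rewrite inv_word_cons -rcons_cons -rcons_cat -eu -ev.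
by have /forallP /(_ b) := deep; rewrite sb eqxx implyTb => /negP h /h.
Qed.

Lemma UNV_exists a : exists u k (v : seq (letter n)), is_UNV I a u k v.
Proof.
have [k Vk deep] := V_set_deep hnz a.
have [t Ut peak] : exists2 t, U_set a t & forall x, U_set a x -> dir o t x.
  have [t] := V_set_deep (nonzero_paths_neg hnz) a.
  by rewrite V_set_neg => Ut h; exists t => // x; rewrite -V_set_neg => /h; rewrite dir_neg.
have /andP[nk sk] := Vk; have /andP[nt st] := Ut.
have [s [ws es]] := dir_walk (nz_dir hnz nk).
have [q [wq eq_]] := dir_walk (nz_dir hnz nt).
exists (inv_word q), k, (inv_word s); split.
- split; last exact: inv_word_inverse.
  by rewrite -eq_; apply: inv_word_string; rewrite ?eq_.
- split; last exact: inv_word_inverse.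
  by rewrite -es; apply: inv_word_string; rewrite ?es.
- by have := hook_string wq eq_ ws Ut; rewrite es; apply.
(* The prolonged path is nonzero. Either it stays in V_a beyond its last vertex, or [b] is [a], next
   to its own inverse in the word. *)
- apply/forallP=> b; apply/implyP=> /eqP sb; apply/negP=> str.
  have eb : wend (src o a) (b :: s) = tgt o b by [].
  have wsb : walk (src o a) (b :: s) by rewrite /= es sb eqxx.
  have nb : nz I (src o a) (tgt o b).
    rewrite -eb; apply: (string_infix_nz str) => //.
    apply/infixP; exists (rcons (inv_word q) (a, false)), [::].
    by rewrite cats0 inv_word_cons cat_rcons rcons_cat rcons_cons.
  have [sd|sd] := boolP (src_side o a (tgt o b)).
    have db : dir o (tgt o b) (src o b) by rewrite sb; apply: deep; rewrite /V_of nb sd.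
    by case/eqP: (src_neq_tgt o b); apply: dir_antisym (dir_arrow o b) db.
  have eba : b = a by apply: side_leave sd; rewrite sb.
  subst b; have /= /andP[/eqP _ _] := wsb.
  have s0 : s = [::] by apply: (walk_unique ws (t := [::])) => //=; rewrite es -sb.
  move: str => /and3P[_ + _]; rewrite s0 -cats1 -catA /= => /reduced_adjacent.
  by rewrite /reduced eqxx.
apply/forallP=> b; apply/negP=> str.
have /and3P[/andP[/eqP tb _] _ _] := str.
have {}tb : tgt o b = t.
  rewrite [LHS]tb -word_end_cat /=.
  by have [_] := inv_word_walk wq; rewrite eq_.
have wqb : walk (src o b) (rcons q b) by rewrite -cats1 is_walk_cat /= eqxx tb wq.
have eqb : wend (src o b) (rcons q b) = tgt o a by rewrite -cats1 -word_end_cat /= tb.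
have nb : nz I (src o b) (tgt o a).
  rewrite -eqb; apply: (string_infix_nz str) => //.
  by rewrite inv_word_rcons -cat_cons; apply/infixP; exists [::], ((a, false) :: inv_word s).
have [sd|sd] := boolP (src_side o a (src o b)); last first.
  have db : dir o (tgt o b) (src o b) by rewrite tb; apply: peak; rewrite /U_of nb sd.
  by case/eqP: (src_neq_tgt o b); apply: dir_antisym (dir_arrow o b) db.
have eba : b = a by apply: side_leave sd _; rewrite tb.
subst b; have q0 : q = [::] by apply: (walk_unique wq (t := [::])) => //=; rewrite eq_.
move: str => /and3P[_ + _]; rewrite q0 /= => /andP[+ _].
by rewrite eqxx.
Qed.

Lemma U_set_between_end a t : U_set a t -> (forall x, U_set a x -> dir o t x) ->
  forall x, between (tgt o a) t x = U_set a x.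
Proof.
move=> Ut h x; apply/idP/idP=> [b|Ux].
  by apply: (U_set_between hI Ut); rewrite between_sym.
have /andP[nx _] := Ux; rewrite between_sym.
exact: dir_between (h _ Ux) (nz_dir hnz nx).
Qed.

Lemma V_set_between_end a k : V_set a k -> (forall x, V_set a x -> dir o x k) ->
  forall x, between k (src o a) x = V_set a x.
Proof.
move=> Vk h x; apply/idP/idP=> [b|Vx].
  by apply: (V_set_dir hnz Vk); rewrite between_sym.
have /andP[nx _] := Vx; rewrite between_sym.
exact: dir_between (nz_dir hnz nx) (h _ Vx).
Qed.

Lemma between_split a k t x : src_side o a k -> ~~ src_side o a t ->
  between k t x = between (tgt o a) t x || between k (src o a) x.
Proof. by rewrite /src_side /between src_val tgt_val; case: (o a) => /=; lia. Qed.

(** String modules occur in the types of the maps of the theorem; with equalities, the results on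
    thin modules carry over by rewriting. *)
Lemma UNV_reps a u k (v : seq (letter n)) : is_UNV I a u k v ->
  [/\ U_rep K o a u = thin K o (U_set a), N_rep K o a u k v = thin K o (N_of I a) &
      V_rep K o k v = thin K o (V_set a)].
Proof.
move=> /UNV_words[t [q [s [[-> ->] [wq eq_] [ws es] [Ut hU] [Vk hV]]]]].
have [_ eu] := inv_word_walk wq; rewrite eq_ in eu.
have [_ ev] := inv_word_walk ws; rewrite es in ev.
have /andP[_ sk] := Vk; have /andP[_ st] := Ut.
split; apply: thin_eq => x.
- by rewrite eu U_set_between_end.
- rewrite -word_end_cat /= [ltgt _ _]/(tgt o a) eu /N_of.
  by rewrite (between_split _ sk st) U_set_between_end // V_set_between_end.
- by rewrite ev V_set_between_end.
Qed.

Lemma UNV_unique a u k (v : seq (letter n)) u' k' (v' : seq (letter n)) : is_UNV I a u k v -> is_UNV I a u' k' v' ->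
  [/\ u = u', k = k' & v = v'].
Proof.
move=> /UNV_words[t [q [s [[-> ->] [wq eq_] [ws es] [Ut hU] [Vk hV]]]]].
move=> /UNV_words[t' [q' [s' [[-> ->] [wq' eq_'] [ws' es'] [Ut' hU'] [Vk' hV']]]]].
have et : t = t' by apply: dir_antisym (hU _ Ut') (hU' _ Ut).
have ek : k = k' by apply: dir_antisym (hV' _ Vk) (hV _ Vk').
rewrite -et in wq' eq_'; split=> //.
  by rewrite (walk_unique wq wq') // eq_ eq_'.
by rewrite (walk_unique ws ws') // es es'.
Qed.

(** The first vertex of V_a is [src o a]. A second arrow from that vertex would have its target in
    V_a, but outside its own set. *)
Lemma V_set_inj a a' : (forall v, V_set a v = V_set a' v) -> a = a'.
Proof.
move=> E; have es : src o a = src o a'.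
  have /andP[n1 _] : V_set a' (src o a) by rewrite -E (V_set_src hnz).
  have /andP[n2 _] : V_set a (src o a') by rewrite E (V_set_src hnz).
  exact: dir_antisym (nz_dir hnz n2) (nz_dir hnz n1).
apply/esym/(@src_side_cross _ o); rewrite -es src_side_src.
have : V_set a (tgt o a') = false by rewrite E /V_of (negbTE (src_side_tgt _ _)) andbF.
by rewrite /V_of es (nz_arrow hnz) /= => ->.
Qed.

End Strings.

(** * The equivalences *)

Lemma all_iff_star (A B C : Prop) :
  (A -> B) -> (A -> C) -> (B -> A) -> (C -> A) -> [<-> A; B; C].
Proof. by move=> AB AC BA CA; tfae => [/AB|/BA/AC|/CA]. Qed.

Section Equivalences.
Local Open Scope ring_scope.
Variables (K : fieldType) (n : nat) (o : 'I_n -> bool) (I : {vspace path_alg K o}).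
Hypothesis hI : admissible I.
Implicit Types (D M N Q X Y : rep K o) (i j k t v : 'I_n.+1) (a : 'I_n).
Let hnz := nz_nonzero_paths hI.
Notation thin := (thin K o).
Notation U_set := (U_of o (nz I)).
Notation V_set := (V_of o (nz I)).

(** The spaces of Q have dimension at most one, so a kernel is fixed by its support. Two exact
    sequences with the same middle term and kernel support are compared through this. *)
Lemma thin_kernel b c Q Y (J : rhom Q (thin c)) (j : rhom (thin b) Q) (g : rhom Q Y) :
  iso J -> short_exact j g -> forall v x, g v x = 0 <-> b v \/ x = 0.
Proof.
move=> jJ /short_exactP[mj eg gj jg] v x; split=> [/jg[u ->]|[bv|->]]; last exact: linear0.
  have [bv|bv] := boolP (b v); first by left.
  by right; rewrite (thin_out0 u bv) linear0.
pose y := J v (j v (thin1 K o b v)).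
have yn : y != 0.
  by apply/eqP=> /(mono0 (iso_mono jJ)) /(mono0 mj) /eqP; rewrite (negbTE (thin1_neq0 K o bv)).
have cy : cf y != 0 by apply: contraNneq yn => e; rewrite -[y]cfK e scale0r.
suff -> : x = (cf (J v x) / cf y) *: j v (thin1 K o b v) by rewrite lfunZ gj scaler0.
apply: ((mono_injP J).1 (iso_mono jJ) v); rewrite lfunZ -/y.
by rewrite -[LHS]cfK -{2}(cfK y) scalerA divfK.
Qed.

(** With [min_det_nonprojective_epi], projectivity of the determiner decides between the two kinds
    of irreducible maps. *)
Lemma min_det_projective_mono M N (f : rhom M N) D : indecomposable M -> indecomposable N ->
  irreducible I f -> is_min_det I f D -> projective I D -> mono f.
Proof.
move=> dM dN irf mD pD; have [//|ef] := irreducible_mono_or_epi irf.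
have [a [j jf]] := irreducible_epi_kernel hI dM dN irf ef.
have [_ _ H] := min_det_epi hI jf.
by case: (V_not_projective hI (projective_iso (H _ mD) pD)).
Qed.

Lemma min_det_nonprojective_epi M N (f : rhom M N) D :
  irreducible I f -> is_min_det I f D -> ~ projective I D -> epi f.
Proof.
move=> irf mD nD; have [mf|//] := irreducible_mono_or_epi irf.
by case: nD; apply: min_det_mono_projective mf mD.
Qed.

Lemma proj_at_projective i : projective I (proj_at I i).
Proof. exact: projective_iso (proj_at_thin hI i) (P_projective hI i). Qed.

Lemma inj_at_indec i : indecomposable (inj_at I i).
Proof.
have [J [jJ _]] := inj_at_thin hI i.
exact: indecomposable_iso (isomorphic_sym (ex_intro _ J jJ)) (I_indec hI i).
Qed.

Lemma string_seq_exists a u k (v : seq (letter n)) : is_UNV I a u k v ->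
  exists (f2 : rhom (U_rep K o a u) (N_rep K o a u k v))
         (g2 : rhom (N_rep K o a u k v) (V_rep K o k v)),
    [/\ almost_split_seq I f2 g2,
        forall j, V_set a j -> (forall x, V_set a x -> dir o x j) -> is_min_det I f2 (proj_at I j),
        is_min_det I g2 (V_rep K o k v) & is_tau_inv I (kernel g2) (V_rep K o k v)].
Proof.
move=> /(UNV_reps hI)[-> -> ->]; have [f [g fg]] := almost_split hI a.
have [_ ex _ _] := fg; have [md ti _] := min_det_epi hI ex.
exists f, g; split=> // j Vj deep.
by apply: (min_det_mono hI _ ex) => //; apply: N_in_mod.
Qed.

Lemma string_seq_unique a u k (v : seq (letter n))
    (f g : rhom (U_rep K o a u) (N_rep K o a u k v))
    (p q : rhom (N_rep K o a u k v) (V_rep K o k v)) : is_UNV I a u k v ->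
  short_exact f p -> short_exact g q -> iso_sequences f p g q.
Proof.
move=> /(UNV_reps hI) [eU eN eV]; move: f g p q; rewrite eU eN eV => f g p q fp gq.
have [v' x|r [t [ir it rE tE]]] := short_exact_unique fp gq.
  by rewrite (thin_kernel (iso_id _) fp) (thin_kernel (iso_id _) gq).
exists r, (rid _), t; split=> //; first exact: iso_id.
move=> i; split; apply/lfunP=> x; rewrite !comp_lfunE !id_lfunE; first by rewrite rE.
by rewrite tE.
Qed.

Lemma injective_source_unique a i Y Y' (g : rhom (inj_at I (tgt o a)) Y) (g' : rhom (inj_at I i) Y')
    (j : rhom (thin (U_set a)) (inj_at I (tgt o a))) (j' : rhom (thin (U_set a)) (inj_at I i)) :
  short_exact j g -> short_exact j' g' -> iso_morphisms g g'.
Proof.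
move=> jg jg'; have [mj' _ _] := jg'; have [J [jJ _]] := inj_at_thin hI i.
have Ut := U_set_tgt hI a.
(* [tgt o a] lies in the support of I(i), and a nonzero vector there survives the path to the socle
   vertex [i], which puts [i] in U_a. Paths in both directions force equality. *)
have ei : i = tgt o a.
  pose F := rcomp J j'; pose y := F _ (thin1 K o (U_set a) (tgt o a)).
  have yn : y != 0.
    apply/eqP; rewrite /y rcompE => /(mono0 (iso_mono jJ)) /(mono0 mj') /eqP.
    by rewrite (negbTE (thin1_neq0 K o Ut)).
  have nt : nz I (tgt o a) i by apply: contraNT yn => nt; rewrite (thin_out0 y nt).
  have Ui : U_set a i.
    apply: contraNT yn => Ui; rewrite /y I_homE //.
    by rewrite (thin_out0 (pm _ _ _ _) Ui) linear0 cf0 scale0r.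
  by case/andP: Ui => ni _; apply: dir_antisym (nz_dir hnz ni) (nz_dir hnz nt).
subst i.
have [v x|_ [t [_ it _ tE]]] := short_exact_unique jg jg'.
  by rewrite (thin_kernel jJ jg) (thin_kernel jJ jg').
exists (rid _), t; split=> //; first exact: iso_id.
by move=> i; apply/lfunP=> x; rewrite !comp_lfunE id_lfunE tE.
Qed.

Lemma injective_epi_exists a : exists (Y : rep K o) (g : rhom (inj_at I (tgt o a)) Y)
    (j : rhom (thin (U_set a)) (inj_at I (tgt o a))),
  [/\ indecomposable Y, irreducible I g & short_exact j g].
Proof.
have [J [jJ _]] := inj_at_thin hI (tgt o a); have [J' [jJ' J'J JJ']] := iso_inv jJ.
have [g [irg [j /short_exactP[mj eg gj jg]]]] := I_Y_exists hI a.
exists (thin (Y_of I a)), (rcomp g J), (rcomp J' j); split.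
- exact: Y_indec.
- apply: irreducible_iso irg; exists J', (rid _); split=> //; first exact: iso_id.
  by move=> i; apply/lfunP=> x; rewrite !comp_lfunE id_lfunE JJ'.
apply/short_exactP; split.
- apply: mono_eq0 => i x; rewrite rcompE => /(mono0 (iso_mono jJ')).
  exact: mono0 mj.
- apply/epi_surj=> i y; have [x ->] := (epi_surj g).1 eg i y.
  by exists (J' i x); rewrite rcompE JJ'.
- by move=> i x; rewrite !rcompE JJ' gj.
by move=> i y; rewrite rcompE => /jg[x ex]; exists x; rewrite rcompE -ex J'J.
Qed.

Lemma projective_mono_exists a : exists (X : rep K o) (f : rhom X (proj_at I (src o a)))
    (p : rhom (proj_at I (src o a)) (thin (V_set a))),
  [/\ indecomposable X, irreducible I f & short_exact f p].
Proof.
have [J jJ] := proj_at_thin hI (src o a); have [J' [jJ' J'J JJ']] := iso_inv jJ.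
have [f [irf [p /short_exactP[mf ep pf fp]]]] := X_P_exists hI a.
exists (thin (X_of I a)), (rcomp J f), (rcomp p J'); split.
- exact: X_indec.
- apply: irreducible_iso irf; exists (rid _), J; split=> //; first exact: iso_id.
  by move=> i; apply/lfunP=> x; rewrite !comp_lfunE id_lfunE.
apply/short_exactP; split.
- apply: mono_eq0 => i x; rewrite rcompE => /(mono0 (iso_mono jJ)).
  exact: mono0 mf.
- apply/epi_surj=> i y; have [x ->] := (epi_surj p).1 ep i y.
  by exists (J i x); rewrite rcompE J'J.
- by move=> i x; rewrite !rcompE J'J pf.
by move=> i y; rewrite rcompE => /fp[x ex]; exists x; rewrite rcompE -ex JJ'.
Qed.

End Equivalences.

Theorem theorem3p5 (K : fieldType) (n : nat) (o : 'I_n -> bool)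
    (I : {vspace path_alg K o}) (hI : admissible I) :
  (forall (M N : rep K o) (f : rhom M N),
     indecomposable M -> indecomposable N -> irreducible I f ->
     [<-> mono f;
          exists (i j : 'I_n.+1) (X : rep K o) (f1 : rhom X (proj_at I i)),
            [/\ indecomposable X, irreducible I f1, mono f1,
                is_min_det I f (proj_at I j) & is_min_det I f1 (proj_at I j)];
          exists (a : 'I_n) (u : seq (letter n)) (k : 'I_n.+1) (v : seq (letter n))
                 (f2 : rhom (U_rep K o a u) (N_rep K o a u k v))
                 (p2 : rhom (N_rep K o a u k v) (V_rep K o k v)) (j : 'I_n.+1),
            [/\ is_UNV I a u k v, almost_split_seq I f2 p2,
                is_min_det I f (proj_at I j) & is_min_det I f2 (proj_at I j)]])
  /\
  (forall (M N : rep K o) (g : rhom M N),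
     indecomposable M -> indecomposable N -> irreducible I g ->
     [<-> epi g;
          exists (i : 'I_n.+1) (Y : rep K o) (g1 : rhom (inj_at I i) Y),
            det_by_injective g g1 /\
            forall (i' : 'I_n.+1) (Y' : rep K o) (g1' : rhom (inj_at I i') Y'),
              det_by_injective g g1' -> iso_morphisms g1 g1';
          exists (a : 'I_n) (u : seq (letter n)) (k : 'I_n.+1) (v : seq (letter n))
                 (f2 : rhom (U_rep K o a u) (N_rep K o a u k v))
                 (g2 : rhom (N_rep K o a u k v) (V_rep K o k v)),
            det_by_string_seq I g f2 g2 /\
            forall (a' : 'I_n) (u' : seq (letter n)) (k' : 'I_n.+1)
                   (v' : seq (letter n))
                   (f2' : rhom (U_rep K o a' u') (N_rep K o a' u' k' v'))
                   (g2' : rhom (N_rep K o a' u' k' v') (V_rep K o k' v')),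
              det_by_string_seq I g f2' g2' -> iso_sequences f2 g2 f2' g2']).
Proof.
split=> [M N f dM dN irf|M N g dM dN irg].
  have iN : in_mod I N by case: irf.
  have H : mono f -> exists a k (p : rhom N (thin K o (V_of o (nz I) a))),
      [/\ short_exact f p, V_of o (nz I) a k & forall x, V_of o (nz I) a x -> dir o x k].
    move=> mf; have [a [p fp]] := irreducible_mono_cokernel hI dM dN irf mf.
    by have [k Vk deep] := V_set_deep (nz_nonzero_paths hI) a; exists a, k, p.
  have back j : is_min_det I f (proj_at I j) -> mono f.
    by move=> md; apply: min_det_projective_mono md (proj_at_projective hI j).
  apply: all_iff_star.
  - move=> /H[a [k [p [fp Vk deep]]]].
    have [X [f1 [p1 [dX irf1 fp1]]]] := projective_mono_exists hI a.
    exists (src o a), k, X, f1; split=> //; first by case: fp1.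
      exact: min_det_mono fp Vk deep.
    by apply: (min_det_mono hI _ fp1) => //; case: (proj_at_projective hI (src o a)).
  - move=> /H[a [k [p [fp Vk deep]]]].
    have [u [k' [v uv]]] := UNV_exists hI a.
    have [f2 [p2 [as2 md _ _]]] := string_seq_exists hI uv.
    exists a, u, k', v, f2, p2, k; split=> //; last exact: md.
    exact: min_det_mono fp Vk deep.
  - by move=> [i [j [X [f1 [_ _ _ /back]]]]].
  - by move=> [a [u [k [v [f2 [p2 [j [_ _ /back]]]]]]]].
apply: all_iff_star.
- move=> eg; have [a [j jg]] := irreducible_epi_kernel hI dM dN irg eg.
  have [mV tV uV] := min_det_epi hI jg.
  have [Y [g1 [j1 [dY irg1 jg1]]]] := injective_epi_exists hI a.
  have [mV1 _ _] := min_det_epi hI jg1.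
  exists (tgt o a), Y, g1; split.
    by split=> //; [case: jg1|exists (thin K o (V_of o (nz I) a))].
  (* A competitor has as determiner some M(V_a') isomorphic to M(V_a), so a' is [a] and both kernels
     are M(U_a). *)
  move=> i' Y' g1' [dY' irg1' eg1' [D [mD mD']]].
  have [a' [j' jg1']] := irreducible_epi_kernel hI (inj_at_indec hI i') dY' irg1' eg1'.
  have [_ _ uV'] := min_det_epi hI jg1'.
  have eV := thin_iso_support (isomorphic_trans (isomorphic_sym (uV _ mD)) (uV' _ mD')).
  have ea := V_set_inj hI eV; subst a'.
  exact: injective_source_unique jg1 jg1'.
- move=> eg; have [a [j jg]] := irreducible_epi_kernel hI dM dN irg eg.
  have [mV tV uV] := min_det_epi hI jg.
  have [u [k [v uv]]] := UNV_exists hI a; have [_ _ eV] := UNV_reps hI uv.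
  have [f2 [g2 [as2 _ md ti]]] := string_seq_exists hI uv.
  exists a, u, k, v, f2, g2; split.
    split=> //; first by split=> //; rewrite eV.
    rewrite eV; have [nzV _] := V_indec hI a; split=> //; last exact: V_indec.
    exact: V_not_projective.
  (* Once the arrows agree, the string data agree literally, and the two sequences have the same
     terms. *)
  move=> a' u' k' v' f2' g2' [uv' as2' [md' _ _] _].
  have [_ _ eV'] := UNV_reps hI uv'; rewrite eV' in md'.
  have ea := V_set_inj hI (thin_iso_support (isomorphic_sym (uV _ md'))); subst a'.
  have [eu ek ev] := UNV_unique hI uv uv'; subst u' k' v'.
  have [_ ex _ _] := as2; have [_ ex' _ _] := as2'.
  exact: (string_seq_unique hI uv ex ex').
- move=> [i [Y [g1 [[dY irg1 eg1 [D [mD mD1]]] _]]]].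
  apply: min_det_nonprojective_epi irg mD _ => // pD.
  have [a [j jg1]] := irreducible_epi_kernel hI (inj_at_indec hI i) dY irg1 eg1.
  have [_ _ uV] := min_det_epi hI jg1.
  exact: V_not_projective (projective_iso (uV _ mD1) pD).
move=> [a [u [k [v [f2 [g2 [[_ _ [md _ _] [_ nV _]] _]]]]]]].
exact: min_det_nonprojective_epi irg md nV.
Qed.
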